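(* Let $(\mathbf F,\mathbf f)$ be a constant coefficient subequation-operator pair on $\mathbb R^n$ which is both compatible and tame. Suppose $(F,f)$ is a subequation with operator which is jet-equivalent to $(\mathbf F,\mathbf f)$ on an open set $X\subset\mathbb R^n$. Then for any continuous admissible inhomogeneous term $\psi\in C(X)$ (i.e. $\psi(X)\subset\mathbf f(\mathbf F)$), weak comparison holds on $X$ for the inhomogeneous subequation $F_f(\psi)=\{J\in F: f(J)\ge\psi\}$.
   Context: $\mathrm{Sym}^2(\mathbb R^n)$ is the space of real symmetric $n\times n$ matrices and $\mathbf J^2=\mathbb R\oplus\mathbb R^n\oplus \mathrm{Sym}^2(\mathbb R^n)$ with elements $(r,p,A)$. A constant coefficient subequation is a closed set $\mathbf F\subset\mathbf J^2$ with (P) $\mathbf F+(0,0,P)\subset\mathbf F$ for all $P\ge0$; (N) $\mathbf F+(-r,0,0)\subset\mathbf F$ for all $r\ge 0$; (T) $\mathbf F=\overline{\mathrm{Int}\,\mathbf F}$. An operator on it is a function $\mathbf f\in C(\mathbf F)$. It is tame if for all $s,\lambda>0$ there is $c(s,\lambda)>0$ with $\mathbf f(J+(-r,0,P))-\mathbf f(J)\ge c(s,\lambda)$ for all $J\in\mathbf F$, $r\ge s$, $P\ge\lambda I$. The pair is compatible if (when $\mathbf F\ne\mathbf J^2$) $\partial\mathbf F=\{\mathbf f=c_0\}$ for some $c_0\in\mathbb R$. For $X\subset\mathbb R^n$ open, $J^2(X)=X\times\mathbf J^2$ and $J^2_xu=(x,u(x),D_xu,D_x^2u)$. A jet-equivalence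 is a bundle automorphism $\Phi(x,r,p,A)=(x,r,g(x)p,h(x)Ah(x)^t+L_x(p))$ with $g,h:X\to \mathrm{GL}_n(\mathbb R)$, $L:X\to\mathrm{Hom}(\mathbb R^n,\mathrm{Sym}^2(\mathbb R^n))$ smooth (or at least Lipschitz continuous). For closed $F\subset J^2(X)$ and $f\in C(F)$, $(F,f)$ is jet-equivalent to $(\mathbf F,\mathbf f)$ on $X$ if for some such $\Phi$, $\Phi(F)=X\times\mathbf F$ and $f=\mathbf f\circ\Phi$ (with $\mathbf f$ applied to the $\mathbf J^2$-component). The dual of a subequation $G\subset J^2(X)$ is $\widetilde G=-(\sim\mathrm{Int}\,G)$, $\sim$ denoting complement. An upper semicontinuous $[-\infty,\infty)$-valued function $u$ is $G$-subharmonic on an open set if $J^2_x\phi\in G$ for every point $x$ of it and every $C^2$ function $\phi$ near $x$ with $u\le\phi$ near $x$, $u(x)=\phi(x)$; $G(Y)$ is the set of such functions on $Y$ (and similarly for any subset of $J^2(X)$ in place of $G$). Fix a metric on the bundle $J^2(X)$. For $c>0$, $G^c$ has fibres $G^c_x=\{J\in G_x:\mathrm{dist}(J,\sim G_x)\ge c\}=\{J\in G_x: J+\eta\in G_x\ \forall\,\|\eta\|\le c\}$. Weak comparison holds for $G$ on an open set $Y\subset X$ if there is a $c>0$ such that for all $u\in G^c(Y)$, $v\in\widetilde G(Y)$ and all $\Omega\subset\subset Y$: $u+v\le0$ on $\partial\Omega$ implies $u+v\le0$ on $\overline\Omega$. *)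

(* Defs.v *)
From mathcomp Require Import all_boot all_order all_algebra.
From mathcomp Require Import all_classical all_reals all_analysis.

Set Implicit Arguments.
Unset Strict Implicit.
Unset Printing Implicit Defensive.

Import Order.TTheory GRing.Theory Num.Theory.
Import numFieldNormedType.Exports.
Local Open Scope classical_set_scope.
Local Open Scope ring_scope.

(* Reduced 2-jets (r, p, A).  Symmetry of A is not part of the type: the space
   J^2 = R + R^n + Sym^2(R^n) is the closed linear subspace [sym_jets], and
   every interior, closure, ... of a set of jets is taken relative to it
   (resp. relative to J^2(X) = X `*` sym_jets), see [int_in], [cl_in]. *)
Notation jet R n := (R * 'cV[R]_n * 'M[R]_n)%type.

(* [subspace D] carries the topology induced on D, so for A `<=` D these are
   the topological notions of D. *)
Definition closed_in (T : topologicalType) (D A : set T) : Prop :=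
  closed (A : set (subspace D)).
Definition int_in (T : topologicalType) (D A : set T) : set T :=
  interior (A : set (subspace D)).
Definition cl_in (T : topologicalType) (D A : set T) : set T :=
  closure (A : set (subspace D)).
Definition bdry_in (T : topologicalType) (D A : set T) : set T :=
  cl_in D A `\` int_in D A.

Section Jets.
Context (R : realType) (n : nat).

Definition sym_mx (A : 'M[R]_n) : Prop := A^T = A.

Definition psd (P : 'M[R]_n) : Prop :=
  sym_mx P /\ forall v : 'cV[R]_n, 0 <= (v^T *m P *m v) 0 0.

Definition sym_jets : set (jet R n) := [set J | sym_mx J.2].

Definition jet_bundle (X : set 'cV[R]_n) : set ('cV[R]_n * jet R n) :=
  X `*` sym_jets.

Definition fibre (F : set ('cV[R]_n * jet R n)) (x : 'cV[R]_n) : set (jet R n) :=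
  [set J | F (x, J)].

Definition positivity (F : set (jet R n)) : Prop :=
  forall J (P : 'M[R]_n), F J -> psd P -> F (J + (0, 0, P)).

Definition negativity (F : set (jet R n)) : Prop :=
  forall J (r : R), F J -> 0 <= r -> F (J + (- r, 0, 0)).

Record const_subequation (F : set (jet R n)) : Prop := ConstSubequation {
  const_sub_jets : F `<=` sym_jets ;
  const_closed : closed_in sym_jets F ;
  const_P : positivity F ;
  const_N : negativity F ;
  const_T : F = cl_in sym_jets (int_in sym_jets F) }.

(* For variable coefficients the topological condition (T) of Harvey and Lawson
   has three parts: one for F in the total space, and two for its fibres. *)
Record subequation (X : set 'cV[R]_n) (F : set ('cV[R]_n * jet R n)) : Prop :=
  Subequation {
  subeq_sub_bundle : F `<=` jet_bundle X ;
  subeq_closed : closed_in (jet_bundle X) F ;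
  subeq_P : forall x, X x -> positivity (fibre F x) ;
  subeq_N : forall x, X x -> negativity (fibre F x) ;
  subeq_T : F = cl_in (jet_bundle X) (int_in (jet_bundle X) F) ;
  subeq_T_fibre : forall x, X x ->
    fibre F x = cl_in sym_jets (int_in sym_jets (fibre F x)) ;
  subeq_T_int : forall x, X x ->
    int_in sym_jets (fibre F x) = fibre (int_in (jet_bundle X) F) x }.

Definition tame (F : set (jet R n)) (f : jet R n -> R) : Prop :=
  forall s lambda : R, 0 < s -> 0 < lambda ->
  exists2 c : R, 0 < c &
    forall J (r : R) (P : 'M[R]_n), F J -> s <= r ->
      psd (P - lambda%:M) -> c <= f (J + (- r, 0, P)) - f J.

Definition compatible (F : set (jet R n)) (f : jet R n -> R) : Prop :=
  F <> sym_jets ->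
  exists c0 : R, bdry_in sym_jets F = [set J | F J /\ f J = c0].

Definition locally_lipschitz (W : normedModType R) (X : set 'cV[R]_n)
    (f : 'cV[R]_n -> W) : Prop :=
  forall x, X x ->
  exists2 U : set 'cV[R]_n, nbhs x U & [lipschitz f y | y in U `&` X].

Definition jet_map (g h : 'cV[R]_n -> 'M[R]_n)
    (L : 'cV[R]_n -> {linear 'cV[R]_n -> 'M[R]_n})
    (z : 'cV[R]_n * jet R n) : 'cV[R]_n * jet R n :=
  let: (x, (r, p, A)) := z in
  (x, (r, g x *m p, h x *m A *m (h x)^T + L x p)).

(* Local Lipschitz continuity covers both the smooth and the Lipschitz case.
   As Hom(R^n, Sym^2) is finite dimensional, x |-> L x is locally Lipschitz iff
   each x |-> L x p is. *)
Definition jet_equivalence (X : set 'cV[R]_n) (g h : 'cV[R]_n -> 'M[R]_n)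
    (L : 'cV[R]_n -> {linear 'cV[R]_n -> 'M[R]_n}) : Prop :=
  [/\ forall x, X x -> g x \in unitmx /\ h x \in unitmx,
      forall x, X x -> forall p, sym_mx (L x p),
      locally_lipschitz X g,
      locally_lipschitz X h &
      forall p, locally_lipschitz X (fun x => L x p)].

Definition jet_equivalent (X : set 'cV[R]_n)
    (F : set ('cV[R]_n * jet R n)) (f : 'cV[R]_n * jet R n -> R)
    (F0 : set (jet R n)) (f0 : jet R n -> R) : Prop :=
  exists (g h : 'cV[R]_n -> 'M[R]_n)
         (L : 'cV[R]_n -> {linear 'cV[R]_n -> 'M[R]_n}),
    [/\ jet_equivalence X g h L,
        jet_map g h L @` F = X `*` F0 &
        forall z, F z -> f z = f0 (jet_map g h L z).2].

Definition dual (X : set 'cV[R]_n) (G : set ('cV[R]_n * jet R n)) :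
    set ('cV[R]_n * jet R n) :=
  [set z | jet_bundle X z /\ ~ int_in (jet_bundle X) G (z.1, - z.2)].

Definition inhomogeneous (F : set ('cV[R]_n * jet R n))
    (f : 'cV[R]_n * jet R n -> R) (psi : 'cV[R]_n -> R) :
    set ('cV[R]_n * jet R n) :=
  [set z | F z /\ psi z.1 <= f z].

Definition partial (i : 'I_n) (phi : 'cV[R]_n -> R) : 'cV[R]_n -> R :=
  fun x => 'D_(delta_mx i 0) phi x.

Definition C2_near (x : 'cV[R]_n) (phi : 'cV[R]_n -> R) : Prop :=
  \forall y \near x,
    [/\ differentiable phi y,
        forall i, differentiable (partial i phi) y &
        forall i j, {for y, continuous (partial j (partial i phi))}].

Definition jet2 (phi : 'cV[R]_n -> R) (x : 'cV[R]_n) : jet R n :=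
  (phi x, \col_i partial i phi x, \matrix_(i, j) partial j (partial i phi) x).

Definition usc_on (Y : set 'cV[R]_n) (u : 'cV[R]_n -> \bar R) : Prop :=
  forall x, Y x -> forall a : R, (u x < a%:E)%E ->
    \forall y \near within Y (nbhs x), (u y < a%:E)%E.

(* G(Y) for Y open; only the values of u on Y matter. *)
Definition subharmonic (G : set ('cV[R]_n * jet R n)) (Y : set 'cV[R]_n)
    (u : 'cV[R]_n -> \bar R) : Prop :=
  [/\ forall x, Y x -> (u x < +oo)%E,
      usc_on Y u &
      forall x (phi : 'cV[R]_n -> R), Y x -> C2_near x phi ->
        (\forall y \near x, (u y <= (phi y)%:E)%E) ->
        u x = (phi x)%:E -> G (x, jet2 phi x)].

(* A continuous field of inner products on the fibres J^2_x, x in X. *)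
Record bundle_metric (X : set 'cV[R]_n)
    (m : 'cV[R]_n -> jet R n -> jet R n -> R) : Prop := BundleMetric {
  metric_sym : forall x J K, X x -> sym_jets J -> sym_jets K ->
    m x J K = m x K J ;
  metric_lin : forall x (a : R) J K I, X x ->
    sym_jets J -> sym_jets K -> sym_jets I ->
    m x (a *: J + K) I = a * m x J I + m x K I ;
  metric_pos : forall x J, X x -> sym_jets J -> J != 0 -> 0 < m x J J ;
  metric_cont : forall J K, sym_jets J -> sym_jets K ->
    {within X, continuous (fun x => m x J K)} }.

Definition metric_norm (m : 'cV[R]_n -> jet R n -> jet R n -> R)
    (x : 'cV[R]_n) (J : jet R n) : R := Num.sqrt (m x J J).

(* The set G^c: as G has closed fibres, this says dist(J, ~ G_x) >= c. *)
Definition strict_part (m : 'cV[R]_n -> jet R n -> jet R n -> R)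
    (G : set ('cV[R]_n * jet R n)) (c : R) : set ('cV[R]_n * jet R n) :=
  [set z | G z /\ forall eta, sym_jets eta -> metric_norm m z.1 eta <= c ->
     G (z.1, z.2 + eta)].

Definition weak_comparison (X : set 'cV[R]_n)
    (m : 'cV[R]_n -> jet R n -> jet R n -> R)
    (G : set ('cV[R]_n * jet R n)) (Y : set 'cV[R]_n) : Prop :=
  exists2 c : R, 0 < c &
    forall u v : 'cV[R]_n -> \bar R,
      subharmonic (strict_part m G c) Y u -> subharmonic (dual X G) Y v ->
    forall Omega : set 'cV[R]_n,
      open Omega -> compact (closure Omega) -> closure Omega `<=` Y ->
      (forall x, (closure Omega `\` Omega) x -> (u x + v x <= 0)%E) ->
      forall x, closure Omega x -> (u x + v x <= 0)%E.

End Jets.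

(* Main.v *)
(** The doubling-of-variables argument with strictness.  Writing
    [Theta eps] for the maximum over [K * K] of
    [u x + v y - |x - y|^2 / (6 eps)], monotonicity in [eps] and the lower bound
    by a positive value of [u + v] give arbitrarily small [eps] at which
    [Theta (2 eps) - Theta eps] is small, hence near-maximum points with
    [|x - y|^2 / eps] small.  The jets of [u] and [v] there are carried by the
    jet-equivalence to the constant coefficient model, where the errors are of
    order [|x - y|^2 / eps] and [|x - y| |p|]; room for them comes from the
    strictness of [u] (a perturbation of size [omega] of its jet stays in the
    set), and the remaining positivity [lam I] together with the gap
    [u x + v y > 0] is turned by tameness into a definite increase of the
    operator, which beats the oscillation of [psi].

    The second order information at the maximum does not use Alexandrov's
    theorem.  To slide a quadratic until it touches a semiconvex function [w], it
    is enough that [w] be within [tau r^2] of that quadratic on a single ball of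
    radius [r].  By duality this reduces to finding a scale at which a convex
    function [H] is nearly quadratic.  Second difference quotients at step [2 r]
    are averages of those at step [r], so the defects in Jensen's inequality for
    [t / (1 + t)] telescope over dyadic scales: at some scale all second
    difference quotients are almost constant, and an ultrafilter limit of
    rescalings of [H] has vanishing third differences, i.e. is quadratic. *)
Require Import Defs.
From mathcomp Require Import all_boot all_order all_algebra.
From mathcomp Require Import all_classical all_reals all_analysis.
From mathcomp Require Import ring lra zify.
Import Order.TTheory GRing.Theory Num.Theory.
Import numFieldNormedType.Exports.
Local Open Scope classical_set_scope.
Local Open Scope ring_scope.
Set Implicit Arguments.
Unset Strict Implicit.
Unset Printing Implicit Defensive.

(** * Functions with vanishing third differences *)

(** The pigeonhole over scales chooses the place together with the scale, and a semiconvex function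
    need not be concave near an arbitrary point close to its maximum. It is therefore run in the
    space of slopes, on the conjugate $H$ of [w]: every slope $q$ near 0 is admissible there, its
    contact point is close to the maximum, and the Hessian $-S^{-1}$ of the quadratic found for [w]
    has the right sign. Semiconvexity of [w] makes $S$ invertible, and it also gives the lower bound
    through which lattice samples of $H$ control [w] on a whole ball.

    The constant $6\varepsilon$ is $3\cdot 2\varepsilon$: [u] and [v] are replaced by
    sup-convolutions, so $x$ and $y$ are joined through two auxiliary points, and three penalties
    with parameter $2\varepsilon$ have $|x-y|^2/(6\varepsilon)$ as minimal sum.

    Two features shape the final estimate. Tameness compares jets with the same gradient, so the two
    transported gradients must be made equal exactly, at the expense of the strictness of [u]. And a
    jet is in the dual when its negative is not interior, so a whole neighbourhood of that negative
    has to be shown to lie in the set. *)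

Section Dot.
Context {R : realType} {n : nat}.
Implicit Types x y z : 'cV[R]_n.

Definition dot x y : R := (x^T *m y) 0 0.

Lemma dotE x y : dot x y = \sum_i x i 0 * y i 0.
Proof. by rewrite /dot mxE; apply: eq_bigr => i _; rewrite mxE. Qed.

Lemma dotC x y : dot x y = dot y x.
Proof. by rewrite !dotE; apply: eq_bigr => i _; rewrite mulrC. Qed.

Lemma dotDl x y z : dot (x + y) z = dot x z + dot y z.
Proof. by rewrite /dot linearD mulmxDl mxE. Qed.

Lemma dotDr x y z : dot z (x + y) = dot z x + dot z y.
Proof. by rewrite /dot mulmxDr mxE. Qed.

Lemma dotNl x y : dot (- x) y = - dot x y.
Proof. by rewrite /dot linearN mulNmx mxE. Qed.

Lemma dotNr x y : dot x (- y) = - dot x y.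
Proof. by rewrite /dot mulmxN mxE. Qed.

Lemma dotZl a x y : dot (a *: x) y = a * dot x y.
Proof. by rewrite /dot linearZ -scalemxAl mxE. Qed.

Lemma dotZr a x y : dot x (a *: y) = a * dot x y.
Proof. by rewrite /dot -scalemxAr mxE. Qed.

Lemma dot0l x : dot 0 x = 0.
Proof. by rewrite /dot linear0 mul0mx mxE. Qed.

Lemma dot0r x : dot x 0 = 0.
Proof. by rewrite dotC dot0l. Qed.

Definition dot_lin := (dotDl, dotDr, dotNl, dotNr, dotZl, dotZr, dot0l, dot0r).

Lemma dot_ge0 x : 0 <= dot x x.
Proof. by rewrite dotE sumr_ge0 // => i _; rewrite -expr2 sqr_ge0. Qed.

Lemma dot_sym (S : 'M[R]_n) x y : S^T = S -> dot (S *m x) y = dot x (S *m y).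
Proof. by move=> Ssym; rewrite /dot trmx_mul Ssym mulmxA. Qed.

Lemma dot_trl (S : 'M[R]_n) x y : dot (S *m x) y = dot x (S^T *m y).
Proof. by rewrite /dot trmx_mul mulmxA. Qed.

Lemma dot_delta x i : dot x (delta_mx i 0) = x i 0.
Proof.
rewrite dotE (bigD1 i) //= mxE !eqxx mulr1 big1 ?addr0 // => j ji.
by rewrite mxE (negbTE ji) mulr0.
Qed.

End Dot.

Section ThirdDifferences.
Context {R : realType}.

Definition second_diff (V : zmodType) (f : V -> R) (e z : V) : R :=
  f (z + e) + f (z - e) - 2 * f z.

(* The third difference along [e] vanishes on every line of direction [e];
   applied to the four directions e, x, x + e and x - e. *)
Lemma second_diff_const (V : zmodType) (f : V -> R) :
  (forall e z, second_diff f e (z + e) = second_diff f e z) ->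
  forall e x z, second_diff f e (z + x) = second_diff f e z.
Proof.
move=> T e x z.
pose F (s t : int) := f (z + x *~ s + e *~ t).
have TF a b s t : F (s + a + a) (t + b + b) - 3 * F (s + a) (t + b)
     + 3 * F s t - F (s - a) (t - b) = 0.
  have shift s' t' : z + x *~ (s' + a) + e *~ (t' + b) =
      z + x *~ s' + e *~ t' + (x *~ a + e *~ b).
    rewrite !mulrzDr -!addrA; congr (_ + (_ + _)).
    by rewrite addrCA.
  have shiftN : z + x *~ (s - a) + e *~ (t - b) =
      z + x *~ s + e *~ t - (x *~ a + e *~ b).
    rewrite !mulrzDr !mulrNz opprD -!addrA; congr (_ + (_ + _)).
    by rewrite addrCA.
  have := T (x *~ a + e *~ b) (z + x *~ s + e *~ t).
  rewrite /second_diff /F !shift shiftN addrK => h; lra.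
(* On the grid spanned by [x] and [e], all values outside the conclusion cancel in a rational
   combination of these eight identities. *)
have t1 : F (-2) 1 - 3 * F (-2) 0 + 3 * F (-2) (-1) - F (-2) (-2) = 0 :=
  TF 0 1 (-2) (-1).
have t2 : F 1 1 - 3 * F 1 0 + 3 * F 1 (-1) - F 1 (-2) = 0 := TF 0 1 1 (-1).
have t3 : F 1 2 - 3 * F 1 1 + 3 * F 1 0 - F 1 (-1) = 0 := TF 0 1 1 0.
have t4 : F 1 (-1) - 3 * F 0 (-1) + 3 * F (-1) (-1) - F (-2) (-1) = 0 :=
  TF 1 0 (-1) (-1).
have t5 : F 1 0 - 3 * F 0 0 + 3 * F (-1) 0 - F (-2) 0 = 0 := TF 1 0 (-1) 0.
have t6 : F 1 1 - 3 * F 0 0 + 3 * F (-1) (-1) - F (-2) (-2) = 0 :=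
  TF 1 1 (-1) (-1).
have t7 : F 1 2 - 3 * F 0 1 + 3 * F (-1) 0 - F (-2) (-1) = 0 := TF 1 1 (-1) 0.
have t8 : F 1 (-2) - 3 * F 0 (-1) + 3 * F (-1) 0 - F (-2) 1 = 0 :=
  TF 1 (-1) (-1) 0.
have -> : second_diff f e (z + x) = F 1 1 + F 1 (-1) - 2 * F 1 0.
  by rewrite /second_diff /F mulr1z mulr0z addr0 mulrN1z mulr1z.
have -> : second_diff f e z = F 0 1 + F 0 (-1) - 2 * F 0 0.
  by rewrite /second_diff /F !mulr0z !addr0 mulrN1z mulr1z.
lra.
Qed.

(* Polarization, as for the parallelogram law. *)
Lemma third_diff_eq0 (V : zmodType) (f : V -> R) :
  (forall e z, second_diff f e (z + e) = second_diff f e z) ->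
  forall x y w, f (x + y + w) - f (x + y) - f (x + w) - f (y + w)
     + f x + f y + f w - f 0 = 0.
Proof.
move=> /second_diff_const C x y w.
(* In the sum of the identities for [x] and [y] minus the one for [x - y], the values at
   [w + x - y], [w + y - x], [x - y] and [y - x] cancel; twice the claim remains. *)
have := C x w y; have := C y w x; have := C (x - y) w 0.
rewrite /second_diff !add0r !opprB.
have -> : y + w + x = x + y + w by rewrite addrAC [y + x]addrC.
have -> : x + w + y = x + y + w by rewrite addrAC.
have -> : y + x = x + y by rewrite addrC.
have -> : w + (x - y) = x + w - y by rewrite addrCA addrA.
have -> : w + (y - x) = y + w - x by rewrite addrCA addrA.
lra.
Qed.

Definition int_vec n (z : 'cV[int]_n) : 'cV[R]_n := map_mx intr z.

Lemma int_vecD n (x y : 'cV[int]_n) : int_vec (x + y) = int_vec x + int_vec y.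
Proof. exact: map_mxD. Qed.

Lemma int_vecN n (x : 'cV[int]_n) : int_vec (- x) = - int_vec x.
Proof. exact: map_mxN. Qed.

Lemma int_vec0 n : int_vec 0 = 0 :> 'cV[R]_n.
Proof. exact: map_mx0. Qed.

Lemma int_vec_delta n (i : 'I_n) :
  int_vec (delta_mx i 0) = delta_mx i 0 :> 'cV[R]_n.
Proof. by apply/matrixP => j k; rewrite !mxE; case: (_ && _). Qed.

Lemma int_vecMn n (x : 'cV[int]_n) k : int_vec (x *+ k) = k%:R *: int_vec x.
Proof.
elim: k => [|k IH]; first by rewrite mulr0n int_vec0 scale0r.
by rewrite mulrS int_vecD IH (mulrS 1) scalerDl scale1r.
Qed.

Lemma additive_int_vec n (l : 'cV[int]_n -> R) :
  (forall x y, l (x + y) = l x + l y) ->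
  forall z, l z = \sum_i (z i 0)%:~R * l (delta_mx i 0).
Proof.
move=> lD z.
have l0 : l 0 = 0.
  have h := lD 0 0; rewrite addr0 in h.
  by apply: (addrI (l 0)); rewrite -h addr0.
have lN x : l (- x) = - l x.
  have h := lD x (- x); rewrite subrr l0 in h.
  by apply/eqP; rewrite -addr_eq0 addrC -h.
have lMn x k : l (x *+ k) = k%:R * l x.
  elim: k => [|k IH]; first by rewrite mulr0n l0 mul0r.
  by rewrite mulrS lD IH (mulrS 1) mulrDl mul1r.
have lZ x (k : int) : l (x *~ k) = k%:~R * l x.
  case: k => k; first by rewrite -pmulrn lMn pmulrn.
  by rewrite NegzE mulrNz lN -pmulrn lMn mulrNz mulNr.
have lsum (I : finType) (F : I -> 'cV[int]_n) :
    l (\sum_i F i) = \sum_i l (F i).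
  exact: (big_morph l lD l0).
have {1}-> : z = \sum_i (delta_mx i 0) *~ (z i 0).
  apply/matrixP => i j; rewrite ord1 summxE (bigD1 i) //= big1 ?addr0.
    by rewrite -scaler_int !mxE !eqxx intz mulr1.
  by move=> k ki; rewrite -scaler_int !mxE eq_sym (negbTE ki) mulr0.
by rewrite lsum; apply: eq_bigr => i _; rewrite lZ.
Qed.

(** The polar form is biadditive, and what it leaves of [f] is additive. On the lattice additivity
    is already linearity, so no regularity of [f] is needed; this is why the blow-ups are sampled at
    integer points only. *)
Lemma quadratic_of_third_diff n (f : 'cV[int]_n -> R) :
  (forall e z, second_diff f e (z + e) = second_diff f e z) ->
  exists (b : 'cV[R]_n) (S : 'M[R]_n), S^T = S /\
    forall z, f z = f 0 + dot b (int_vec z)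
                  + 2^-1 * dot (int_vec z) (S *m int_vec z).
Proof.
move=> /third_diff_eq0 T.
pose B x y := f (x + y) - f x - f y + f 0.
have Bsym x y : B x y = B y x by rewrite /B [y + x]addrC; ring.
have BD y x x' : B (x + x') y = B x y + B x' y.
  by have := T x x' y; rewrite /B => h; lra.
pose L z := f z - f 0 - 2^-1 * B z z.
have LD x y : L (x + y) = L x + L y.
  have h : B (x + y) (x + y) = B x x + 2 * B x y + B y y.
    by rewrite BD !(Bsym _ (x + y)) !BD (Bsym y x); ring.
  by rewrite /L h /B; field.
exists (\col_i L (delta_mx i 0)).
exists (\matrix_(i, j) B (delta_mx i 0) (delta_mx j 0)); split.
  by apply/matrixP => i j; rewrite !mxE Bsym.
move=> z; have -> : f z = f 0 + L z + 2^-1 * B z z by rewrite /L; ring.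
congr (_ + _ + _ * _).
  rewrite (additive_int_vec LD) dotE; apply: eq_bigr => i _.
  by rewrite !mxE mulrC.
rewrite (additive_int_vec (BD z)) dotE; apply: eq_bigr => i _.
rewrite !mxE; congr (_ * _); rewrite Bsym (additive_int_vec (BD _)).
by apply: eq_bigr => j _; rewrite !mxE mulrC Bsym.
Qed.

End ThirdDifferences.

(** * A scale at which a convex function is nearly quadratic *)

Section Boxes.
Context {n : nat}.
Local Notation V := ('cV[int]_n).

(** An explicit duplicate-free list, because ['cV[int]_n] is not finite and sums over lattice cubes
    are needed. *)
Definition box (L : nat) : seq V :=
  [seq \col_i ((f i : nat)%:Z - L%:Z) | f : {ffun 'I_n -> 'I_(L.*2.+1)}].

Lemma size_box L : size (box L) = (L.*2.+1 ^ n)%N.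
Proof. by rewrite size_image card_ffun !card_ord. Qed.

Lemma mem_box L (z : V) : (z \in box L) = [forall i, (absz (z i 0%R) <= L)%N].
Proof.
rewrite /box; apply/fintype.imageP/forallP => [[f _ ->] i|zL].
  by rewrite mxE; move: (f i) => [k /= kL]; lia.
have zi i : (absz (z i 0%R + L%:Z)%R < L.*2.+1)%N by have := zL i; lia.
exists [ffun i => Ordinal (zi i)] => //.
apply/matrixP => i j; rewrite ord1 mxE ffunE /=.
by have := zL i; lia.
Qed.

Lemma box_uniq L : uniq (box L).
Proof.
rewrite map_inj_uniq ?enum_uniq // => f g /matrixP fg.
apply/ffunP => i; apply/val_inj.
by have := fg i 0; rewrite !mxE => /addIr [].
Qed.

Lemma box_sub L L' : (L <= L')%N -> {subset box L <= box L'}.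
Proof.
move=> LL' z; rewrite !mem_box => /forallP zL; apply/forallP => i.
exact: leq_trans LL'.
Qed.

Lemma boxD L L' (z v : V) :
  z \in box L -> v \in box L' -> z + v \in box (L + L').
Proof.
rewrite !mem_box => /forallP zL /forallP vL; apply/forallP => i.
by rewrite mxE; move: (zL i) (vL i); move: (z i 0) (v i 0) => a b; lia.
Qed.

Lemma boxN L (z : V) : (- z \in box L) = (z \in box L).
Proof.
by rewrite !mem_box; under eq_forallb do rewrite mxE abszN.
Qed.

Lemma boxMn L (z : V) k : z \in box L -> z *+ k \in box (k * L).
Proof.
rewrite !mem_box => /forallP zL; apply/forallP => i.
by rewrite mulmxnE -mulr_natr abszM natz absz_nat mulnC leq_mul.
Qed.

Lemma box_delta (i : 'I_n) : delta_mx i 0 \in box 1.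
Proof. by rewrite mem_box; apply/forallP => j; rewrite mxE; case: (_ && _). Qed.

Definition sup_norm (z : V) : nat := \max_i absz (z i 0%R).

Lemma mem_box_norm L (z : V) : (z \in box L) = (sup_norm z <= L)%N.
Proof.
rewrite mem_box; apply/forallP/bigmax_leqP => [h i _|h i]; exact: h.
Qed.

Lemma size_box_mul c L :
  (0 < c)%N -> (size (box (c * L)) <= c ^ n * size (box L))%N.
Proof.
move=> c0; rewrite !size_box -expnMn; case: (posnP n) => [->|n0] //.
by rewrite leq_exp2r //; nia.
Qed.

End Boxes.

(** * Averages over nested lattice cubes *)

Section BoxSums.
Context {R : realType} {n : nat}.
Local Notation V := ('cV[int]_n).

Lemma ler_sum_subset (T : eqType) (s t : seq T) (a : T -> R) :
  uniq s -> {subset s <= t} -> (forall z, 0 <= a z) ->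
  \sum_(z <- s) a z <= \sum_(z <- t) a z.
Proof.
elim: s t => [|x s IH] t /=; first by move=> _ _ a0; rewrite big_nil sumr_ge0.
move=> /andP[xs us] st a0.
have xt : x \in t by apply: st; rewrite mem_head.
rewrite big_cons (perm_big _ (perm_to_rem xt)) big_cons lerD2l.
apply: IH => // y ys.
have := st y; rewrite inE ys orbT => /(_ isT).
rewrite (perm_mem (perm_to_rem xt)) inE => /orP[/eqP yx|//].
by rewrite -yx ys in xs.
Qed.

Lemma ler_sum_shift (a : V -> R) (v : V) L E L' :
  (forall z, 0 <= a z) -> v \in box E -> (L + E <= L')%N ->
  \sum_(z <- box L) a (z + v) <= \sum_(z <- box L') a z.
Proof.
move=> a0 vE LEL'.
rewrite -(big_map (fun z => z + v) predT a).
apply: ler_sum_subset => //.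
  by rewrite map_inj_uniq ?box_uniq //; exact: addIr.
by move=> _ /mapP[z zL ->]; apply: (box_sub LEL'); exact: boxD.
Qed.

Lemma ler_shift_sum (a : V -> R) (v : V) L E L' :
  (forall z, 0 <= a z) -> v \in box E -> (L + E <= L')%N ->
  \sum_(z <- box L) a z <= \sum_(z <- box L') a (z + v).
Proof.
move=> a0 vE LEL'.
have := @ler_sum_shift (fun z => a (z + v)) (- v) L E L'.
rewrite boxN; under eq_bigr do rewrite subrK.
by apply.
Qed.

Lemma ler_sum_box (a : V -> R) L L' :
  (forall z, 0 <= a z) -> (L <= L')%N ->
  \sum_(z <- box L) a z <= \sum_(z <- box L') a z.
Proof.
by move=> a0 LL'; exact: (ler_sum_subset (box_uniq L) (box_sub LL') a0).
Qed.

(* The boxes grow by the step of the averaging, so that no boundary terms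
   appear and the defects telescope over the scales. *)
Lemma nested_box_sum (a d : nat -> V -> R) (e : V) (L E J : nat) :
  e \in box E -> (forall j z, 0 <= a j z) -> (forall j z, 0 <= d j z) ->
  (forall j z, a j.+1 z =
     (a j (z + e *+ (2 ^ j)%N) + 2 * a j z + a j (z - e *+ (2 ^ j)%N)) / 4
     + d j z) ->
  forall j, (j <= J)%N ->
  \sum_(z <- box (L + 2 ^ j * E)) a j z
    + \sum_(j <= i < J) \sum_(z <- box L) d i z
  <= \sum_(z <- box (L + 2 ^ J * E)) a J z.
Proof.
move=> eE a0 d0 step; elim: J => [|J IH] j.
  by rewrite leqn0 => /eqP ->; rewrite big_geq // addr0.
rewrite leq_eqVlt => /orP[/eqP ->|]; first by rewrite big_geq // addr0.
rewrite ltnS => jJ; rewrite big_nat_recr //= addrA.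
apply: (le_trans (lerD (IH _ jJ) (lexx _))).
(* The sum at level [J.+1] is a mean, with weights 1/4, 1/2, 1/4, of three translated sums at level
   [J]; the larger cube is chosen so that each of them still covers the smaller one. *)
under [leRHS]eq_bigr do rewrite step.
rewrite big_split /= -mulr_suml !big_split /= -mulr_sumr.
apply: lerD; last by apply: ler_sum_box => //; exact: leq_addr.
have eJ := boxMn (2 ^ J) eE.
have LL : (L + 2 ^ J * E + 2 ^ J * E <= L + 2 ^ J.+1 * E)%N.
  by rewrite expnS; lia.
have h1 := ler_shift_sum (a0 J) eJ LL.
have h2 : \sum_(z <- box (L + 2 ^ J * E)) a J z <=
    \sum_(z <- box (L + 2 ^ J.+1 * E)) a J (z - e *+ (2 ^ J)).
  by apply: ler_shift_sum (a0 J) _ LL; rewrite boxN.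
have h3 : \sum_(z <- box (L + 2 ^ J * E)) a J z <=
    \sum_(z <- box (L + 2 ^ J.+1 * E)) a J z.
  by apply: ler_sum_box => //; rewrite expnS; lia.
lra.
Qed.

(** Weights of total mass at most 1 on a countable set. They allow one averaging argument to control
    all directions at once, with bounds that do not depend on how many directions are considered. *)
Lemma sum_pow_pickle_le1 (T : countType) (s : seq T) :
  uniq s -> \sum_(x <- s) (2^-1 : R) ^+ (choice.pickle x).+1 <= 1.
Proof.
move=> us.
rewrite -(big_map choice.pickle predT (fun k => (2^-1 : R) ^+ k.+1)).
pose t := map choice.pickle s; rewrite -/t.
have ut : uniq t by rewrite map_inj_uniq //; exact: (pcan_inj choice.pickleK).
pose M := (\max_(k <- t) k).+1.
apply: (@le_trans _ _ (\sum_(k <- iota 0 M) (2^-1 : R) ^+ k.+1)).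
  apply: ler_sum_subset => // k kt.
  by rewrite mem_iota /= add0n ltnS; apply: leq_bigmax_seq.
suff -> : \sum_(k <- iota 0 M) (2^-1 : R) ^+ k.+1 = 1 - 2^-1 ^+ M.
  by rewrite gerBl exprn_ge0 // invr_ge0.
elim: {ut}M => [|m IH]; first by rewrite big_nil expr0 subrr.
rewrite -addn1 iotaD big_cat /= IH big_cons big_nil addr0 add0n.
by rewrite addn1 exprS; field.
Qed.

Lemma exists_le_mean (T : eqType) (s : seq T) (a : T -> R) (C : R) :
  s != [::] -> \sum_(x <- s) a x <= C * (size s)%:R ->
  exists2 x, x \in s & a x <= C.
Proof.
move=> s0 h; apply/hasP; apply: contraT => /hasPn N.
move: h; rewrite leNgt => /negP[].
have -> : C * (size s)%:R = \sum_(x <- s) C.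
  by rewrite big_const_seq count_predT iter_addr_0 mulr_natr.
case: s s0 N => [//|x s] _ N; rewrite !big_cons.
apply: ltr_leD; first by rewrite ltNge; apply: N; exact: mem_head.
rewrite !big_seq; apply: ler_sum => y ys; apply: ltW.
by rewrite ltNge; apply: N; rewrite inE ys orbT.
Qed.

End BoxSums.

(** * The Jensen defect of a bounded concave function *)

Section Defect.
Context {R : realType}.

(** Boundedness keeps the total defect over all scales finite, strict concavity makes a small defect
    force nearly equal arguments, and a rational function gives the defect in closed form. *)
Definition sat (t : R) : R := t / (1 + t).

Definition sat_defect (a b c : R) : R :=
  sat ((a + 2 * b + c) / 4) - (sat a + 2 * sat b + sat c) / 4.

Lemma sat_ge0 t : 0 <= t -> 0 <= sat t.
Proof. by move=> t0; rewrite /sat divr_ge0 // addr_ge0. Qed.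

Lemma sat_le1 t : 0 <= t -> sat t <= 1.
Proof.
by move=> t0; rewrite /sat ler_pdivrMr ?mul1r; lra.
Qed.

(** The midpoint defect of $t/(1+t)$ at $s,t$ is exactly $(s-t)^2/(2(1+s)(1+t)(2+s+t))$. It is used
    for the pairs $(a,b)$ and $(b,c)$, and then for their two means; the last, nonnegative,
    contribution is dropped. *)
Lemma sat_defect_ge a b c : 0 <= a -> 0 <= b -> 0 <= c ->
  4^-1 * ((a - b) ^+ 2 / ((1 + a) * (1 + b) * (2 + a + b))
          + (b - c) ^+ 2 / ((1 + b) * (1 + c) * (2 + b + c)))
  <= sat_defect a b c.
Proof.
move=> a0 b0 c0.
pose X := 2 + a + b; pose Y := 2 + b + c.
have X0 : 0 < X by rewrite /X; lra.
have Y0 : 0 < Y by rewrite /Y; lra.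
have -> : sat_defect a b c =
  4^-1 * ((a - b) ^+ 2 / ((1 + a) * (1 + b) * (2 + a + b))
          + (b - c) ^+ 2 / ((1 + b) * (1 + c) * (2 + b + c)))
  + (X - Y) ^+ 2 / (X * Y * (X + Y)).
  by rewrite /sat_defect /sat /X /Y; field; do ?[apply/andP; split]; lra.
rewrite lerDl divr_ge0 ?sqr_ge0 // !mulr_ge0 //; lra.
Qed.

Lemma sat_defect_ge0 a b c : 0 <= a -> 0 <= b -> 0 <= c -> 0 <= sat_defect a b c.
Proof.
move=> a0 b0 c0; apply: le_trans (sat_defect_ge a0 b0 c0).
by rewrite mulr_ge0 // addr_ge0 // divr_ge0 ?sqr_ge0 // !mulr_ge0 //; lra.
Qed.

End Defect.

(** * Choice of a scale and a point by averaging *)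

Section Pigeonhole.
Context {R : realType} {n : nat}.
Local Notation V := ('cV[int]_n).
Implicit Types H : 'cV[R]_n -> R.

Definition diff_quot H (r : R) (e q : 'cV[R]_n) : R :=
  (H (q + r *: e) + H (q - r *: e) - 2 * H q) / r ^+ 2.

Lemma diff_quot_double H r (e q : 'cV[R]_n) : r != 0 ->
  diff_quot H (r * 2) e q =
  (diff_quot H r e (q + r *: e) + 2 * diff_quot H r e q
   + diff_quot H r e (q - r *: e)) / 4.
Proof.
move=> r0; rewrite /diff_quot addrK subrK.
have -> : (r * 2) *: e = r *: e + r *: e by rewrite -scalerDl; congr (_ *: _); ring.
by rewrite opprD !addrA; field.
Qed.

Lemma diff_quot_ge0 H r (e q : 'cV[R]_n) :
  (forall p h, 2 * H p <= H (p + h) + H (p - h)) -> 0 <= diff_quot H r e q.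
Proof. by move=> Hc; rewrite divr_ge0 ?sqr_ge0 // subr_ge0 Hc. Qed.

Definition line_defect H r (e q : 'cV[R]_n) : R :=
  sat_defect (diff_quot H r e (q + r *: e)) (diff_quot H r e q)
             (diff_quot H r e (q - r *: e)).

Lemma norm_int_vec (L : nat) (z : V) i :
  z \in box L -> `|int_vec z i 0 : R| <= L%:R.
Proof.
rewrite mem_box => /forallP /(_ i) zL.
by rewrite mxE -intr_norm -abszE -pmulrn ler_nat.
Qed.

Section FixedLattice.
Context (H : 'cV[R]_n -> R) (sigma M : R).
Hypothesis sigma_gt0 : 0 < sigma.
Hypothesis M_gt0 : 0 < M.
Hypothesis Hconv : forall p h, 2 * H p <= H (p + h) + H (p - h).
Hypothesis Hbnd : forall p : 'cV[R]_n, (forall i, `|p i 0| <= 3 * sigma) -> `|H p| <= M.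

(** Second differences of [H] are at most $4M$ on the region considered. The coarsest step allowed
    in direction [e] is $\sigma/2^{|e|}$, with $|e|$ the maximum norm, and dividing by its square
    produces the factor $4^{|e|}$. *)
Let bound (e : V) : R := 4 * M * 4 ^+ sup_norm e / sigma ^+ 2.

(** The spacing of the sampled lattice is fixed by [K], while the step [mesh K j] doubles with [j]:
    the averaging rule relates difference quotients at different steps but on the same lattice. *)
Let pt K (z : V) : 'cV[R]_n := (sigma / 2 ^+ K) *: int_vec z.
Let mesh K j : R := sigma / 2 ^+ K * 2 ^+ j.
Let dq K (e : V) j z := diff_quot H (mesh K j) (int_vec e) (pt K z).
Let df K (e : V) j z := line_defect H (mesh K j) (int_vec e) (pt K z).

Let mesh_gt0 K j : 0 < mesh K j.
Proof. by rewrite /mesh mulr_gt0 ?divr_gt0 ?exprn_gt0. Qed.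

Let ptD K j (z e : V) :
  pt K (z + e *+ (2 ^ j)%N) = pt K z + mesh K j *: int_vec e.
Proof.
by rewrite /pt /mesh int_vecD int_vecMn scalerDr scalerA natrX.
Qed.

Let ptB K j (z e : V) :
  pt K (z - e *+ (2 ^ j)%N) = pt K z - mesh K j *: int_vec e.
Proof.
by rewrite /pt /mesh int_vecD int_vecN int_vecMn scalerDr scalerN scalerA natrX.
Qed.

Let dq_ge0 K e j z : 0 <= dq K e j z.
Proof. exact: diff_quot_ge0. Qed.

Let df_ge0 K e j z : 0 <= df K e j z.
Proof. by apply: sat_defect_ge0; exact: diff_quot_ge0. Qed.

Let meshS K j : mesh K j.+1 = mesh K j * 2.
Proof. by rewrite /mesh exprSr mulrA. Qed.

Let dq_step K e j z : dq K e j.+1 z =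
  (dq K e j (z + e *+ (2 ^ j)%N) + 2 * dq K e j z
   + dq K e j (z - e *+ (2 ^ j)%N)) / 4 + 0.
Proof.
by rewrite addr0 /dq ptD ptB meshS diff_quot_double // gt_eqF.
Qed.

Let sat_step K e j z : sat (dq K e j.+1 z) =
  (sat (dq K e j (z + e *+ (2 ^ j)%N)) + 2 * sat (dq K e j z)
   + sat (dq K e j (z - e *+ (2 ^ j)%N))) / 4 + df K e j z.
Proof.
rewrite dq_step addr0 /df /line_defect /sat_defect /dq ptD ptB; ring.
Qed.

Let bound_gt0 e : 0 < bound e.
Proof. by rewrite /bound divr_gt0 ?exprn_gt0 // !mulr_gt0 // exprn_gt0. Qed.

Let pt_norm K L z i : z \in box L -> `|pt K z i 0| <= sigma / 2 ^+ K * L%:R.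
Proof.
move=> zL; rewrite mxE normrM ger0_norm ?divr_ge0 ?exprn_ge0 ?(ltW sigma_gt0) //.
by rewrite ler_wpM2l ?norm_int_vec ?divr_ge0 ?exprn_ge0 ?(ltW sigma_gt0).
Qed.

(* [sup_norm e <= 2 ^ sup_norm e], so at this top scale the segment
   [z - r e, z + r e] stays in the region where H is bounded. *)
Let dq_top K (e z : V) : (sup_norm e <= K)%N -> z \in box (2 * 2 ^ K) ->
  dq K e (K - sup_norm e) z <= bound e.
Proof.
move=> eK zK; set E := sup_norm e.
have meshE : mesh K (K - E) = sigma / 2 ^+ E.
  rewrite /mesh -[K in sigma / 2 ^+ K](subnK eK) exprD.
  by field; rewrite !expf_neq0.
have p2 i : `|pt K z i 0| <= 2 * sigma.
  apply: le_trans (pt_norm K i zK) _.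
  rewrite natrM natrX le_eqVlt; apply/orP; left; apply/eqP; field.
  by rewrite expf_neq0.
have eE : e \in box E by rewrite mem_box_norm.
have re i : `|(mesh K (K - E) *: int_vec e) i 0| <= sigma.
  rewrite mxE normrM (ger0_norm (ltW (mesh_gt0 _ _))) meshE.
  apply: (@le_trans _ _ (sigma / 2 ^+ E * E%:R)).
    by rewrite ler_wpM2l ?(norm_int_vec _ eE) ?divr_ge0 ?exprn_ge0 ?ltW.
  rewrite mulrAC ler_pdivrMr ?exprn_gt0 // ler_pM2l //.
  by rewrite -natrX ler_nat ltnW // ltn_expl.
have b1 : `|H (pt K z + mesh K (K - E) *: int_vec e)| <= M.
  apply: Hbnd => i; rewrite mxE (le_trans (ler_normD _ _)) //.
  by have := p2 i; have := re i; lra.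
have b2 : `|H (pt K z - mesh K (K - E) *: int_vec e)| <= M.
  apply: Hbnd => i; rewrite mxE (le_trans (ler_normD _ _)) //.
  by rewrite [X in _ + `|X|]mxE normrN; have := p2 i; have := re i; lra.
have b3 : `|H (pt K z)| <= M by apply: Hbnd => i; have := p2 i; move: sigma_gt0; lra.
rewrite /dq /diff_quot meshE /bound.
have -> : 4 * M * 4 ^+ E / sigma ^+ 2 = 4 * M / (sigma / 2 ^+ E) ^+ 2.
  have -> : 4 ^+ E = (2 ^+ E) ^+ 2 :> R.
    by rewrite -exprM mulnC exprM; congr (_ ^+ _); ring.
  by field; rewrite expf_neq0 //= gt_eqF.
rewrite -meshE ler_pM2r ?invr_gt0 ?exprn_gt0 //.
by move: b1 b2 b3; rewrite !ler_norml => /andP[_ ?] /andP[_ ?] /andP[? _]; lra.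
Qed.

Let size_box_gt0 L : 0 < (size (@box n L))%:R :> R.
Proof. by rewrite size_box ltr0n expn_gt0. Qed.

Let size_box_mulR c L : (0 < c)%N ->
  (size (@box n (c * L)))%:R <= c%:R ^+ n * (size (@box n L))%:R :> R.
Proof. by move=> c0; rewrite -natrX -natrM ler_nat size_box_mul. Qed.

(** Sums over the growing cubes increase with the scale, so the pointwise bound at the top scale
    bounds the mean at every smaller one. The factor $2^n$ compares the cubes of half-widths $2\cdot
    2^K$ and $2^K$. *)
Let sum_dq K e j : (j + sup_norm e <= K)%N ->
  \sum_(z <- box (2 ^ K)) dq K e j z
  <= 2 ^+ n * bound e * (size (@box n (2 ^ K)))%:R.
Proof.
move=> jK; set E := sup_norm e; pose L := (2 ^ K)%N.
have eE : e \in box E by rewrite mem_box_norm.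
have jKE : (j <= K - E)%N by rewrite /E; lia.
have := @nested_box_sum R n (dq K e) (fun _ _ => 0) e L E (K - E) eE
  (dq_ge0 K e) (fun _ _ => lexx 0) (dq_step K e) j jKE.
rewrite [X in _ + X <= _]big1 ?addr0; last by move=> i _; rewrite big1.
move=> h; apply: (@le_trans _ _ (\sum_(z <- box (L + 2 ^ j * E)) dq K e j z)).
  by apply: ler_sum_box; [exact: dq_ge0|exact: leq_addr].
apply: le_trans h _.
have LL : (L + 2 ^ (K - E) * E <= 2 * 2 ^ K)%N.
  rewrite mul2n -addnn leq_add2l.
  have EK : (E <= K)%N by lia.
  rewrite -[X in (_ <= 2 ^ X)%N](subnK EK) expnD leq_mul2l.
  by rewrite ltnW ?orbT // ltn_expl.
apply: (@le_trans _ _ (\sum_(z <- box (2 * 2 ^ K)) dq K e (K - E) z)).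
  by apply: ler_sum_box => //; exact: dq_ge0.
apply: (@le_trans _ _ (\sum_(z <- @box n (2 * 2 ^ K)) bound e)).
  rewrite !big_seq; apply: ler_sum => z zK; apply: dq_top => //.
  by rewrite -/E; lia.
rewrite big_const_seq count_predT iter_addr_0 -[leLHS]mulr_natl [leRHS]mulrAC.
apply: ler_wpM2r; first exact: ltW.
exact: size_box_mulR.
Qed.

(** As [sat] is at most 1, the defects of all scales together are bounded by the number of points of
    the top cube, however many scales there are. The cube [2 * 2 ^ K] leaves room for the later
    shifts by [s]. *)
Let sum_df K e m : e \in box m -> (m <= K)%N ->
  \sum_(0 <= i < K - m) \sum_(z <- box (2 * 2 ^ K)) df K e i z
  <= 3 ^+ n * (size (@box n (2 ^ K)))%:R.
Proof.
move=> em mK; pose L := (2 * 2 ^ K)%N.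
have := @nested_box_sum R n (fun j z => sat (dq K e j z)) (df K e) e L m (K - m)
  em (fun j z => sat_ge0 (dq_ge0 K e j z)) (df_ge0 K e) (sat_step K e) 0 (leq0n _).
rewrite -/L => h.
have h0 : 0 <= \sum_(z <- box (L + 2 ^ 0 * m)) sat (dq K e 0%N z).
  by apply: sumr_ge0 => z _; exact: sat_ge0.
have LL : (L + 2 ^ (K - m) * m <= 3 * 2 ^ K)%N.
  rewrite /L -[3%N]/(2 + 1)%N mulnDl leq_add2l mul1n.
  rewrite -[X in (_ <= 2 ^ X)%N](subnK mK) expnD leq_mul2l.
  by rewrite ltnW ?orbT // ltn_expl.
have h1 : \sum_(z <- box (L + 2 ^ (K - m) * m)) sat (dq K e (K - m)%N z)
    <= \sum_(z <- @box n (3 * 2 ^ K)) 1.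
  apply: (@le_trans _ _
    (\sum_(z <- box (L + 2 ^ (K - m) * m)) (1 : R))).
    by apply: ler_sum => z _; exact: sat_le1.
  exact: ler_sum_box.
rewrite big_const_seq count_predT iter_addr_0 in h1.
have := size_box_mulR (2 ^ K) (isT : 0 < 3)%N.
move: h h0 h1; rewrite -/L; lra.
Qed.

(** Averaging twice: over the scales, to find one whose mean defect is small, and then over the base
    points, to find one where both the defects and the difference quotients are controlled. That
    [Lam] is independent of [m] and [eps] is what makes the blow-ups bounded. *)
Lemma flat_scale_exists : exists Lam : V -> R, forall m (eps : R), 0 < eps ->
  exists (q : 'cV[R]_n) (r : R),
  [/\ 0 < r <= sigma / 2 ^+ m, (forall i, `|q i 0| <= sigma),
      (forall e, e \in box m -> diff_quot H r (int_vec e) q <= Lam e) &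
      forall e s, e \in box m -> s \in box m ->
        line_defect H r (int_vec e) (q + r *: int_vec s) <= eps].
Proof.
(* The last factor undoes the weight of [e] in [W] below; the 2 bounds the sum of two quantities,
   each of mean at most 1. *)
exists (fun e => 2 * (2 ^+ n * bound e * 2 ^+ (choice.pickle e).+1)).
move=> m eps eps0; set Cm : R := 3 ^+ n * (size (@box n m))%:R ^+ 2.
have [J0 [J00 J0P]] : exists J0 : nat, (0 < J0)%N /\ Cm <= eps / 2 * J0%:R.
  have [k kP] : exists k : nat, Cm / (eps / 2) < k%:R.
    exists (Num.truncn (Cm / (eps / 2))).+1.
    by apply: truncnS_gt; rewrite ?num_real.
  have e2 : 0 < eps / 2 by rewrite divr_gt0.
  exists k.+1; split; first by [].
  rewrite mulrC -ler_pdivrMr //.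
  by apply: (le_trans (ltW kP)); rewrite ler_nat leqnSn.
(* This leaves exactly [J0] scales below [K - m], and makes each of their steps at most
   [sigma / 2 ^+ m]. *)
pose K := (J0 + m)%N; pose L := (2 ^ K)%N; set B := @box n L.
pose Tot j z : R :=
  \sum_(e <- box m) \sum_(s <- box m) df K e j (z + s *+ (2 ^ j)%N).
have mK : (m <= K)%N by exact: leq_addl.
have KmJ : (K - m = J0)%N by rewrite /K addnK.
have TotP : \sum_(0 <= j < J0) \sum_(z <- B) Tot j z <= Cm * (size B)%:R.
  have -> : \sum_(0 <= j < J0) \sum_(z <- B) Tot j z =
      \sum_(e <- box m) \sum_(s <- box m)
      \sum_(0 <= j < J0) \sum_(z <- B) df K e j (z + s *+ (2 ^ j)%N).
    rewrite /Tot; under eq_bigr do rewrite exchange_big.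
    rewrite exchange_big /=; apply: eq_bigr => e _.
    under eq_bigr do rewrite exchange_big.
    by rewrite exchange_big.
  apply: (@le_trans _ _
     (\sum_(e <- @box n m) \sum_(s <- @box n m) (3 ^+ n * (size B)%:R))).
    rewrite !big_seq; apply: ler_sum => e em.
    rewrite !big_seq; apply: ler_sum => s sm.
    apply: le_trans (sum_df em mK); rewrite KmJ !big_nat.
    apply: ler_sum => j /andP[_ jJ].
    apply: (@ler_sum_shift _ _ _ _ _ (2 ^ j * m)) => //; first exact: boxMn.
    rewrite mul2n -addnn leq_add2l /L (@leq_trans (2 ^ j * 2 ^ m)%N) //.
      by rewrite leq_mul2l ltnW ?orbT // ltn_expl.
    by rewrite -expnD leq_pexp2l // /K leq_add2r ltnW.
  rewrite !big_const_seq !count_predT !iter_addr_0.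
  rewrite -mulrnA -[leLHS]mulr_natr /Cm natrM.
  by rewrite le_eqVlt; apply/orP; left; apply/eqP; ring.
have [j jJ jP] : exists2 j, (j < J0)%N &
    \sum_(z <- B) Tot j z <= eps / 2 * (size B)%:R.
  have [||j] := @exists_le_mean R nat (iota 0 J0)
    (fun j => \sum_(z <- B) Tot j z) (eps / 2 * (size B)%:R).
  - by case: (J0) J00.
  - have := TotP; rewrite size_iota /index_iota subn0 => h.
    apply: (le_trans h); rewrite [leRHS]mulrAC.
    by apply: ler_wpM2r J0P; exact: ltW (size_box_gt0 _).
  by rewrite mem_iota add0n => /andP[_ jJ] jP; exists j.
pose W z : R := \sum_(e <- box m)
  (2^-1 ^+ (choice.pickle e).+1 / (2 ^+ n * bound e)) * dq K e j z.
have WP : \sum_(z <- B) W z <= (size B)%:R.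
  rewrite /W exchange_big /=.
  apply: (@le_trans _ _ (\sum_(e <- @box n m)
     2^-1 ^+ (choice.pickle e).+1 * (size B)%:R)).
    rewrite !big_seq; apply: ler_sum => e em; rewrite -mulr_sumr.
    have c0 : 0 < 2 ^+ n * bound e by rewrite mulr_gt0 // exprn_gt0.
    rewrite -mulrA ler_wpM2l ?exprn_ge0 ?invr_ge0 // ler_pdivrMl //.
    apply: sum_dq; rewrite /K ltnW // -ltnS.
    rewrite mem_box_norm in em; lia.
  rewrite -mulr_suml -[leRHS]mul1r ler_wpM2r ?sum_pow_pickle_le1 ?box_uniq //.
have [||z zB zP] := @exists_le_mean R V B (fun z => Tot j z / (eps / 2) + W z) 2.
- by rewrite -size_eq0 -(@pnatr_eq0 R) gt_eqF // size_box_gt0.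
- rewrite big_split /= -mulr_suml.
  have h : (\sum_(z <- B) Tot j z) / (eps / 2) <= (size B)%:R.
    rewrite ler_pdivrMr; last by rewrite divr_gt0.
    by rewrite [leRHS]mulrC.
  by rewrite mulr_natl mulr2n; exact: lerD.
have Tot0 : 0 <= Tot j z by do 2![apply: sumr_ge0 => ? _]; exact: df_ge0.
have W0 e : 0 <= (2^-1 ^+ (choice.pickle e).+1 / (2 ^+ n * bound e)) * dq K e j z.
  rewrite mulr_ge0 ?dq_ge0 // divr_ge0 ?exprn_ge0 ?invr_ge0 //.
  by rewrite mulr_ge0 ?exprn_ge0 // ltW.
exists (pt K z), (mesh K j); split.
- rewrite mesh_gt0 /= /mesh mulrAC ler_pdivrMr ?exprn_gt0 //.
  rewrite mulrAC ler_pdivlMr ?exprn_gt0 // -mulrA ler_pM2l // -exprD.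
  by rewrite ler_weXn2l ?ler1n // /K leq_add2r ltnW.
- move=> i; apply: le_trans (pt_norm K i zB) _.
  rewrite natrX le_eqVlt; apply/orP; left; apply/eqP; field.
  by rewrite expf_neq0.
- move=> e em.
  have W2 : W z <= 2.
    have : 0 <= Tot j z / (eps / 2) by rewrite divr_ge0 //; lra.
    by move: zP; lra.
  have : (2^-1 ^+ (choice.pickle e).+1 / (2 ^+ n * bound e)) * dq K e j z <= 2.
    apply: le_trans W2; rewrite /W (bigD1_seq e) ?box_uniq //= lerDl.
    exact: sumr_ge0.
  have c0 : 0 < 2 ^+ n * bound e by rewrite mulr_gt0 // exprn_gt0.
  have p0 : 0 < 2 ^+ (choice.pickle e).+1 :> R by rewrite exprn_gt0.
  rewrite exprVn -mulrA -ler_pdivlMl ?invr_gt0 // invrK -/(dq K e j z).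
  rewrite -ler_pdivlMl ?invr_gt0 // invrK => h; apply: le_trans h _.
  by rewrite le_eqVlt; apply/orP; left; apply/eqP; ring.
- move=> e s em sm.
  have T2 : Tot j z <= eps.
    have Wz : 0 <= W z by apply: sumr_ge0.
    have : Tot j z / (eps / 2) <= 2 by move: zP; lra.
    by rewrite ler_pdivrMr; lra.
  apply: le_trans T2; rewrite -ptD -/(df K e j (z + s *+ (2 ^ j)%N)) /Tot.
  rewrite (bigD1_seq e) ?box_uniq //= (bigD1_seq s) ?box_uniq //= -addrA lerDl.
  by rewrite addr_ge0 // ?sumr_ge0 // => e' _; rewrite sumr_ge0.
Qed.

End FixedLattice.
End Pigeonhole.

(** * Blow-up limits with vanishing third differences *)

Section BlowUp.
Context {R : realType} {n : nat}.
Local Notation V := ('cV[int]_n).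

Lemma dot_le_sum (x y : 'cV[R]_n) :
  (forall i, `|y i 0| <= 1) -> `|dot x y| <= \sum_i `|x i 0|.
Proof.
move=> y1; rewrite dotE (le_trans (ler_norm_sum _ _ _)) // ler_sum // => i _.
by rewrite normrM ler_piMr.
Qed.

Lemma floor_vec (x : 'cV[R]_n) : exists z : V,
  forall i, `|(x - int_vec z) i 0| <= 1.
Proof.
exists (\col_i Num.floor (x i 0)) => i; rewrite !mxE.
have := floor_le (x i 0); have := lt_succ_floor (x i 0).
rewrite intrD => h1 h2; rewrite ger0_norm; lra.
Qed.

(** A large multiple $Tx$ lies at bounded distance from the lattice, so the form at $Tx$ is at least
    $-O(T)$; dividing by $T$, the quantity $T\langle x,Ax\rangle$ is bounded below for all $T$,
    which excludes a negative value. *)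
Lemma qform_int_vec_ge0 (A : 'M[R]_n) : A^T = A ->
  (forall z : V, 0 <= dot (int_vec z) (A *m int_vec z)) ->
  forall x, 0 <= dot x (A *m x).
Proof.
move=> As Apos x.
pose C1 := 2 * \sum_i `|(A *m x) i 0|; pose C2 := \sum_i \sum_j `|A i j|.
have C0 : 0 <= C1 + C2.
  by rewrite addr_ge0 ?mulr_ge0 // ?sumr_ge0 // => i _; rewrite sumr_ge0.
have key (t : nat) : - (C1 + C2) <= t.+1%:R * dot x (A *m x).
  have [z zP] := floor_vec (t.+1%:R *: x); set w := _ - _ in zP.
  have zE : int_vec z = t.+1%:R *: x - w by rewrite /w opprB addrC subrK.
  clearbody w.
  have := Apos z; rewrite zE.
  rewrite mulmxBr -scalemxAr !dot_lin -(dot_sym x w As) (dotC w (A *m x)).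
  have h1 : `|dot (A *m x) w| <= \sum_i `|(A *m x) i 0| by apply: dot_le_sum.
  have h2 : `|dot w (A *m w)| <= C2.
    rewrite dotC; apply: le_trans (dot_le_sum _ zP) _.
    apply: ler_sum => i _; rewrite mxE (le_trans (ler_norm_sum _ _ _)) //.
    by apply: ler_sum => j _; rewrite normrM ler_piMr.
  move: h1 h2; rewrite !ler_norml /C1 => /andP[h1 h1'] /andP[h2 h2'].
  have t1 : 1 <= t.+1%:R :> R by rewrite ler1n.
  move: (t.+1%:R : R) t1 => T T1.
  move: (dot x _) (dot (A *m x) w) (dot w _) h1 h1' h2 h2' => a b d h1 h1' h2 h2' h.
  have T0 : 0 < T by lra.
  rewrite -(ler_pM2l T0); nra.
rewrite leNgt; apply/negP => neg.
have [k kP] : exists k : nat, (C1 + C2) / (- dot x (A *m x)) < k%:R.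
  exists (Num.truncn ((C1 + C2) / (- dot x (A *m x)))).+1.
  by apply: truncnS_gt; rewrite ?num_real.
have := key k; rewrite leNgt => /negP[].
move: kP; rewrite ltr_pdivrMr ?oppr_gt0 // -natr1 => kP; nra.
Qed.

Lemma fmap_ultra (T T' : Type) (U : set_system T) (x : T -> T') :
  UltraFilter U -> UltraFilter (x @ U).
Proof.
move=> UU; split=> [|G GF xG]; first exact: fmap_proper_filter.
rewrite predeqE => A; split; last exact: xG.
move=> GA; have [//|UnA] := in_ultra_setVsetC (x @^-1` A) UU.
have GnA : G (~` A) by apply: xG.
by have /filter_ex [? []] : G (A `&` (~` A)) by exact: filterI.
Qed.

Lemma ultra_bounded_cvg (T : Type) (U : set_system T) (x : T -> R) (a b : R) :
  UltraFilter U -> (\forall k \near U, a <= x k <= b) ->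
  exists l : R, x @ U --> l.
Proof.
move=> UU xab; have := @segment_compact R a b; rewrite compact_ultra => cab.
have := cab (x @ U) _ xab.
by case=> [|l [_ xl]]; [exact: fmap_ultra|exists l].
Qed.

Lemma second_diff_affine (H : 'cV[R]_n -> R) (q l : 'cV[R]_n) (r a : R) e z :
  r != 0 ->
  second_diff (fun z : V =>
     (H (q + r *: int_vec z) - a - dot l (int_vec z)) / r ^+ 2) e z
  = diff_quot H r (int_vec e) (q + r *: int_vec z).
Proof.
move=> r0; rewrite /second_diff /diff_quot !int_vecD int_vecN.
by rewrite scalerDr scalerBr !dot_lin !addrA; field.
Qed.

(** [H] is rescaled along flat scales of order going to 0, after subtracting an approximate
    supporting affine function; the limit on the lattice has third differences zero. Approximate
    subgradients are enough, since errors of order $r^2$ stay bounded after rescaling. [Lam] is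
    fixed before [m] and [r0], so that later constants may depend on it. *)
Lemma blow_up_quadratic (H : 'cV[R]_n -> R) (sigma M c : R) :
  0 < sigma -> 0 < M -> 0 <= c ->
  (forall p h, 2 * H p + 2 * c * dot h h <= H (p + h) + H (p - h)) ->
  (forall p : 'cV[R]_n, (forall i, `|p i 0| <= 3 * sigma) -> `|H p| <= M) ->
  (forall p t, 0 < t -> exists zeta, forall p',
     H p + dot zeta (p' - p) - t <= H p') ->
  exists Lam : R, forall (m : nat) (r0 : R), 0 < r0 ->
  exists (q : 'cV[R]_n) (r : R) (l : 'cV[R]_n) (S : 'M[R]_n),
  [/\ 0 < r <= r0, (forall i, `|q i 0| <= sigma),
      [/\ S^T = S, (forall i, S i i <= Lam)
        & forall x, 2 * c * dot x x <= dot x (S *m x)] &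
      forall z, z \in box m ->
        `|H (q + r *: int_vec z) - H q - r * dot l (int_vec z)
          - r ^+ 2 / 2 * dot (int_vec z) (S *m int_vec z)| <= r ^+ 2].
Proof.
move=> s0 M0 c0 Hsc Hb Hsub.
have Hc p h : 2 * H p <= H (p + h) + H (p - h).
  by apply: le_trans (Hsc p h); rewrite lerDl !mulr_ge0 ?dot_ge0.
have [Lam LamP] := flat_scale_exists s0 M0 Hc Hb.
exists (\sum_i `|Lam (delta_mx i 0)|) => m r0 r00.
have /choice[X XP] : forall k : nat, exists X : 'cV[R]_n * R * 'cV[R]_n,
  [/\ 0 < X.1.2 <= sigma / 2 ^+ k, (forall i, `|X.1.1 i 0| <= sigma),
      (forall e, e \in box k -> diff_quot H X.1.2 (int_vec e) X.1.1 <= Lam e),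
      (forall e s, e \in box k -> s \in box k ->
        line_defect H X.1.2 (int_vec e) (X.1.1 + X.1.2 *: int_vec s)
        <= k.+1%:R^-1) &
      forall p', H X.1.1 + dot X.2 (p' - X.1.1) - X.1.2 ^+ 2 <= H p'].
  move=> k; have kk : 0 < k.+1%:R^-1 :> R by rewrite invr_gt0.
  have [q [r [rr qs h1 h2]]] := LamP k _ kk.
  have r20 : 0 < r ^+ 2 by rewrite exprn_gt0 //; case/andP: rr.
  by have [zeta zP] := Hsub q _ r20; exists (q, r, zeta).
pose q k := (X k).1.1; pose r k := (X k).1.2; pose zeta k := (X k).2.
have r_gt0 k : 0 < r k by case: (XP k) => /andP[].
pose f k (z : V) :=
  (H (q k + r k *: int_vec z) - H (q k) - dot (r k *: zeta k) (int_vec z))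
  / r k ^+ 2.
have fD k e z : second_diff (f k) e z =
    diff_quot H (r k) (int_vec e) (q k + r k *: int_vec z).
  by rewrite second_diff_affine // gt_eqF.
have f0 k : f k 0 = 0 by rewrite /f int_vec0 scaler0 addr0 dot0r subrr subr0 mul0r.
(* The subgradient error is $r_k^2$, hence the bound $-1$. The upper bound follows from it:
   [f k z + f k (- z)] is a difference quotient, at most [Lam z]. *)
have f_ge k z : -1 <= f k z.
  case: (XP k) => _ _ _ _ /(_ (q k + r k *: int_vec z)).
  rewrite -/(q k) -/(r k) -/(zeta k) [q k + _ - _]addrC addKr => h.
  rewrite /f ler_pdivlMr ?exprn_gt0 //; move: h; rewrite !dot_lin; lra.
have f_le k z : z \in box k -> f k z <= Lam z + 1.
  move=> zk; case: (XP k) => _ _ /(_ z zk) h _ _.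
  have := fD k z 0; rewrite /second_diff add0r sub0r f0 int_vec0 scaler0 addr0.
  by have := f_ge k (- z); rewrite -/(q k) -/(r k) in h *; lra.
have [U [UU Uoo]] := @ultraFilterLemma nat \oo _.
have box_near z : \forall k \near U, z \in @box n k.
  apply: Uoo; exists (sup_norm z) => // k /= zk.
  by rewrite mem_box_norm.
have /choice[g gP] : forall z, exists l : R, (fun k => f k z) @ U --> l.
  move=> z; apply: (@ultra_bounded_cvg _ U _ (-1) (Lam z + 1)).
  near=> k; rewrite f_ge f_le //; near: k; exact: box_near.
have gD e z : (fun k => second_diff (f k) e z) @ U --> second_diff g e z.
  rewrite /second_diff; apply: cvgB; first by apply: cvgD; exact: gP.
  by apply: cvgM; [exact: cvg_cst|exact: gP].
have inv_cvg : (fun k : nat => (k.+1%:R^-1 : R)) @ U --> (0 : R).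
  by apply: cvg_trans (@cvg_harmonic R); exact: cvg_app.
(* By [sat_defect_ge], $(a_k-b_k)^2$ is at most $4/(k+1)$ times a product of convergent factors, so
   the two second differences agree in the limit. *)
have gT e z : second_diff g e (z + e) = second_diff g e z.
  set a := second_diff g e (z + e); set b := second_diff g e z.
  have : (a - b) * (a - b) <= 4 * 0 * ((1 + a) * (1 + b) * (2 + a + b)).
    have ca := gD e (z + e); have cb := gD e z.
    pose ak k := second_diff (f k) e (z + e); pose bk k := second_diff (f k) e z.
    apply: (@ler_cvg_to _ U _ _ (fun k => (ak k - bk k) * (ak k - bk k))
      (fun k => 4 * k.+1%:R^-1 * ((1 + ak k) * (1 + bk k) * (2 + ak k + bk k)))).
    - by apply: cvgM; apply: cvgB.
    - apply: cvgM; first by apply: cvgM; [exact: cvg_cst|exact: inv_cvg].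
      apply: cvgM; last by apply: cvgD => //; apply: cvgD => //; exact: cvg_cst.
      by apply: cvgM; apply: cvgD => //; exact: cvg_cst.
    near=> k; rewrite -expr2.
    have ek : e \in @box n k by near: k; exact: box_near.
    have zk : z \in @box n k by near: k; exact: box_near.
    case: (XP k) => _ _ _ /(_ e z ek zk) + _.
    rewrite -/(q k) -/(r k) /line_defect -addrA -scalerDr -int_vecD -!fD.
    rewrite -/(ak k) -/(bk k) => h.
    have a0 : 0 <= ak k by rewrite /ak fD; exact: diff_quot_ge0.
    have b0 : 0 <= bk k by rewrite /bk fD; exact: diff_quot_ge0.
    have c0' := diff_quot_ge0 (r k) (int_vec e)
      (q k + r k *: int_vec z - r k *: int_vec e) Hc.
    have := le_trans (sat_defect_ge a0 b0 c0') h.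
    set D := (1 + ak k) * _ * _.
    have D0 : 0 < D by rewrite !mulr_gt0 //; lra.
    rewrite mulrDr => h1.
    have : 4^-1 * ((ak k - bk k) ^+ 2 / D) <= k.+1%:R^-1.
      apply: le_trans h1; rewrite lerDl mulr_ge0 // divr_ge0 ?sqr_ge0 //.
      by rewrite !mulr_ge0 //; lra.
    rewrite mulrA ler_pdivrMr // => h2.
    have lin (x y : R) : 4^-1 * x <= y -> x <= 4 * y by lra.
    by rewrite -mulrA; exact: lin.
  rewrite -expr2 mulr0 mul0r => h; apply/eqP; rewrite -subr_eq0 -sqrf_eq0.
  by rewrite eq_le h sqr_ge0.
have g0 : g 0 = 0.
  have c1 : (fun _ : nat => 0 : R) @ U --> g 0.
    by have := gP 0; under eq_fun do rewrite f0.
  have c2 : (fun _ : nat => 0 : R) @ U --> (0 : R) by exact: cvg_cst.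
  exact: (cvg_unique (@norm_hausdorff _ R^o) c1 c2).
have [b [S [Ssym gE0]]] := quadratic_of_third_diff gT.
have gE z : g z = dot b (int_vec z) + 2^-1 * dot (int_vec z) (S *m int_vec z).
  by rewrite gE0 g0 add0r.
have gD0 e : second_diff g e 0 = dot (int_vec e) (S *m int_vec e).
  by rewrite /second_diff add0r sub0r g0 !gE int_vecN mulmxN !dot_lin; field.
have r_le : \forall k \near U, r k <= r0.
  have [k kP] : exists k : nat, sigma / r0 < k%:R.
    exists (Num.truncn (sigma / r0)).+1.
    by apply: truncnS_gt; rewrite ?num_real.
  apply: Uoo; exists k => // j /= kj; case: (XP j) => /andP[_ rj] _ _ _ _.
  apply: (le_trans rj); rewrite ler_pdivrMr ?exprn_gt0 // mulrC.
  rewrite -ler_pdivrMr // (le_trans (ltW kP)) //.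
  by rewrite -natrX ler_nat (leq_trans kj) // ltnW // ltn_expl.
have near_box : \forall k \near U, all (fun z => `|f k z - g z| <= 1) (@box n m).
  elim: (@box n m) => [|z s IH]; first exact: nearW.
  have := gP z => /cvgrPdist_le /(_ 1 ltr01).
  by apply: filterS2 IH => k IHk /= zk; rewrite distrC zk.
have [k [rk fk0]] := filter_ex (filterI r_le near_box).
have fk := allP fk0.
exists (q k), (r k), (zeta k + r k *: b), S; split.
- by rewrite r_gt0.
- by case: (XP k).
- split=> // [i|x].
    rewrite (bigD1 i) //=.
    have -> : S i i = second_diff g (delta_mx i 0) 0.
      by rewrite gD0 int_vec_delta dotC dot_delta -colE mxE.
    have : second_diff g (delta_mx i 0) 0 <= Lam (delta_mx i 0).
      apply: (@ler_cvg_to _ U _ _ (fun k => second_diff (f k) (delta_mx i 0) 0)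
        (fun _ => Lam (delta_mx i 0))); [exact: gD|exact: cvg_cst|].
      near=> j; rewrite fD int_vec0 scaler0 addr0.
      by case: (XP j) => _ _ h _ _; apply: h; near: j; exact: box_near.
    move=> h; apply: (le_trans h); apply: (le_trans (ler_norm _)).
    by rewrite lerDl sumr_ge0.
  have Asym : (S - (2 * c)%:M)^T = S - (2 * c)%:M.
    by rewrite linearB /= Ssym tr_scalar_mx.
  have := qform_int_vec_ge0 Asym _ x.
  rewrite mulmxBl mul_scalar_mx dotDr dotNr dotZr subr_ge0; apply=> z.
  rewrite mulmxBl mul_scalar_mx dotDr dotNr dotZr subr_ge0 -gD0.
  apply: (@ler_cvg_to _ U _ _ (fun _ => 2 * c * dot (int_vec z) (int_vec z))
    (fun k => second_diff (f k) z 0)); [exact: cvg_cst|exact: gD|].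
  near=> j; rewrite fD int_vec0 scaler0 addr0 /diff_quot.
  rewrite ler_pdivlMr ?exprn_gt0 //.
  by have := Hsc (q j) (r j *: int_vec z); rewrite !dot_lin; lra.
- move=> z zm; have := fk z zm; rewrite gE /f.
  have r0' : r k != 0 by rewrite gt_eqF.
  have r2 : 0 < r k ^+ 2 by rewrite exprn_gt0.
  rewrite -(ler_pM2l r2) mulr1 -{1}(ger0_norm (ltW r2)) -normrM.
  congr (`|_| <= _); rewrite !dot_lin; field.
  by rewrite r0'.
Unshelve. all: by end_near.
Qed.

End BlowUp.

(** * A semiconvex analogue of Jensen's lemma *)

Section Bounds.
Context {R : realType} {n : nat}.

Lemma exists_nat_gt (x : R) : exists k : nat, x < k%:R.
Proof.
by exists (Num.truncn x).+1; apply: truncnS_gt; rewrite ?num_real.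
Qed.

Lemma psd_entry_le (S : 'M[R]_n) (L : R) : S^T = S ->
  (forall x, 0 <= dot x (S *m x)) -> (forall i, S i i <= L) ->
  forall i j, `|S i j| <= L.
Proof.
move=> Ssym Spos Sii i j.
have E a b : dot (delta_mx a 0) (S *m delta_mx b 0) = S a b.
  by rewrite dotC dot_delta -colE mxE.
have Sji : S j i = S i j by rewrite -[in LHS]Ssym mxE.
have h1 := Spos (delta_mx i 0 + delta_mx j 0).
have h2 := Spos (delta_mx i 0 - delta_mx j 0).
rewrite !(mulmxDr, mulmxN) !dot_lin !E Sji in h1 h2.
have := Sii i; have := Sii j; rewrite ler_norml => ? ?.
by apply/andP; split; lra.
Qed.

Lemma mulmx_coord_le (S : 'M[R]_n) (L : R) (x : 'cV[R]_n) :
  (forall i j, `|S i j| <= L) -> (forall i, `|x i 0| <= 1) ->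
  forall i, `|(S *m x) i 0| <= n%:R * L.
Proof.
move=> SL x1 i; rewrite mxE (le_trans (ler_norm_sum _ _ _)) //.
apply: (@le_trans _ _ (\sum_(j < n) L)).
  apply: ler_sum => j _; rewrite normrM -[L]mulr1.
  by rewrite ler_pM.
by rewrite sumr_const card_ord mulr_natl.
Qed.

Lemma dot_coord_le (x : 'cV[R]_n) (a : R) : 0 <= a ->
  (forall i, `|x i 0| <= a) -> dot x x <= n%:R * a ^+ 2.
Proof.
move=> a0 xa; rewrite dotE; apply: (@le_trans _ _ (\sum_(j < n) a ^+ 2)).
  apply: ler_sum => j _; rewrite -expr2 -real_normK ?num_real //.
  by rewrite lerXn2r ?nnegrE.
by rewrite sumr_const card_ord mulr_natl.
Qed.

Lemma coord_le_dot (x : 'cV[R]_n) (i : 'I_n) : (x i 0) ^+ 2 <= dot x x.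
Proof.
rewrite dotE (bigD1 i) //= -expr2 lerDl sumr_ge0 // => j _.
by rewrite -expr2 sqr_ge0.
Qed.

Lemma dot_young (t : R) (x y : 'cV[R]_n) : 0 < t ->
  2 * dot x y <= t * dot x x + dot y y / t.
Proof.
move=> t0; have := dot_ge0 (t *: x - y).
rewrite !dot_lin (dotC y x) => h.
have t0' : t != 0 by rewrite gt_eqF.
have -> : t * dot x x + dot y y / t =
  2 * dot x y + (t * (t * dot x x) + - (t * dot x y)
   + (- (t * dot x y) - - dot y y)) / t.
  by field.
rewrite lerDl divr_ge0 ?(ltW t0) //; apply: le_trans h _.
by rewrite le_eqVlt; apply/orP; left; apply/eqP; ring.
Qed.

(** The point nearly reaching the supremum that defines the conjugate at a slope is, with sign
    reversed, an approximate subgradient of the conjugate there. [H3] is the value at that slope,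
    [H1] and [H2] those at its two neighbours in one coordinate direction, [H4] the value at the
    centre, and [z] the matching coordinate of the point. The quadratic model at the neighbours ties
    $-z$ to its gradient $l+ru$. The 3 counts the model errors at a neighbour and at the slope, and
    the defect of maximality. *)
Lemma slope_bound (H1 H2 H3 H4 W X r z b l u s t L : R) :
  0 < r -> s <= L ->
  W - (X + r * z) <= H1 -> W - (X - r * z) <= H2 ->
  `|H1 - H4 - r * (b + l) - r ^+ 2 / 2 * (t + u + (u + s))| <= r ^+ 2 ->
  `|H2 - H4 - r * (b - l) - r ^+ 2 / 2 * (t - u - (u - s))| <= r ^+ 2 ->
  `|H3 - H4 - r * b - r ^+ 2 / 2 * t| <= r ^+ 2 ->
  H3 - r ^+ 2 < W - X ->
  `|z + l + r * u| <= r * (L / 2 + 3).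
Proof.
move=> r0 sL h1 h2.
rewrite ler_norml => /andP[_ h3]; rewrite ler_norml => /andP[_ h4].
rewrite ler_norml => /andP[h5 _] h6.
have r2 : r ^+ 2 * s <= r ^+ 2 * L by rewrite ler_pM2l // exprn_gt0.
have e : r * (r * (L / 2 + 3)) = r ^+ 2 * L / 2 + 3 * r ^+ 2 by field.
have e' : r * (z + l + r * u) = r * z + r * l + r ^+ 2 * u by ring.
have e3 : H1 - H4 - r * (b + l) - r ^+ 2 / 2 * (t + u + (u + s)) =
  H1 - H4 - r * b - r * l - r ^+ 2 * t / 2 - r ^+ 2 * u - r ^+ 2 * s / 2 by field.
have e4 : H2 - H4 - r * (b - l) - r ^+ 2 / 2 * (t - u - (u - s)) =
  H2 - H4 - r * b + r * l - r ^+ 2 * t / 2 + r ^+ 2 * u - r ^+ 2 * s / 2 by field.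
have e5 : H3 - H4 - r * b - r ^+ 2 / 2 * t = H3 - H4 - r * b - r ^+ 2 * t / 2.
  by field.
rewrite e3 in h3; rewrite e4 in h4; rewrite e5 in h5.
have -> : (`|z + l + r * u| <= r * (L / 2 + 3)) =
    (`|r * (z + l + r * u)| <= r * (r * (L / 2 + 3))).
  by rewrite normrM (ger0_norm (ltW r0)) ler_pM2l.
rewrite ler_norml e e'; clear e e' e3 e4 e5.
move: (r * z) (r * l) (r * b) (r ^+ 2) (r ^+ 2 * u) (r ^+ 2 * s) (r ^+ 2 * L)
  (r ^+ 2 * t) h1 h2 h3 h4 h5 h6 r2 => a1 a2 a3 a4 a5 a6 a7 a8 h1 h2 h3 h4 h5 h6 r2.
by apply/andP; split; lra.
Qed.

End Bounds.

(** * Conjugates of semiconvex functions *)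

Section Jensen.
Context {R : realType} {n : nat}.
Variables (w : 'cV[R]_n -> R) (kappa theta M : R).
Hypothesis kappa_gt0 : 0 < kappa.
Hypothesis theta_gt0 : 0 < theta.
Hypothesis w_semiconvex : forall z h,
  2 * w z - 2 * kappa * dot h h <= w (z + h) + w (z - h).
Hypothesis w_le : forall z, w z <= M - theta * dot z z.
Hypothesis w0 : w 0 = M.

Let H (p : 'cV[R]_n) : R := sup (range (fun z => w z - dot p z)).

Let w_sub_le p z : w z - dot p z <= M + dot p p / (4 * theta).
Proof.
have t2 : 0 < 2 * theta by rewrite mulr_gt0.
have := @dot_young R n _ (- p) z _; rewrite !dot_lin opprK.
have := @dot_young R n (2 * theta)^-1 (- p) z; rewrite invr_gt0 !dot_lin opprK.
move=> /(_ t2); rewrite invrK => h _.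
have := w_le z.
have -> : dot p p / (4 * theta) = (2 * theta)^-1 * dot p p / 2.
  by field; rewrite gt_eqF.
lra.
Qed.

Let H_sup p : has_sup (range (fun z => w z - dot p z)).
Proof.
split; first by exists (w 0 - dot p 0); exists 0.
by exists (M + dot p p / (4 * theta)) => _ [z _ <-]; exact: w_sub_le.
Qed.

Let H_ub p z : w z - dot p z <= H p.
Proof. by apply: sup_ubound; [case: (H_sup p)|exists z]. Qed.

Let H_near p t : 0 < t -> exists z, H p - t < w z - dot p z.
Proof.
move=> t0; have [_ [z _ <-] h] := sup_adherent t0 (H_sup p).
by exists z.
Qed.

Let H_le p : H p <= M + dot p p / (4 * theta).
Proof.
apply: sup_le_ub; first by case: (H_sup p).
by move=> _ [z _ <-]; exact: w_sub_le.
Qed.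

Let H_ge p : M <= H p.
Proof. by have := H_ub p 0; rewrite w0 dot0r subr0. Qed.

(* Duality: semiconvexity of w with constant kappa becomes uniform convexity
   of H, so that the Hessian of H is invertible. *)
Let H_convex p k :
  2 * H p + 2 * (4 * kappa)^-1 * dot k k <= H (p + k) + H (p - k).
Proof.
apply/ler_addgt0Pr => t t0.
have t20 : 0 < t / 2 by rewrite divr_gt0.
have [z zP] := H_near p t20.
(* This [h] maximises $-2\kappa|h|^2-2\langle k,h\rangle$, the gain when the conjugates at [p + k]
   and [p - k] are tested at [z + h] and [z - h]. *)
pose h := - (2 * kappa)^-1 *: k.
have k0 : kappa != 0 by rewrite gt_eqF.
have h1 := w_semiconvex z h; have h2 := H_ub (p + k) (z + h).
have h3 := H_ub (p - k) (z - h).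
rewrite !dot_lin in h1 h2 h3.
have e1 : (2 * kappa)^-1 = 2 * (4 * kappa)^-1 by field.
have e2 : kappa * (2 * (4 * kappa)^-1) = 2^-1 by field.
set d := (4 * kappa)^-1 in e1 e2 *.
rewrite e1 in h1 h2 h3.
have e3 : kappa * (2 * d * (2 * d * dot k k)) = d * dot k k.
  transitivity (kappa * (2 * d) * (2 * d * dot k k)); first by ring.
  by rewrite e2; field.
move: h1 h2 h3 zP.
rewrite (_ : 2 * kappa * _ = 2 * (kappa * (2 * d * (2 * d * dot k k)))); last by ring.
rewrite e3; lra.
Qed.

Lemma concave_conjugate : exists H : 'cV[R]_n -> R,
  [/\ forall p z, w z - dot p z <= H p,
      forall p t, 0 < t -> exists z, H p - t < w z - dot p z,
      forall p, H p <= M + dot p p / (4 * theta),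
      forall p, M <= H p &
      forall p k, 2 * H p + 2 * (4 * kappa)^-1 * dot k k <= H (p + k) + H (p - k)].
Proof. by exists H; split. Qed.

End Jensen.

(** If the conjugate is nearly $H(q)+r\langle l,k\rangle+\frac{r^2}{2}\langle k,Sk\rangle$ at slopes
    $q+rk$, then [w] should be nearly the conjugate quadratic, centred at the contact point $-l$,
    with slope $q$ and Hessian $-S^{-1}$. The errors are $O(r^2)$ with a constant fixed in advance,
    so they are small relative to the square of a radius $r\rho$ with $\rho$ large. *)
Lemma jensen_quadratic (R : realType) n (w : 'cV[R]_n -> R) (kappa theta M tau : R) :
  0 < kappa -> 0 < theta ->
  (forall z h, 2 * w z - 2 * kappa * dot h h <= w (z + h) + w (z - h)) ->
  (forall z, w z <= M - theta * dot z z) -> w 0 = M -> 0 < tau ->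
  exists (zb p : 'cV[R]_n) (P : 'M[R]_n) (rad a : R),
  [/\ 0 < rad <= tau, dot zb zb <= tau, dot p p <= tau & M - 2 * tau <= w zb]
  /\
  [/\ P^T = P, (forall x, 0 <= dot x (P *m x)),
      (forall x, dot (P *m x) (P *m x) <= (2 * kappa) ^+ 2 * dot x x)
    & forall h, dot h h <= rad ^+ 2 ->
      `|w (zb + h) - (a + dot p h - 2^-1 * dot h (P *m h))| <= tau * rad ^+ 2].
Proof.
move=> kappa_gt0 theta_gt0 w_semiconvex w_le w0.
have [H [H_ub H_near H_le H_ge H_convex]] :=
  concave_conjugate kappa_gt0 theta_gt0 w_semiconvex w_le w0.
move=> tau0; pose N : R := n%:R.
have N0 : 0 <= N by rewrite ler0n.
(* The bound $N\sigma^2\le\tau$ keeps the slope $q$ small. The other one keeps the contact point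
   small, since strictness of the maximum makes $\theta|zb|$ of order $|q|$. *)
have [sigma [s0 s1 s2]] : exists sigma : R,
  [/\ 0 < sigma, N * sigma ^+ 2 <= tau & N * sigma ^+ 2 / theta ^+ 2 <= tau / 2].
  pose D := N + N / theta ^+ 2 + 1; have th2 : 0 < theta ^+ 2 by rewrite exprn_gt0.
  have Nt : 0 <= N / theta ^+ 2 by rewrite divr_ge0 // ltW.
  have D1 : 1 <= D by rewrite /D; lra.
  exists (Num.min 1 (tau / 2 / D)).
  have D0 : 0 < D by lra.
  set sg := Num.min _ _.
  have sg0 : 0 < sg by rewrite lt_min ltr01 /= !divr_gt0.
  have sg1 : sg <= 1 by rewrite ge_min lexx.
  have sgD : sg * D <= tau / 2 by rewrite -ler_pdivlMr // ge_min lexx orbT.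
  have sg2 : sg ^+ 2 * D <= tau / 2.
    apply: le_trans sgD; rewrite ler_pM2r // expr2 ler_piMl // ltW //.
  have q0 : 0 <= sg ^+ 2 by rewrite sqr_ge0.
  have e : sg ^+ 2 * D = N * sg ^+ 2 + N * sg ^+ 2 / theta ^+ 2 + sg ^+ 2.
    by rewrite /D; ring.
  have x0 : 0 <= N * sg ^+ 2 by rewrite mulr_ge0.
  have y0 : 0 <= N * sg ^+ 2 / theta ^+ 2 by rewrite divr_ge0 // ltW.
  by split=> //; move: sg2; rewrite e; lra.
pose Mb := `|M| + N * (3 * sigma) ^+ 2 / (4 * theta) + 1.
have t4 : 0 < 4 * theta by rewrite mulr_gt0.
have Mb0 : 0 < Mb.
  by rewrite ltr_wpDl // addr_ge0 // divr_ge0 ?(ltW t4) // mulr_ge0 // sqr_ge0.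
have Hb (p : 'cV[R]_n) : (forall i, `|p i 0| <= 3 * sigma) -> `|H p| <= Mb.
  move=> ps; have h1 := H_ge p; have h2 := H_le p.
  have s30 : 0 <= 3 * sigma by rewrite mulr_ge0 // ltW.
  have h3 : dot p p / (4 * theta) <= N * (3 * sigma) ^+ 2 / (4 * theta).
    by rewrite ler_pM2r ?invr_gt0 //; exact: dot_coord_le.
  have h4 : 0 <= N * (3 * sigma) ^+ 2 / (4 * theta).
    by rewrite divr_ge0 ?(ltW t4) // mulr_ge0 // sqr_ge0.
  have := ler_norm M; have := ler_norm (- M); rewrite normrN => h5 h6.
  by rewrite ler_norml /Mb; apply/andP; split; lra.
have Hsub p t : 0 < t -> exists zeta, forall p', H p + dot zeta (p' - p) - t <= H p'.
  move=> t0; have [z zP] := H_near p _ t0; exists (- z) => p'.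
  by have := H_ub p' z; rewrite !dot_lin (dotC z p') (dotC z p); lra.
have c0 : 0 <= (4 * kappa)^-1 by rewrite invr_ge0 mulr_ge0 // ltW.
have [Lam0 LamP] := blow_up_quadratic s0 Mb0 c0 H_convex Hb Hsub.
pose Lam := `|Lam0|; have Lam_ge0 : 0 <= Lam by rewrite normr_ge0.
pose C1 := Lam / 2 + 3 + N * Lam.
have C10 : 0 <= C1 by rewrite /C1 !addr_ge0 ?divr_ge0 ?mulr_ge0.
pose C2 := 3 + N * (N * Lam) + 2 * kappa * (N * C1 ^+ 2).
have C2_ge : 3 + N * (N * Lam) <= C2.
  by rewrite /C2 lerDl !mulr_ge0 ?sqr_ge0 // ltW.
have NNL : 0 <= N * (N * Lam) by rewrite !mulr_ge0.
have C20 : 0 < C2 by lra.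
have k20 : 0 < 2 * kappa by rewrite mulr_gt0.
have [m0 m0P] := exists_nat_gt (2 * kappa * (C2 / tau + 1)).
(* [rho] is the radius in units of [r], so large that [C2 <= tau * rho ^+ 2]. As $|S^{-1}|\le
   2\kappa$, the slopes needed lie within $2\kappa\rho=m_0$ lattice units of $q$; rounding them to
   the lattice costs one more unit, and passing to their neighbours another. *)
pose m := m0.+2; pose rho : R := m0%:R / (2 * kappa).
have rho1 : C2 / tau + 1 < rho by rewrite /rho ltr_pdivlMr // mulrC.
have Ct0 : 0 < C2 / tau by rewrite divr_gt0.
have rho0 : 0 < rho by lra.
have rho2 : C2 <= tau * rho ^+ 2.
  rewrite mulrC -ler_pdivrMr // (le_trans (ltW (lt_trans _ rho1))) //.
    by rewrite ltrDl.
  by rewrite expr2 ler_peMl ?(ltW rho0) //; lra.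
pose r0 := Num.min (tau / rho) (Num.min 1 (Num.min tau (theta * tau / 4) / C2)).
have r00 : 0 < r0.
  rewrite !lt_min ltr01 divr_gt0 //= divr_gt0 // lt_min tau0 /=.
  by rewrite !divr_gt0 ?mulr_gt0.
have [q [r [l [S [/andP[r_gt0 rr0] qs [Ssym Sii Spos] HS]]]]] := LamP m r0 r00.
have r2_gt0 : 0 < r ^+ 2 by rewrite exprn_gt0.
have r1 : r * rho <= tau.
  by rewrite -ler_pdivlMr // (le_trans rr0) // ge_min lexx.
have Cr : C2 * r ^+ 2 <= Num.min tau (theta * tau / 4).
  rewrite mulrC -ler_pdivlMr //; apply: (@le_trans _ _ r).
    rewrite expr2 ler_piMl ?(ltW r_gt0) // (le_trans rr0) //.
    by rewrite ge_min ge_min lexx orbT.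
  by rewrite (le_trans rr0) // ge_min ge_min lexx !orbT.
have Cr1 : C2 * r ^+ 2 <= tau by rewrite (le_trans Cr) // ge_min lexx.
have Cr2 : C2 * r ^+ 2 <= theta * tau / 4.
  by rewrite (le_trans Cr) // ge_min lexx orbT.
have Spsd x : 0 <= dot x (S *m x).
  by apply: le_trans (Spos x); rewrite !mulr_ge0 ?dot_ge0.
have SL : forall i j, `|S i j| <= Lam.
  by apply: psd_entry_le => // i; rewrite (le_trans (Sii i)) // ler_norm.
have Sinj (x : 'cV[R]_n) : S *m x = 0 -> x = 0.
  move=> Sx; have := Spos x; rewrite Sx dot0r => h.
  have d0 : dot x x <= 0.
    by move: h; rewrite pmulr_rle0 // mulr_gt0 // invr_gt0 mulr_gt0.
  apply/matrixP => i j; rewrite ord1 mxE; apply/eqP; rewrite -sqrf_eq0.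
  by rewrite eq_le sqr_ge0 (le_trans (coord_le_dot x i)).
have Sunit : S \in unitmx.
  rewrite -row_free_unit -kermx_eq0; apply/eqP/row_matrixP => i.
  have : row i (kermx S) *m S = 0 by apply/sub_kermxP; exact: row_sub.
  move=> /(congr1 trmx); rewrite trmx_mul Ssym trmx0 => /Sinj.
  by move=> /(congr1 trmx); rewrite trmxK trmx0 row0.
pose P := invmx S.
have SP x : S *m (P *m x) = x :> 'cV[R]_n by rewrite mulmxA mulmxV // mul1mx.
have Psym : P^T = P by rewrite /P trmx_inv Ssym.
have Ppos x : 0 <= dot x (P *m x).
  by have := Spsd (P *m x); rewrite SP dotC.
have Pbd x : dot (P *m x) (P *m x) <= (2 * kappa) ^+ 2 * dot x x.
  have := Spos (P *m x); rewrite SP => h.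
  have := dot_ge0 (P *m x - (2 * kappa) *: x); rewrite !dot_lin.
  rewrite (dotC x (P *m x)); set b := dot (P *m x) x in h *.
  set d := dot (P *m x) (P *m x) in h * => h2.
  have h3 : d <= 2 * kappa * b.
    rewrite -ler_pdivrMl //; apply: le_trans h.
    by rewrite le_eqVlt; apply/orP; left; apply/eqP; field; rewrite gt_eqF.
  by clear h; move: k20 h2 h3; move: (2 * kappa) (dot x x) d b; clear=> ? ? ? ? *; nra.
have [zb zbE] : exists zb, zb = - l by exists (- l).
pose a := H q + dot q zb.
pose Q h := a + dot q h - 2^-1 * dot h (P *m h).
have main h : dot h h <= (r * rho) ^+ 2 -> `|w (zb + h) - Q h| <= C2 * r ^+ 2.
  have [y hy] : exists y, h = r *: y.
    by exists (r^-1 *: h); rewrite scalerA divff ?gt_eqF // scale1r.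
  have -> : dot h h = r ^+ 2 * dot y y by rewrite hy !dot_lin; ring.
  rewrite exprMn ler_pM2l // => yy.
  (* In the model, the slope $q+rx$ with $Sx=-y$ has its contact point at [zb + h]. [H] is known
     only at lattice slopes, so [x] is rounded to [k], with error [dl]. *)
  have [x [Sx xi xy]] : exists x : 'cV[R]_n, [/\ S *m x = - y,
      forall i, `|x i 0| <= m0%:R & dot x y = - dot y (P *m y)].
    exists (- (P *m y)); split; first by rewrite mulmxN SP.
      move=> i; rewrite -(@ler_pXn2r _ 2) ?nnegrE ?ler0n //.
      rewrite real_normK ?num_real // (le_trans (coord_le_dot _ i)) //.
      rewrite !dot_lin opprK (le_trans (Pbd y)) //.
      have -> : m0%:R = 2 * kappa * rho :> R by rewrite mulrC divfK // gt_eqF.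
      by rewrite [leRHS]exprMn ler_pM2l // exprn_gt0.
    by rewrite dotNl dotC.
  have [k kP] := floor_vec x.
  have [dl [dl1 kE]] : exists dl : 'cV[R]_n,
      (forall i, `|dl i 0| <= 1) /\ int_vec k = x + dl.
    exists (int_vec k - x); split; last by rewrite addrC subrK.
    by move=> i; have := kP i; rewrite -normrN !mxE opprB.
  have km : k \in box m0.+1.
    rewrite mem_box; apply/forallP => i.
    have : `|int_vec k i 0 : R| <= m0.+1%:R.
      rewrite kE mxE (le_trans (ler_normD _ _)) // -[m0.+1%:R]natr1.
      exact: lerD.
    by rewrite mxE -intr_norm -abszE -pmulrn ler_nat.
  pose p := q + r *: int_vec k.
  pose E := a + r * dot q y + r ^+ 2 * (2^-1 * dot x y + 2^-1 * dot dl (S *m dl)).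
  have QE : Q h = a + r * dot q y + r ^+ 2 * (2^-1 * dot x y).
    by rewrite /Q hy -scalemxAr !dot_lin xy; ring.
  have Sdl i := mulmx_coord_le SL dl1 i.
  have dSd : `|dot dl (S *m dl)| <= N * (N * Lam).
    rewrite dotC; apply: le_trans (dot_le_sum _ dl1) _.
    apply: (@le_trans _ _ (\sum_(i < n) N * Lam)); first exact: ler_sum.
    by rewrite sumr_const card_ord -[leLHS]mulr_natl.
  (* the value at p of the affine function supporting -w at the contact point *)
  have touch : `|H p + dot p (zb + h) - E| <= r ^+ 2.
    have kbox : k \in box m by apply: box_sub km.
    have := HS k kbox; rewrite -/p; congr (`|_| <= _).
    rewrite /E /a /p hy zbE !dot_lin (dotC l (int_vec k)) (dotC q l).
    have -> : dot (int_vec k) (S *m int_vec k) =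
      dot x (S *m x) + 2 * dot dl (S *m x) + dot dl (S *m dl).
      rewrite kE mulmxDr !dot_lin -[dot x (S *m dl)](dot_sym x dl Ssym).
      by rewrite (dotC (S *m x)); ring.
    have -> : dot (int_vec k) y = dot x y + dot dl y by rewrite kE dotDl.
    by rewrite Sx !dot_lin; field.
  have [zp zpP] := H_near p _ r2_gt0.
  pose d := zb + h - zp.
  have di i : `|d i 0| <= r * C1.
    have e_in : delta_mx i 0 \in @box n 1 by exact: box_delta.
    have kp : k + delta_mx i 0 \in box m by rewrite -[m]addn1; exact: boxD.
    have kn : k - delta_mx i 0 \in box m.
      by rewrite -[m]addn1; apply: boxD => //; rewrite boxN.
    have kbox : k \in box m by apply: box_sub km.
    have h1 := H_ub (q + r *: int_vec (k + delta_mx i 0)) zp.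
    have h2 := H_ub (q + r *: int_vec (k - delta_mx i 0)) zp.
    have h3 := HS _ kp; have h4 := HS _ kn; have h5 := HS _ kbox.
    rewrite -/p in h5.
    move: h1 h2 h3 h4 h5 zpP.
    rewrite !int_vecD !int_vecN !int_vec_delta.
    rewrite !(mulmxDr S, mulmxN S) !scalerDr !scalerN !addrA -/p !dot_lin.
    set H1 := H _; set H2 := H _; set H3 := H p; set H4 := H q.
    rewrite -(dot_sym (int_vec k) (delta_mx i 0) Ssym).
    rewrite !(dotC (delta_mx i 0)) !dot_delta.
    have -> : (S *m (delta_mx i 0 : 'cV[R]_n)) i 0 = S i i by rewrite -colE mxE.
    have dE : d i 0 = - l i 0 - zp i 0 - r * (S *m int_vec k) i 0
        + r * (S *m dl) i 0.
      have -> : S *m dl = S *m int_vec k + y.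
        by rewrite kE mulmxDr Sx addrAC addNr add0r.
      by rewrite /d zbE hy !mxE; ring.
    have b2 : `|r * (S *m dl) i 0| <= r * (N * Lam).
      by rewrite normrM (ger0_norm (ltW r_gt0)) ler_pM2l.
    have Sii' : S i i <= Lam by rewrite (le_trans (ler_norm _)).
    move=> h1 h2 h3 h4 h5 h6.
    have h7 := slope_bound r_gt0 Sii' h1 h2 h3 h4 h5 h6.
    have -> : d i 0 = r * (S *m dl) i 0
        - (zp i 0 + l i 0 + r * (S *m int_vec k) i 0) by rewrite dE; ring.
    apply: (le_trans (ler_normB _ _)); apply: (le_trans (lerD b2 h7)).
    by rewrite /C1 -mulrDr addrC.
  have rC10 : 0 <= r * C1 by rewrite mulr_ge0 // ltW.
  have dd := dot_coord_le rC10 di.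
  have up := H_ub p (zb + h).
  (* The lower bound for [w]: semiconvexity centred at the near-contact point [zp], where [w] almost
     equals the dominating affine function, while its reflected value [w (zp - d)] is at most that
     affine function. *)
  have lo : H p + dot p (zb + h) - 2 * r ^+ 2 - 2 * kappa * dot d d <= w (zb + h).
    have := w_semiconvex zp d; have := H_ub p (zp - d); move: zpP.
    have -> : zp + d = zb + h by rewrite /d addrC subrK.
    have -> : dot p (zp - d) = 2 * dot p zp - dot p (zb + h).
      have -> : zp - d = 2 *: zp - (zb + h) by rewrite /d scaler_nat mulr2n opprB addrA.
      by rewrite !dot_lin; ring.
    move: (2 * kappa * dot d d) (H p) (r ^+ 2) (w zp) (dot p zp) (w (zp - d)).
    move: (w (zb + h)) (dot p (zb + h)); clear=> *; lra.
  have dd' : 2 * kappa * dot d d <= 2 * kappa * (N * C1 ^+ 2) * r ^+ 2.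
    rewrite -[leRHS]mulrA ler_pM2l //; apply: (le_trans dd).
    by rewrite le_eqVlt; apply/orP; left; apply/eqP; ring.
  have e1 : E = Q h + r ^+ 2 * (2^-1 * dot dl (S *m dl)) by rewrite QE /E; ring.
  have e2 : C2 * r ^+ 2 = 3 * r ^+ 2 + N * (N * Lam) * r ^+ 2
     + 2 * kappa * (N * C1 ^+ 2) * r ^+ 2 by rewrite /C2; ring.
  have rN : `|r ^+ 2 * dot dl (S *m dl)| <= N * (N * Lam) * r ^+ 2.
    by rewrite normrM (ger0_norm (ltW r2_gt0)) mulrC ler_pM2r.
  have rN0 : 0 <= N * (N * Lam) * r ^+ 2 by rewrite mulr_ge0 // ltW.
  have rK0 : 0 <= 2 * kappa * (N * C1 ^+ 2) * r ^+ 2.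
    by rewrite !mulr_ge0 // ?ltW // sqr_ge0.
  have e3 : r ^+ 2 * (2^-1 * dot dl (S *m dl)) = r ^+ 2 * dot dl (S *m dl) / 2.
    by field.
  rewrite e2; move: touch rN; rewrite e1 e3 !ler_norml => /andP[u1 u2] /andP[u3 u4].
  move: u1 u2 u3 u4 rN0 rK0 up lo dd' (ltW r2_gt0).
  move: (r ^+ 2) (N * (N * Lam) * r ^+ 2) (2 * kappa * (N * C1 ^+ 2) * r ^+ 2)
    (r ^+ 2 * dot dl (S *m dl)) (Q h) (2 * kappa * dot d d) (H p) (dot p (zb + h)).
  by clear=> *; apply/andP; split; lra.
have rr : r * rho <= tau := r1.
have rr0' : 0 < r * rho by rewrite mulr_gt0.
have main_tau h : dot h h <= (r * rho) ^+ 2 ->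
    `|w (zb + h) - Q h| <= tau * (r * rho) ^+ 2.
  move=> /main h1; apply: (le_trans h1).
  have -> : tau * (r * rho) ^+ 2 = tau * rho ^+ 2 * r ^+ 2 by ring.
  by rewrite ler_pM2r.
have qq : dot q q <= N * sigma ^+ 2 by apply: dot_coord_le; rewrite // ltW.
have wzb : a - C2 * r ^+ 2 <= w zb.
  have := main 0; rewrite addr0 dot0r sqr_ge0 => /(_ isT).
  rewrite /Q !dot_lin mulr0 subr0 addr0 ler_norml => /andP[].
  by clear; lra.
have HqM := H_ge q.
have qz := dot_young (- q) zb theta_gt0.
(* The upper bound $M-\theta|zb|^2$ and the lower bound $M+\langle q,zb\rangle-C_2r^2$ for [w zb]
   are compared, and the mixed term is split by Young's inequality. *)
have zbzb : dot zb zb <= tau.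
  have h1 := w_le zb.
  have h2 := @dot_young R n theta^-1 (- q) zb; rewrite invr_gt0 invrK in h2.
  have {h2} := h2 theta_gt0; rewrite !dot_lin opprK => h2.
  have h3 : theta * (dot zb zb) <= theta * tau.
    have h4 : theta^-1 * dot q q <= theta * (tau / 2).
      have -> : theta^-1 * dot q q = theta * (dot q q / theta ^+ 2).
        by field; rewrite gt_eqF.
      rewrite ler_pM2l //; apply: le_trans s2.
      by rewrite ler_pM2r // invr_gt0 exprn_gt0.
    move: h1 h2 h4 wzb Cr2 HqM; rewrite /a.
    move: (w zb) (dot q zb) (dot zb zb) (H q) (C2 * r ^+ 2) (theta^-1 * dot q q).
    by clear=> *; lra.
  by rewrite ler_pM2l in h3.
exists zb, q, P, (r * rho), a; split; split=> //.
- by rewrite rr0' rr.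
- by rewrite (le_trans qq).
- have := @dot_young R n 1 (- q) zb ltr01; rewrite !dot_lin opprK mul1r divr1.
  by move: wzb HqM Cr1 zbzb (le_trans qq s1); rewrite /a; clear; lra.
Qed.

(** * An approximate theorem on sums *)

Section VectorTopology.
Context {R : realType}.

Lemma cvg_sumr (I T : Type) (s : seq I) (F : set_system T) (f : I -> T -> R)
  (a : I -> R) : Filter F -> (forall i, f i @ F --> a i) ->
  (fun t => \sum_(i <- s) f i t) @ F --> \sum_(i <- s) a i.
Proof.
move=> FF fa; elim: s => [|i s IH].
  by rewrite big_nil; under eq_fun do rewrite big_nil; exact: cvg_cst.
rewrite big_cons; under eq_fun do rewrite big_cons.
exact: cvgD.
Qed.

Lemma cvg_dot n (T : Type) (F : set_system T) (f g : T -> 'cV[R]_n) a b :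
  Filter F -> f @ F --> a -> g @ F --> b ->
  (fun t => dot (f t) (g t)) @ F --> dot a b.
Proof.
move=> FF fa gb; under eq_fun do rewrite dotE; rewrite dotE.
apply: cvg_sumr => i; apply: cvgM.
  exact: (cvg_comp _ _ fa (@coord_continuous R n 1 i 0 a)).
exact: (cvg_comp _ _ gb (@coord_continuous R n 1 i 0 b)).
Qed.

Lemma trmx_continuous m n : continuous (@trmx R m n).
Proof.
move=> M s /= /(nbhs_ballP M^T) [e e0 es].
apply/nbhs_ballP; exists e => //= N [e0' MN]; apply: es.
by split=> // i j; rewrite !mxE; exact: MN.
Qed.

Lemma compact_dot_ball n (r : R) : compact [set h : 'cV[R]_n | dot h h <= r].
Proof.
pose M := `|r| + 1.
have cbox : compact [set v : 'rV[R]_n | forall i, v ord0 i \in `[- M, M]].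
  by apply: (@rV_compact _ _ (fun=> `[- M, M]%classic)) => i; exact: segment_compact.
have cimg := continuous_compact (continuous_subspaceT (@trmx_continuous 1 n)) cbox.
apply: (subclosed_compact _ cimg).
  have -> : [set h : 'cV[R]_n | dot h h <= r] =
      (fun h => dot h h) @^-1` [set t | t <= r] by [].
  apply: (@closed_comp _ _ (fun h : 'cV[R]_n => dot h h)); last exact: closed_le.
  by move=> h _; exact: (@cvg_dot n _ (nbhs h) id id h h _ cvg_id cvg_id).
move=> h hr; exists h^T; last by rewrite trmxK.
move=> i; rewrite mxE in_itv /= -ler_norml.
have M1 : 1 <= M by rewrite /M lerDr.
have M0 : 0 <= M by apply: le_trans M1.
rewrite -(@ler_pXn2r _ 2) ?nnegrE //.
rewrite real_normK ?num_real // (le_trans (coord_le_dot h i)) //.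
rewrite (le_trans hr) // (le_trans (ler_norm r)) //.
apply: (@le_trans _ _ M); first by rewrite lerDl.
by rewrite expr2 ler_peMl.
Qed.

End VectorTopology.

(** * Maxima of upper semicontinuous functions on compact sets *)

Section UpperSemicontinuity.
Context {R : realType}.
Local Open Scope ereal_scope.

Definition usc_within (T : topologicalType) (K : set T) (f : T -> \bar R) :=
  forall x, K x -> forall a : R, f x < a%:E ->
    \forall y \near within K (nbhs x), f y < a%:E.

(* The level sets [f y <= f z] form a filter base as long as the maximum is
   not attained. *)
Lemma usc_compact_max (T : topologicalType) (K : set T) (f : T -> \bar R) x0 :
  compact K -> K x0 -> (forall x, K x -> f x < +oo) -> usc_within K f ->
  exists2 x, K x & forall y, K y -> f y <= f x.
Proof.
move=> /compact_near_coveringP cK Kx0 flt fusc; apply: contrapT => nmax.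
have above x : K x -> exists2 y, K y & f x < f y.
  move=> Kx; apply: contrapT => ny; apply: nmax; exists x => // y Ky.
  by rewrite leNgt; apply/negP => xy; apply: ny; exists y.
pose F := filter_from K (fun y => [set z | K z /\ f y <= f z]).
have FF : Filter F.
  apply: filter_from_filter; first by exists x0.
  move=> i j Ki Kj; have [ij|/ltW ji] := leP (f i) (f j).
    by exists j => // z [Kz jz]; split; split=> //; exact: le_trans ij jz.
  by exists i => // z [Kz iz]; split; split=> //; exact: le_trans ji iz.
have := cK T F (fun z x => K x -> f x < f z) FF.
case=> [x Kx|y Ky /(_ y)]; last first.
  by move=> /(_ (conj Ky (lexx _)) y Ky Ky); rewrite ltxx.
have [y Ky xy] := above x Kx.
have [r fy] : exists r : R, f y = r%:E.
  have := flt y Ky; move: xy; case: (f y) => [r _ _|//|].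
    by exists r.
  by rewrite ltNge leNye.
have := fusc x Kx r; rewrite -fy => /(_ xy) h.
exists ([set x' | K x' -> f x' < f y], [set z | K z /\ f y <= f z]) => /=.
  by split; [exact: h|exists y].
by move=> [x' z] /= [h1 [Kz yz]] Kx'; apply: lt_le_trans yz; exact: h1.
Qed.

Lemma lteD_split (x y : \bar R) (a : R) : x < +oo -> y < +oo ->
  x + y < a%:E -> exists s t : R, [/\ x < s%:E, y < t%:E & (s + t <= a)%R].
Proof.
case: x => [x| |] //; case: y => [y| |] // _ _.
- rewrite -EFinD lte_fin => xya.
  exists (x + (a - x - y) / 2)%R, (y + (a - x - y) / 2)%R.
  by rewrite !lte_fin; split; lra.
- move=> _; exists (x + 1)%R, (a - x - 1)%R.
  by rewrite lte_fin ltNyr; split=> //; lra.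
- move=> _; exists (a - y - 1)%R, (y + 1)%R.
  by rewrite lte_fin ltNyr; split=> //; lra.
- by move=> _; exists a, 0%R; rewrite !ltNyr addr0.
Qed.

Lemma usc_withinD (T : topologicalType) (K : set T) (f g : T -> \bar R) :
  (forall x, K x -> f x < +oo) -> (forall x, K x -> g x < +oo) ->
  usc_within K f -> usc_within K g -> usc_within K (fun x => f x + g x).
Proof.
move=> foo goo fu gu x Kx a /(lteD_split (foo x Kx) (goo x Kx)).
move=> [s [t [fs gt sta]]].
have := gu x Kx t gt; have := fu x Kx s fs.
apply: filterS2 => y fy gy; apply: (@lt_le_trans _ _ (s%:E + t%:E)).
  exact: lteD.
by rewrite -EFinD lee_fin.
Qed.

Lemma usc_within_continuous (T : topologicalType) (K : set T) (c : T -> R) :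
  (forall x, K x -> {for x, continuous c}) ->
  usc_within K (fun x => (c x)%:E).
Proof.
move=> cc x Kx a; rewrite lte_fin => ca.
rewrite near_withinE; have h := @cvgr_lt R T (nbhs x) (nbhs_filter x) c (c x) (cc x Kx) a ca.
apply: (@filterS _ (nbhs x) _ _ _ _ h) => y ya _.
by rewrite lte_fin.
Qed.

Lemma usc_within_comp (T S : topologicalType) (K : set S) (L : set T)
  (f : S -> \bar R) (g : T -> S) : continuous g -> (forall x, L x -> K (g x)) ->
  usc_within K f -> usc_within L (f \o g).
Proof.
move=> gc gK fu x Lx a fa; have := fu (g x) (gK x Lx) a fa.
rewrite !near_withinE => h.
apply: (@filterS _ _ (nbhs_filter x) _ _ _ (gc x _ h)) => y hy Ly.
by apply: hy; exact: gK.
Qed.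

End UpperSemicontinuity.

(** * Sup-convolutions and test functions obtained from them *)

Section SupConvolution.
Context {R : realType} {n : nat}.
Implicit Types (K : set 'cV[R]_n) (u : 'cV[R]_n -> \bar R).

(** The norm on column vectors is the maximum norm, while the penalties have to be Euclidean. *)
Definition sqd (x y : 'cV[R]_n) : R := dot (x - y) (x - y).

Lemma sqd_ge0 x y : 0 <= sqd x y. Proof. exact: dot_ge0. Qed.

(** Only points where [u] is finite enter, which keeps the supremum real although [u] may take the
    value $-\infty$. *)
Definition sup_conv K u (eps : R) (xi : 'cV[R]_n) : R :=
  sup [set t | exists x a, [/\ K x, u x = a%:E & t = a - sqd x xi / (2 * eps)]].

Definition qjet (p : 'cV[R]_n) (A : 'M[R]_n) (h : 'cV[R]_n) : R :=
  dot p h + 2^-1 * dot h (A *m h).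

Lemma cvg_qjet (T : Type) (F : set_system T) (p : 'cV[R]_n) (A : 'M[R]_n)
  (g : T -> 'cV[R]_n) h :
  Filter F -> g @ F --> h -> (fun t => qjet p A (g t)) @ F --> qjet p A h.
Proof.
move=> FF gh.
have qE k : qjet p A k = dot p k + 2^-1 *
    \sum_j \sum_i (k j 0 * A j i * k i 0).
  rewrite /qjet [dot k _]dotE; congr (_ + _ * _).
  apply: eq_bigr => j _; rewrite mxE mulr_sumr.
  by apply: eq_bigr => i _; rewrite mulrA.
rewrite qE; under eq_fun do rewrite qE.
have c0 i : (fun t => g t i 0) @ F --> h i 0.
  exact: (cvg_comp _ _ gh (@coord_continuous R n 1 i 0 h)).
apply: cvgD; first by apply: cvg_dot => //; exact: cvg_cst.
apply: cvgM; first exact: cvg_cst.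
apply: cvg_sumr => j; apply: cvg_sumr => i.
by apply: cvgM => //; apply: cvgM => //; exact: cvg_cst.
Qed.

Context (K : set 'cV[R]_n) (u : 'cV[R]_n -> \bar R) (eps : R).
Hypothesis eps_gt0 : 0 < eps.
Hypothesis K_compact : compact K.
Hypothesis u_usc : usc_within K u.
Hypothesis u_lt : forall x, K x -> (u x < +oo)%E.
Hypothesis u_fin : exists x a, K x /\ u x = a%:E.

Let eps2 : 0 < 2 * eps. Proof. by rewrite mulr_gt0. Qed.

Let sup_conv_has_sup xi : has_sup
  [set t | exists x a, [/\ K x, u x = a%:E & t = a - sqd x xi / (2 * eps)]].
Proof.
have [x0 [a0 [Kx0 ux0]]] := u_fin; split.
  by exists (a0 - sqd x0 xi / (2 * eps)); exists x0, a0.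
have [x1 Kx1 umax] := usc_compact_max K_compact Kx0 u_lt u_usc.
have [m um] : exists m, u x1 = m%:E.
  have := u_lt Kx1; have := umax x0 Kx0; rewrite ux0.
  by case: (u x1) => // r _ _; exists r.
exists m => _ [x [a [Kx ux ->]]].
have := umax x Kx; rewrite ux um lee_fin => am.
have : 0 <= sqd x xi / (2 * eps) by rewrite divr_ge0 ?sqd_ge0 // ltW.
lra.
Qed.

Lemma sup_conv_ub xi x a : K x -> u x = a%:E ->
  a - sqd x xi / (2 * eps) <= sup_conv K u eps xi.
Proof.
move=> Kx ux; apply: sup_ubound; first by case: (sup_conv_has_sup xi).
by exists x, a.
Qed.

Lemma sup_conv_near xi t : 0 < t -> exists x a, [/\ K x, u x = a%:E &
  sup_conv K u eps xi - t < a - sqd x xi / (2 * eps)].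
Proof.
move=> t0; have [_ [x [a [Kx ux ->]]] h] := sup_adherent t0 (sup_conv_has_sup xi).
by exists x, a.
Qed.

Lemma sup_conv_semiconvex xi h :
  2 * sup_conv K u eps xi - dot h h / eps
  <= sup_conv K u eps (xi + h) + sup_conv K u eps (xi - h).
Proof.
apply/ler_addgt0Pr => t t0.
have t20 : 0 < t / 2 by rewrite divr_gt0.
have [x [a [Kx ux xP]]] := sup_conv_near xi t20.
have h1 := sup_conv_ub (xi + h) Kx ux; have h2 := sup_conv_ub (xi - h) Kx ux.
have e : sqd x (xi + h) / (2 * eps) + sqd x (xi - h) / (2 * eps) =
   2 * (sqd x xi / (2 * eps)) + dot h h / eps.
  by rewrite /sqd !dot_lin !(dotC h) (dotC xi x); field; rewrite gt_eqF.
move: (sqd x (xi + h) / (2 * eps)) (sqd x (xi - h) / (2 * eps))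
  (sqd x xi / (2 * eps)) (dot h h / eps) h1 h2 e xP => *; lra.
Qed.

(* If sup_conv is close to a quadratic on a ball, sliding the quadratic (made
   slightly more convex) down yields a test function for u itself, since u is
   touched where sup_conv is (the translation by x - xi). *)
Lemma sup_conv_touch (xi p : 'cV[R]_n) (A : 'M[R]_n) (alpha rad tau : R) :
  A^T = A -> 0 < rad -> 0 < tau ->
  (forall h, dot h h <= rad ^+ 2 ->
     `|sup_conv K u eps (xi + h) - (alpha + qjet p A h)| <= tau * rad ^+ 2) ->
  exists h x a, [/\ dot h h <= rad ^+ 2, K x, u x = a%:E,
    sup_conv K u eps (xi + h) - 2 * tau * rad ^+ 2
      <= a - sqd x (xi + h) / (2 * eps) &
    \forall y \near x, K y ->
      (u y <= (a + qjet (p + (A + (8 * tau)%:M) *m h) (A + (8 * tau)%:M) (y - x))%:E)%E].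
Proof.
move=> Asym rad0 tau0 close.
(* The extra $4\tau|h|^2$ beats the error $\tau\,\mathrm{rad}^2$ on both sides and forces
   $|h|^2\le\mathrm{rad}^2/2$ at a maximum, so contact is interior; its Hessian is the [8 * tau] of
   the conclusion. *)
pose q h := alpha + qjet p A h + 4 * tau * dot h h.
pose c (z : 'cV[R]_n * 'cV[R]_n) := - (sqd z.1 (xi + z.2) / (2 * eps) + q z.2).
pose B := [set h : 'cV[R]_n | dot h h <= rad ^+ 2].
(* Maximising in the point and the displacement jointly uses only the semicontinuity of [u], and no
   continuity of [sup_conv]. *)
pose f (z : 'cV[R]_n * 'cV[R]_n) := (u z.1 + (c z)%:E)%E.
have KB : compact (K `*` B) by apply: compact_setX => //; exact: compact_dot_ball.
have r20 : 0 < rad ^+ 2 by rewrite exprn_gt0.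
have B0 : B 0 by rewrite /B /= dot0r ltW.
have [x0 [a0 [Kx0 ux0]]] := u_fin.
have c_cvg (F : set_system ('cV[R]_n * 'cV[R]_n)) z : Filter F ->
    (fun z => z.1) @ F --> z.1 -> (fun z => z.2) @ F --> z.2 -> c @ F --> c z.
  move=> FF c1 c2; apply: cvgN; apply: cvgD.
    apply: cvgM; last exact: cvg_cst.
    have c3 : (fun z : 'cV[R]_n * 'cV[R]_n => z.1 - (xi + z.2)) @ F
        --> z.1 - (xi + z.2).
      by apply: cvgB => //; apply: cvgD => //; exact: cvg_cst.
    exact: cvg_dot.
  apply: cvgD; last by apply: cvgM; [exact: cvg_cst|exact: cvg_dot].
  by apply: cvgD; [exact: cvg_cst|exact: cvg_qjet].
have c_cont z : c @ z --> c z.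
  apply: (c_cvg (nbhs z) z (nbhs_filter z)); [exact: cvg_fst|exact: cvg_snd].
have f_usc : usc_within (K `*` B) f.
  apply: usc_withinD => //.
  - by move=> [x h] [/= Kx _]; exact: u_lt.
  - by move=> z _; exact: ltry.
  - have -> : (fun z : 'cV[R]_n * 'cV[R]_n => u z.1) = u \o fst by [].
    apply: (@usc_within_comp _ _ _ K) => //; last by move=> z [].
    by move=> z; exact: cvg_fst.
  - by apply: usc_within_continuous => z _; exact: c_cont.
have f_lt z : (K `*` B) z -> (f z < +oo)%E.
  by move=> [Kz _]; rewrite lte_add_pinfty ?ltry // u_lt.
have [[x h] [/= Kx Bh] fmax] :=
  @usc_compact_max R _ _ f (x0, 0) KB (conj Kx0 B0) f_lt f_usc.
have fmaxR y b k : K y -> u y = b%:E -> B k -> ((b + c (y, k))%:E <= f (x, h))%E.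
  by move=> Ky uy Bk; have := fmax (y, k) (conj Ky Bk); rewrite {1}/f /= uy.
have [a ux] : exists a, u x = a%:E.
  have := fmaxR x0 a0 0 Kx0 ux0 B0; have := u_lt Kx; rewrite /f /=.
  by case: (u x) => // r _ _; exists r.
have fE : f (x, h) = (a + c (x, h))%:E by rewrite /f /= ux.
have q0 : qjet p A 0 = 0 by rewrite /qjet mulmx0 !dot0r mulr0 addr0.
have max0 : - (tau * rad ^+ 2) <= a + c (x, h).
  apply/ler_addgt0Pl => t t0.
  have [y [b [Ky uy yP]]] := sup_conv_near xi t0.
  have := fmaxR y b 0 Ky uy B0; rewrite fE lee_fin.
  have := close 0 B0; rewrite addr0 q0 addr0 ler_norml => /andP[h1 _].
  rewrite /c /= addr0 /q q0 dot0r mulr0 !addr0.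
  move: (sqd y xi / (2 * eps)) yP h1 => *; lra.
have top := sup_conv_ub (xi + h) Kx ux.
have := close h Bh; rewrite ler_norml => /andP[cl1 cl2].
have cE : c (x, h) = - (sqd x (xi + h) / (2 * eps)) - (alpha + qjet p A h)
   - 4 * tau * dot h h by rewrite /c /q /=; ring.
have hh : dot h h < rad ^+ 2.
  have h1 : 4 * (tau * dot h h) <= 2 * (tau * rad ^+ 2).
    move: max0; rewrite cE -mulrA.
    move: (sqd x (xi + h) / (2 * eps)) (tau * dot h h) (tau * rad ^+ 2) top cl2.
    move=> *; lra.
  have tr : 0 < tau * rad ^+ 2 by rewrite mulr_gt0.
  rewrite -(ltr_pM2l tau0); move: (tau * dot h h) (tau * rad ^+ 2) h1 tr => *; lra.
exists h, x, a; split=> //.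
  have th : 0 <= 4 * tau * dot h h by rewrite !mulr_ge0 ?dot_ge0 // ltW.
  move: max0; rewrite cE -(mulrA 2).
  move: (sqd x (xi + h) / (2 * eps)) (4 * tau * dot h h) (tau * rad ^+ 2) th top cl1 cl2.
  by move=> *; lra.
have near_hh : \forall y \near x, dot (h + (y - x)) (h + (y - x)) < rad ^+ 2.
  have shift_cvg (F : set_system 'cV[R]_n) : Filter F -> id @ F --> x ->
      (fun y : 'cV[R]_n => h + (y - x)) @ F --> h + (x - x).
    move=> FF Fx; apply: cvgD; first exact: cvg_cst.
    by apply: cvgB => //; exact: cvg_cst.
  have c3 := shift_cvg (nbhs x) (nbhs_filter x) cvg_id.
  have c4 := @cvg_dot R n _ (nbhs x) _ _ _ _ (nbhs_filter x) c3 c3.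
  have h0 : dot (h + (x - x)) (h + (x - x)) < rad ^+ 2 by rewrite subrr addr0.
  exact: (@cvgr_lt R _ (nbhs x) (nbhs_filter x) _ _ c4 _ h0).
apply: (@filterS _ _ (nbhs_filter x) _ _ _ near_hh) => y hy Ky.
case uy : (u y) => [b| |]; last by rewrite leNye.
  have := fmaxR y b (h + (y - x)) Ky uy (ltW hy); rewrite fE !lee_fin.
  have -> : c (y, h + (y - x)) = - (sqd x (xi + h) / (2 * eps))
     - q (h + (y - x)).
    rewrite /c /= /sqd; have -> : y - (xi + (h + (y - x))) = x - (xi + h).
      by apply/matrixP => i j; rewrite !mxE; ring.
    by rewrite opprD.
  have -> : c (x, h) = - (sqd x (xi + h) / (2 * eps)) - q h by rewrite /c /= opprD.
  move: (y - x) => d le1.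
  have qE : q (h + d) - q h =
      qjet (p + (A + (8 * tau)%:M) *m h) (A + (8 * tau)%:M) d.
    rewrite /q /qjet !(mulmxDr, mulmxDl) !mul_scalar_mx !dot_lin.
    rewrite -[dot h (A *m d)](dot_sym h d Asym) (dotC d (A *m h)) (dotC d h).
    by field.
  by rewrite -qE; move: (q (h + d)) (q h) le1 => *; lra.
by have := u_lt Ky; rewrite uy.
Qed.

End SupConvolution.

Section Blocks.
Context {R : realType} {n : nat}.

Lemma dot_col (a b c d : 'cV[R]_n) :
  dot (col_mx a b) (col_mx c d) = dot a c + dot b d.
Proof. by rewrite /dot tr_col_mx mul_row_col mxE. Qed.

Lemma mul_col0r (P : 'M[R]_(n + n)) (h : 'cV[R]_n) :
  P *m col_mx h 0 = col_mx (ulsubmx P *m h) (dlsubmx P *m h).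
Proof. by rewrite -{1}[P]submxK mul_block_col !mulmx0 !addr0. Qed.

Lemma mul_col0l (P : 'M[R]_(n + n)) (h : 'cV[R]_n) :
  P *m col_mx 0 h = col_mx (ursubmx P *m h) (drsubmx P *m h).
Proof. by rewrite -{1}[P]submxK mul_block_col !mulmx0 !add0r. Qed.

Lemma col_mx_split (h k : 'cV[R]_n) : col_mx h k = col_mx h 0 + col_mx 0 k.
Proof. by rewrite add_col_mx addr0 add0r. Qed.

Lemma dot_eq0 m (x : 'cV[R]_m) : dot x x = 0 -> x = 0.
Proof.
move=> x0; apply/matrixP => i j; rewrite ord1 mxE; apply/eqP.
by rewrite -sqrf_eq0 eq_le sqr_ge0 -x0 coord_le_dot.
Qed.

Lemma dotD_le m (x y : 'cV[R]_m) : dot (x + y) (x + y) <= 2 * dot x x + 2 * dot y y.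
Proof. by have := dot_ge0 (x - y); rewrite !dot_lin (dotC y x); lra. Qed.

(** Cauchy-Schwarz along the path [x], [xi], [eta], [y]; equality holds for equally spaced points of
    a segment. *)
Lemma sqd3_le (x xi eta y : 'cV[R]_n) :
  sqd x y / 3 <= sqd x xi + sqd xi eta + sqd y eta.
Proof.
have -> : sqd y eta = sqd eta y by rewrite /sqd -opprB dotNl dotNr opprK.
have [p pE] : exists p, p = x - xi by exists (x - xi).
have [q qE] : exists q, q = xi - eta by exists (xi - eta).
have [r rE] : exists r, r = eta - y by exists (eta - y).
have xyE : x - y = p + q + r by rewrite pE qE rE !addrA !subrK.
rewrite /sqd xyE -pE -qE -rE.
have := dot_ge0 (p - q); have := dot_ge0 (q - r); have := dot_ge0 (p - r).
by rewrite !dot_lin (dotC q p) (dotC r p) (dotC r q); lra.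
Qed.

Lemma dot5_le (a b c d e : 'cV[R]_n) :
  dot (a + b + c + d + e) (a + b + c + d + e)
  <= 5 * (dot a a + dot b b + dot c c + dot d d + dot e e).
Proof.
have := dot_ge0 (a - b); have := dot_ge0 (a - c); have := dot_ge0 (a - d).
have := dot_ge0 (a - e); have := dot_ge0 (b - c); have := dot_ge0 (b - d).
have := dot_ge0 (b - e); have := dot_ge0 (c - d); have := dot_ge0 (c - e).
have := dot_ge0 (d - e); rewrite !dot_lin.
rewrite (dotC b a) (dotC c a) (dotC d a) (dotC e a) (dotC c b) (dotC d b).
by rewrite (dotC e b) (dotC d c) (dotC e c) (dotC e d) => *; lra.
Qed.

Lemma slope_error (p z h k Ah : 'cV[R]_n) (theta kappa t ie : R) :
  0 < t -> t <= 1 -> 0 < theta ->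
  dot p p <= t -> dot z z <= t -> dot h h <= t -> dot k k <= t ->
  dot Ah Ah <= (2 * kappa) ^+ 2 * dot h h ->
  dot (p + (2 * theta) *: z - Ah + (2 * theta + 32 * t) *: h + ie *: k)
      (p + (2 * theta) *: z - Ah + (2 * theta + 32 * t) *: h + ie *: k)
  <= 5 * (t * (1 + (2 * theta) ^+ 2 + (2 * kappa) ^+ 2 + (2 * theta + 32) ^+ 2
               + ie ^+ 2)).
Proof.
move=> t0 t1 th0 pt zt ht kt At; apply: (le_trans (dot5_le _ _ _ _ _)).
have Z a x : dot (a *: x) (a *: x) = dot x x * a ^+ 2 :> R.
  by rewrite dotZl dotZr; ring.
rewrite ler_pM2l // !Z dotNl dotNr opprK.
rewrite (mulrDr t _ (ie ^+ 2)) (mulrDr t _ ((2 * theta + 32) ^+ 2)).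
rewrite (mulrDr t _ ((2 * kappa) ^+ 2)) (mulrDr t 1) mulr1.
apply: lerD; [apply: lerD; [apply: lerD; [apply: lerD => //|]|]|].
- by rewrite ler_wpM2r ?sqr_ge0.
- by apply: (le_trans At); rewrite mulrC ler_wpM2r ?sqr_ge0.
- apply: ler_pM; rewrite ?dot_ge0 ?sqr_ge0 // lerXn2r ?nnegrE //.
  + by rewrite addr_ge0 ?mulr_ge0 // ltW.
  + by rewrite addr_ge0 ?mulr_ge0 // ltW.
  + lra.
- by rewrite ler_wpM2r ?sqr_ge0.
Qed.

(** In a mixed second difference everything depending on one of the two variables alone cancels.
    Applied to [w] on the doubled space, it removes both sup-convolutions, so the off-diagonal block
    [beta] of [P] is controlled by the explicit coupling only. *)
Lemma mixed_bound (w1 w2 w3 w4 a p2 p3 x y beta m t : R) :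
  `|w1 - (a + (p2 + p3) - 2^-1 * (x + y + 2 * beta))| <= t ->
  `|w2 - (a + p2 - 2^-1 * x)| <= t -> `|w3 - (a + p3 - 2^-1 * y)| <= t ->
  `|w4 - a| <= t -> w1 - w2 - w3 + w4 = m -> beta <= - m + 4 * t.
Proof.
rewrite !ler_norml => /andP[_ h1] /andP[h2 _] /andP[h3 _] /andP[_ h4] h5.
lra.
Qed.

End Blocks.

Section Sums.
Context {R : realType} {n : nat}.
Variables (K : set 'cV[R]_n) (u v : 'cV[R]_n -> \bar R) (eps Theta : R).
Hypothesis eps_gt0 : 0 < eps.
Hypothesis K_compact : compact K.
Hypothesis u_usc : usc_within K u.
Hypothesis v_usc : usc_within K v.
Hypothesis u_lt : forall x, K x -> (u x < +oo)%E.
Hypothesis v_lt : forall x, K x -> (v x < +oo)%E.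
Hypothesis Theta_ub : forall x y a b, K x -> K y -> u x = a%:E -> v y = b%:E ->
  a + b - sqd x y / (6 * eps) <= Theta.
Hypothesis Theta_max : exists x y a b, [/\ K x, K y, u x = a%:E, v y = b%:E &
  Theta = a + b - sqd x y / (6 * eps)].

Local Notation U := (sup_conv K u eps).
Local Notation V := (sup_conv K v eps).

Let u_fin : exists x a, K x /\ u x = a%:E.
Proof. by have [x [y [a [b []]]]] := Theta_max; exists x, a. Qed.

Let v_fin : exists x a, K x /\ v x = a%:E.
Proof. by have [x [y [a [b []]]]] := Theta_max; exists y, b. Qed.

Let UV_le xi eta : U xi + V eta - sqd xi eta / (2 * eps) <= Theta.
Proof.
apply/ler_addgt0Pr => t t0; have t20 : 0 < t / 2 by rewrite divr_gt0.
have [x [a [Kx ux xP]]] := sup_conv_near eps_gt0 K_compact u_usc u_lt u_fin xi t20.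
have [y [b [Ky vy yP]]] := sup_conv_near eps_gt0 K_compact v_usc v_lt v_fin eta t20.
have := Theta_ub Kx Ky ux vy.
have h : sqd x y / (6 * eps) <=
   sqd x xi / (2 * eps) + sqd xi eta / (2 * eps) + sqd y eta / (2 * eps).
  have -> : sqd x y / (6 * eps) = sqd x y / 3 / (2 * eps).
    by field; rewrite gt_eqF.
  by rewrite -!mulrDl ler_pM2r ?sqd3_le // invr_gt0 mulr_gt0.
move: (sqd x y / (6 * eps)) (sqd x xi / (2 * eps)) (sqd xi eta / (2 * eps))
  (sqd y eta / (2 * eps)) h xP yP => *; lra.
Qed.

Let UV_max : exists xi eta, U xi + V eta - sqd xi eta / (2 * eps) = Theta.
Proof.
have [x [y [a [b [Kx Ky ux vy ThE]]]]] := Theta_max.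
(* The points dividing the segment from [x] to [y] into thirds, where the three penalties add up to
   $|x-y|^2/(6\varepsilon)$. *)
exists (3^-1 *: (2 *: x + y)), (3^-1 *: (x + 2 *: y)).
set xi := _ *: _; set eta := 3^-1 *: (x + _).
apply/eqP; rewrite eq_le UV_le /= ThE.
have h1 := sup_conv_ub eps_gt0 K_compact u_usc u_lt u_fin xi Kx ux.
have h2 := sup_conv_ub eps_gt0 K_compact v_usc v_lt v_fin eta Ky vy.
have e1 : sqd x xi = sqd x y / 9.
  rewrite /sqd; have -> : x - xi = 3^-1 *: (x - y).
    by apply/matrixP => i j; rewrite !mxE; field.
  by rewrite dotZl dotZr; field.
have e2 : sqd y eta = sqd x y / 9.
  rewrite /sqd; have -> : y - eta = - 3^-1 *: (x - y).
    by apply/matrixP => i j; rewrite !mxE; field.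
  by rewrite dotZl dotZr; field.
have e3 : sqd xi eta = sqd x y / 9.
  rewrite /sqd; have -> : xi - eta = 3^-1 *: (x - y).
    by apply/matrixP => i j; rewrite !mxE; field.
  by rewrite dotZl dotZr; field.
rewrite e1 e2 in h1 h2; rewrite e3.
have -> : sqd x y / (6 * eps) = 3 * (sqd x y / 9 / (2 * eps)).
  by field; rewrite gt_eqF.
move: (sqd x y / 9 / (2 * eps)) h1 h2 => *; lra.
Qed.

Lemma sup_conv_sum_max :
  [/\ exists x a, K x /\ u x = a%:E, exists x a, K x /\ v x = a%:E,
      forall xi eta, U xi + V eta - sqd xi eta / (2 * eps) <= Theta &
      exists xi eta, U xi + V eta - sqd xi eta / (2 * eps) = Theta].
Proof. by split. Qed.

End Sums.

(** [jensen_quadratic] is applied on the doubled space to the two sup-convolutions minus their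
    coupling. Freezing one variable gives each sup-convolution its own quadratic, hence by
    [sup_conv_touch] a genuine test function; [tau] replaces the passage to limits of jets. The
    joint bound on [A] and [B] combines $P\ge0$ with the bound on its off-diagonal block. *)
Lemma approx_sums (R : realType) n (K : set 'cV[R]_n) (u v : 'cV[R]_n -> \bar R)
    (eps Theta tau : R) :
  0 < eps -> compact K -> usc_within K u -> usc_within K v ->
  (forall x, K x -> (u x < +oo)%E) -> (forall x, K x -> (v x < +oo)%E) ->
  (forall x y a b, K x -> K y -> u x = a%:E -> v y = b%:E ->
     a + b - sqd x y / (6 * eps) <= Theta) ->
  (exists x y a b, [/\ K x, K y, u x = a%:E, v y = b%:E &
     Theta = a + b - sqd x y / (6 * eps)]) ->
  0 < tau ->
  exists (x y xi eta p q : 'cV[R]_n) (A B : 'M[R]_n) (a b : R),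
  [/\ K x, K y, u x = a%:E & v y = b%:E] /\
  [/\ Theta - tau <= a + b - (sqd x xi + sqd xi eta + sqd y eta) / (2 * eps),
      dot (p - eps^-1 *: (xi - eta)) (p - eps^-1 *: (xi - eta)) <= tau,
      dot (q + eps^-1 *: (xi - eta)) (q + eps^-1 *: (xi - eta)) <= tau &
      [/\ A^T = A, B^T = B & forall c d,
        dot c (A *m c) + dot d (B *m d)
        <= dot (c - d) (c - d) / eps + tau * (dot c c + dot d d)]] /\
  (\forall z \near x, K z -> (u z <= (a + qjet p A (z - x))%:E)%E) /\
  (\forall z \near y, K z -> (v z <= (b + qjet q B (z - y))%:E)%E).
Proof.
move=> eps_gt0 K_compact u_usc v_usc u_lt v_lt Theta_ub Theta_max.
have [u_fin v_fin] := sup_conv_sum_max eps_gt0 K_compact u_usc v_usc u_lt v_lt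
  Theta_ub Theta_max.
have := sup_conv_semiconvex eps_gt0 K_compact u_usc u_lt u_fin.
have := sup_conv_semiconvex eps_gt0 K_compact v_usc v_lt v_fin.
have := sup_conv_touch eps_gt0 K_compact u_usc u_lt u_fin.
have := sup_conv_touch eps_gt0 K_compact v_usc v_lt v_fin.
move: (sup_conv K u eps) (sup_conv K v eps) => U V.
move=> touchV touchU semiV semiU UV_le UV_max.
move=> tau0; have [xi0 [eta0 max0]] := UV_max.
pose theta := tau / 4; have theta0 : 0 < theta by rewrite divr_gt0.
(* The sup-convolutions contribute $1/(2\varepsilon)$ on the doubled space, the coupling
   $1/\varepsilon$, because $|h_1-h_2|^2\le 2|h|^2$, and the strictness term contributes [theta]. *)
pose kappa := 3 / (2 * eps) + theta.
have e2_gt0 : 0 < 2 * eps by rewrite mulr_gt0.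
have ie0 : 0 < eps^-1 by rewrite invr_gt0.
have kappa0 : 0 < kappa by rewrite addr_gt0 // divr_gt0.
pose w (z : 'cV[R]_(n + n)) := U (xi0 + usubmx z) + V (eta0 + dsubmx z)
  - sqd (xi0 + usubmx z) (eta0 + dsubmx z) / (2 * eps) - theta * dot z z.
have w_le z : w z <= Theta - theta * dot z z by rewrite /w lerD2r UV_le.
have w0 : w 0 = Theta by rewrite /w !linear0 !addr0 dot0r mulr0 subr0.
have w_sc z h : 2 * w z - 2 * kappa * dot h h <= w (z + h) + w (z - h).
  rewrite /w !linearD !linearN /= !addrA.
  set X := xi0 + usubmx z; set Y := eta0 + dsubmx z.
  have h1 := semiU X (usubmx h).
  have h2 := semiV Y (dsubmx h).
  have e : sqd (X + usubmx h) (Y + dsubmx h) / (2 * eps)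
     + sqd (X - usubmx h) (Y - dsubmx h) / (2 * eps) =
     2 * (sqd X Y / (2 * eps)) + sqd (usubmx h) (dsubmx h) / eps.
    rewrite /sqd; have -> : X + usubmx h - (Y + dsubmx h) =
      X - Y + (usubmx h - dsubmx h) by apply/matrixP => i j; rewrite !mxE; ring.
    have -> : X - usubmx h - (Y - dsubmx h) =
      X - Y - (usubmx h - dsubmx h) by apply/matrixP => i j; rewrite !mxE; ring.
    move: (X - Y) (usubmx h - dsubmx h) => s t; rewrite !dot_lin (dotC t s).
    by field; rewrite gt_eqF.
  have hE : dot h h = dot (usubmx h) (usubmx h) + dot (dsubmx h) (dsubmx h).
    by rewrite -[in LHS](vsubmxK h) dot_col.
  have le1 : sqd (usubmx h) (dsubmx h) / eps <= 2 * (dot h h / eps).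
    have := dotD_le (usubmx h) (- dsubmx h); rewrite dotNl dotNr opprK.
    by rewrite /sqd hE mulrA -mulrDr ler_pM2r.
  have e3 : 2 * kappa * dot h h = 3 * (dot h h / eps) + 2 * (theta * dot h h).
    by rewrite /kappa; field; rewrite gt_eqF.
  have e4 : theta * dot (z + h) (z + h) + theta * dot (z - h) (z - h) =
     2 * (theta * dot z z) + 2 * (theta * dot h h).
    by rewrite !dot_lin (dotC h z); ring.
  have e5 : dot h h / eps = dot (usubmx h) (usubmx h) / eps
     + dot (dsubmx h) (dsubmx h) / eps by rewrite hE mulrDl.
  move: h1 h2 e le1 e4 e5; rewrite e3.
  move: (U (X + _)) (U (X - _)) (V (Y + _)) (V (Y - _)) (U X) (V Y)
   (sqd (X + _) _ / _) (sqd (X - _) _ / _) (sqd X Y / _) (sqd _ _ / eps)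
   (theta * dot (z + h) (z + h)) (theta * dot (z - h) (z - h)) (theta * dot z z)
   (theta * dot h h) (dot (usubmx h) (usubmx h) / eps)
   (dot (dsubmx h) (dsubmx h) / eps) (dot h h / eps) => *; lra.
pose G := 1 + (2 * theta) ^+ 2 + (2 * kappa) ^+ 2 + (2 * theta + 32) ^+ 2 + eps^-1 ^+ 2.
have G1 : 1 <= G.
  by rewrite /G; have := sqr_ge0 (2 * theta); have := sqr_ge0 (2 * kappa);
    have := sqr_ge0 (2 * theta + 32); have := sqr_ge0 eps^-1; lra.
have D0 : 0 < 9 + kappa + 5 * G + 80 by lra.
(* The summand [9 + kappa] serves the near-maximality, [5 * G] the slopes, and 80 the Hessians:
   there $40\tau_1\le\tau/2$, and $2\theta=\tau/2$ is the other half. *)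
pose tau1 := Num.min 1 (tau / (9 + kappa + 5 * G + 80)).
have tau10 : 0 < tau1 by rewrite lt_min ltr01 divr_gt0.
have tau11 : tau1 <= 1 by rewrite ge_min lexx.
have tau1D : tau1 * (9 + kappa + 5 * G + 80) <= tau.
  by rewrite -ler_pdivlMr // ge_min lexx orbT.
have t1G : 5 * (tau1 * G) <= tau.
  apply: le_trans tau1D; rewrite mulrCA ler_pM2l //; lra.
have t1k : tau1 * (9 + kappa) <= tau by apply: le_trans tau1D; rewrite ler_pM2l //; lra.
have t180 : tau1 * 80 <= tau by apply: le_trans tau1D; rewrite ler_pM2l //; lra.
have [zb [p [P [rad [a0 [[/andP[rad0 radt] zbt pt wzb] [Psym Ppos Pbd close]]]]]]] :=
  jensen_quadratic kappa0 theta0 w_sc w_le w0 tau10.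
have [p1 [p2 pE]] : exists p1 p2 : 'cV[R]_n, p = col_mx p1 p2.
  by exists (usubmx p), (dsubmx p); rewrite vsubmxK.
have [z1 [z2 zE]] : exists z1 z2 : 'cV[R]_n, zb = col_mx z1 z2.
  by exists (usubmx zb), (dsubmx zb); rewrite vsubmxK.
rewrite zE in zbt wzb close; rewrite pE in pt close.
have [xb xbE] : exists xb, xb = xi0 + z1 by exists (xi0 + z1).
have [yb ybE] : exists yb, yb = eta0 + z2 by exists (eta0 + z2).
have wE h k : w (col_mx z1 z2 + col_mx h k) =
    U (xb + h) + V (yb + k) - sqd (xb + h) (yb + k) / (2 * eps)
    - theta * (dot (z1 + h) (z1 + h) + dot (z2 + k) (z2 + k)).
  by rewrite /w add_col_mx !col_mxKu !col_mxKd dot_col xbE ybE !addrA.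
have [D DE] : exists D, D = xb - yb by exists (xb - yb).
have sqdE h k : sqd (xb + h) (yb + k) = dot (D + h - k) (D + h - k).
  rewrite /sqd DE; congr (dot _ _); by apply/matrixP => i j; rewrite !mxE; ring.
pose A1 := ulsubmx P; pose B1 := drsubmx P.
have A1sym : A1^T = A1 by rewrite /A1 trmx_ulsub Psym.
have B1sym : B1^T = B1 by rewrite /B1 trmx_drsub Psym.
have PA h : dot (col_mx h 0) (P *m col_mx h 0) = dot h (A1 *m h).
  by rewrite mul_col0r dot_col dot0l addr0.
have PB k : dot (col_mx 0 k) (P *m col_mx 0 k) = dot k (B1 *m k).
  by rewrite mul_col0l dot_col dot0l add0r.
pose c1 := eps^-1 + 2 * theta.
pose Au := c1%:M - A1; pose Av := c1%:M - B1.
have Ausym : Au^T = Au by rewrite /Au linearB /= tr_scalar_mx A1sym.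
have Avsym : Av^T = Av by rewrite /Av linearB /= tr_scalar_mx B1sym.
have [pu puE] : exists pu, pu = p1 + eps^-1 *: D + (2 * theta) *: z1.
  by exists (p1 + eps^-1 *: D + (2 * theta) *: z1).
have [pv pvE] : exists pv, pv = p2 - eps^-1 *: D + (2 * theta) *: z2.
  by exists (p2 - eps^-1 *: D + (2 * theta) *: z2).
have [zz zzE] : exists zz, zz = theta * (dot z1 z1 + dot z2 z2).
  by exists (theta * (dot z1 z1 + dot z2 z2)).
(* With half the radius, the displacements [h] and [k], found separately, still form a pair in the
   ball where [w] is approximated. *)
pose r1 := rad / 2; have r10 : 0 < r1 by rewrite divr_gt0.
have r1E : 4 * r1 ^+ 2 = rad ^+ 2 by rewrite /r1; field.
have rad2 : 0 < rad ^+ 2 by rewrite exprn_gt0.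
have tau4 : 0 < 4 * tau1 by rewrite mulr_gt0.
have epsN : eps != 0 by rewrite gt_eqF.
have closeU h : dot h h <= r1 ^+ 2 ->
    `|U (xb + h) - (a0 - V yb + dot D D / (2 * eps) + zz + qjet pu Au h)|
    <= 4 * tau1 * r1 ^+ 2.
  move=> hr; have hr' : dot (col_mx h (0 : 'cV[R]_n)) (col_mx h 0) <= rad ^+ 2.
    rewrite dot_col dot0l addr0 -r1E; move: (r1 ^+ 2) hr (exprn_gt0 2 r10); clear=> *; lra.
  have := close (col_mx h 0) hr'.
  rewrite wE sqdE PA dot_col dot0r !addr0 subr0.
  have -> : tau1 * rad ^+ 2 = 4 * tau1 * r1 ^+ 2 by rewrite -r1E; ring.
  congr (`|_| <= _); rewrite /qjet /Au mulmxBl mul_scalar_mx puE zzE.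
  rewrite !dot_lin (dotC h D) (dotC h z1) /c1; by field.
have closeV k : dot k k <= r1 ^+ 2 ->
    `|V (yb + k) - (a0 - U xb + dot D D / (2 * eps) + zz + qjet pv Av k)|
    <= 4 * tau1 * r1 ^+ 2.
  move=> kr; have kr' : dot (col_mx (0 : 'cV[R]_n) k) (col_mx 0 k) <= rad ^+ 2.
    rewrite dot_col dot0l add0r -r1E; move: (r1 ^+ 2) kr (exprn_gt0 2 r10); clear=> *; lra.
  have := close (col_mx 0 k) kr'.
  rewrite wE sqdE PB dot_col dot0r add0r !addr0.
  have -> : tau1 * rad ^+ 2 = 4 * tau1 * r1 ^+ 2 by rewrite -r1E; ring.
  congr (`|_| <= _); rewrite /qjet /Av mulmxBl mul_scalar_mx pvE zzE.
  rewrite !dot_lin (dotC k D) (dotC k z2) /c1; by field.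
have [h [x [a [hr Kx ux xsup xtest]]]] :=
  touchU _ _ _ _ _ _ Ausym r10 tau4 closeU.
have [k [y [b [kr Ky vy ysup ytest]]]] :=
  touchV _ _ _ _ _ _ Avsym r10 tau4 closeV.
exists x, y, (xb + h), (yb + k).
exists (pu + (Au + (8 * (4 * tau1))%:M) *m h), (pv + (Av + (8 * (4 * tau1))%:M) *m k).
exists (Au + (8 * (4 * tau1))%:M), (Av + (8 * (4 * tau1))%:M), a, b.
split; first by split.
split; last by split.
have rt : rad ^+ 2 <= tau1.
  by rewrite expr2 (le_trans _ radt) // ler_piMr ?(ltW rad0) // (le_trans radt).
have r1t : r1 ^+ 2 <= tau1 by move: rt; rewrite -r1E; move: (exprn_gt0 2 r10); clear; lra.
have hh := le_trans hr r1t; have kk := le_trans kr r1t.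
have [pt1 pt2] : dot p1 p1 <= tau1 /\ dot p2 p2 <= tau1.
  rewrite dot_col in pt; move: pt (dot_ge0 p1) (dot_ge0 p2).
  by clear=> *; split; lra.
have [zt1 zt2] : dot z1 z1 <= tau1 /\ dot z2 z2 <= tau1.
  rewrite dot_col in zbt; move: zbt (dot_ge0 z1) (dot_ge0 z2).
  by clear=> *; split; lra.
have A1h : dot (A1 *m h) (A1 *m h) <= (2 * kappa) ^+ 2 * dot h h.
  have := Pbd (col_mx h 0); rewrite mul_col0r !dot_col dot0l addr0.
  by apply: le_trans; rewrite lerDl dot_ge0.
have B1k : dot (B1 *m k) (B1 *m k) <= (2 * kappa) ^+ 2 * dot k k.
  have := Pbd (col_mx 0 k); rewrite mul_col0l !dot_col dot0l add0r.
  by apply: le_trans; rewrite lerDr dot_ge0.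
split.
- have [X XE] : exists X, X = col_mx h k by exists (col_mx h k).
  have XX : dot X X <= rad ^+ 2.
    by rewrite XE dot_col -r1E; move: (r1 ^+ 2) hr kr (exprn_gt0 2 r10); clear=> *; lra.
  have Xrt := le_trans XX rt.
  have c1X := close X XX.
  have c0X : `|w (col_mx z1 z2) - a0| <= tau1 * rad ^+ 2.
    have := close 0; rewrite mulmx0 !dot0r addr0 mulr0 subr0 addr0.
    by apply; exact: ltW.
  have pX := @dot_young R _ 1 (- col_mx p1 p2) X ltr01.
  rewrite !(dotNl, dotNr) opprK mul1r divr1 in pX.
  have k20 : 0 < 2 * kappa by rewrite mulr_gt0.
  have PX := @dot_young R _ (2 * kappa) X (P *m X) k20.
  have PX2 : dot X (P *m X) <= 2 * kappa * tau1.
    have h1 : dot (P *m X) (P *m X) / (2 * kappa) <= 2 * kappa * tau1.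
      rewrite ler_pdivrMr // (le_trans (Pbd X)) //.
      rewrite [leRHS](_ : _ = (2 * kappa) ^+ 2 * tau1); last by ring.
      by rewrite ler_pM2l // exprn_gt0.
    have h2 : 2 * kappa * dot X X <= 2 * kappa * tau1 by rewrite ler_pM2l.
    by move: (2 * kappa * dot X X) (2 * kappa * tau1) h1 h2 PX; clear=> *; lra.
  have trr : tau1 * rad ^+ 2 <= tau1 by rewrite ler_piMr ?(ltW tau10) // (le_trans rt).
  move: c1X; rewrite XE wE; have thpos : 0 <= theta * (dot (z1 + h) (z1 + h)
     + dot (z2 + k) (z2 + k)) by rewrite mulr_ge0 ?addr_ge0 ?dot_ge0 // ltW.
  move: c0X; rewrite !ler_norml => /andP[_ c0X] /andP[c1X _].
  rewrite -XE in c1X.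
  have e1 : 2 * (4 * tau1) * r1 ^+ 2 = 2 * (tau1 * rad ^+ 2) by rewrite -r1E; ring.
  rewrite e1 in xsup ysup.
  have tk : tau1 * (9 + kappa) = 9 * tau1 + kappa * tau1 by ring.
  have tk' : 2 * kappa * tau1 = 2 * (kappa * tau1) by ring.
  rewrite tk in t1k; rewrite tk' in PX2.
  rewrite (mulrDl _ (sqd y _)) (mulrDl (sqd x _)).
  move: (theta * (_ + _)) (kappa * tau1) (tau1 * rad ^+ 2) (sqd x (xb + h) / _)
    (sqd (xb + h) (yb + k) / _) (sqd y (yb + k) / _) (dot X (P *m X))
    (dot (col_mx p1 p2) X) (dot X X) (dot (col_mx p1 p2) (col_mx p1 p2))
    (w _) (U _) (V _) thpos t1k trr xsup ysup PX2 pX Xrt pt c0X c1X wzb.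
  by clear=> *; lra.
- have -> : pu + (Au + (8 * (4 * tau1))%:M) *m h - eps^-1 *: (xb + h - (yb + k)) =
     p1 + (2 * theta) *: z1 - A1 *m h + (2 * theta + 32 * tau1) *: h + eps^-1 *: k.
    rewrite puE DE /Au /c1 mulmxDl mulmxBl !mul_scalar_mx.
    by apply/matrixP => i j; rewrite !mxE; ring.
  by apply: (le_trans _ t1G); exact: slope_error.
- have -> : pv + (Av + (8 * (4 * tau1))%:M) *m k + eps^-1 *: (xb + h - (yb + k)) =
     p2 + (2 * theta) *: z2 - B1 *m k + (2 * theta + 32 * tau1) *: k + eps^-1 *: h.
    rewrite pvE DE /Av /c1 mulmxDl mulmxBl !mul_scalar_mx.
    by apply/matrixP => i j; rewrite !mxE; ring.
  by apply: (le_trans _ t1G); exact: slope_error.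
- split; first by rewrite linearD /= Ausym tr_scalar_mx.
    by rewrite linearD /= Avsym tr_scalar_mx.
  move=> c d; pose s := dot c c + dot d d.
  have polar h' k' : dot (col_mx h' k') (P *m col_mx h' k') =
      dot (col_mx h' 0) (P *m col_mx h' 0) + dot (col_mx 0 k') (P *m col_mx 0 k')
      + 2 * dot (col_mx h' 0) (P *m col_mx 0 k').
    have cr : dot (col_mx 0 k') (P *m col_mx h' 0) =
        dot (col_mx h' 0) (P *m col_mx 0 k').
      by rewrite -(dot_sym _ _ Psym) dotC.
    by rewrite col_mx_split mulmxDr dotDl !dotDr cr; ring.
  have linp h' k' : dot (col_mx p1 p2) (col_mx h' k') =
      dot (col_mx p1 p2) (col_mx h' 0) + dot (col_mx p1 p2) (col_mx 0 k').
    by rewrite (col_mx_split h' k') dotDr.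
  have cross : dot (col_mx c 0) (P *m col_mx 0 d) <= - dot c d / eps + 4 * tau1 * s.
    have s0 : 0 <= s by rewrite addr_ge0 ?dot_ge0.
    have := s0; rewrite le_eqVlt => /orP[/eqP sE|spos].
      have c0 : c = 0.
        by apply: dot_eq0; have := dot_ge0 c; have := dot_ge0 d; rewrite /s in sE; move: sE; clear; lra.
      by rewrite c0 col_mx0 !dot0l oppr0 mul0r add0r !mulr_ge0 // ltW.
    (* Scaling [(c, d)] to length [rad] turns the error $4\tau_1\mathrm{rad}^2$ into $4\tau_1 s$
       after division by $t^2$. *)
    pose t := rad / Num.sqrt s.
    have t0 : 0 < t by rewrite divr_gt0 // sqrtr_gt0.
    have ts : t ^+ 2 * s = rad ^+ 2.
      by rewrite /t expr_div_n sqr_sqrtr // divfK // gt_eqF.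
    have dcd : dot (t *: c) (t *: c) + dot (t *: d) (t *: d) = rad ^+ 2.
      by rewrite -ts /s !dotZl !dotZr; ring.
    have dc := dot_ge0 (t *: c); have dd := dot_ge0 (t *: d).
    have m1 : dot (col_mx (t *: c) (t *: d)) (col_mx (t *: c) (t *: d)) <= rad ^+ 2.
      by rewrite dot_col dcd.
    have m2 : dot (col_mx (t *: c) (0 : 'cV[R]_n)) (col_mx (t *: c) 0) <= rad ^+ 2.
      by rewrite dot_col dot0l addr0 -dcd lerDl.
    have m3 : dot (col_mx (0 : 'cV[R]_n) (t *: d)) (col_mx 0 (t *: d)) <= rad ^+ 2.
      by rewrite dot_col dot0l add0r -dcd lerDr.
    have l1 := close _ m1; have l2 := close _ m2; have l3 := close _ m3.
    have l4 : `|w (col_mx z1 z2 + col_mx 0 0) - a0| <= tau1 * rad ^+ 2.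
      rewrite col_mx0; have := close 0.
      by rewrite mulmx0 !dot0r [a0 + 0]addr0 mulr0 subr0; apply; exact: ltW.
    have mix : w (col_mx z1 z2 + col_mx (t *: c) (t *: d))
        - w (col_mx z1 z2 + col_mx (t *: c) 0) - w (col_mx z1 z2 + col_mx 0 (t *: d))
        + w (col_mx z1 z2 + col_mx 0 0) = t ^+ 2 * (dot c d / eps).
      rewrite !wE !sqdE !addr0 !subr0 !dot_lin (dotC d c) (dotC d D) (dotC c D).
      by field.
    rewrite (polar (t *: c) (t *: d)) linp in l1.
    have := mixed_bound l1 l2 l3 l4 mix.
    have -> : dot (col_mx (t *: c) 0) (P *m col_mx 0 (t *: d)) =
        t ^+ 2 * dot (col_mx c 0) (P *m col_mx 0 d).
      have -> : col_mx (t *: c) 0 = t *: col_mx c (0 : 'cV[R]_n).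
        by rewrite scale_col_mx scaler0.
      have -> : col_mx 0 (t *: d) = t *: col_mx (0 : 'cV[R]_n) d.
        by rewrite scale_col_mx scaler0.
      by rewrite -scalemxAr dotZl dotZr; ring.
    have t20 : 0 < t ^+ 2 by rewrite exprn_gt0.
    rewrite -ts => h1; rewrite -(ler_pM2l t20); apply: (le_trans h1).
    by rewrite le_eqVlt; apply/orP; left; apply/eqP; field.
  have Pcd := Ppos (col_mx c d); rewrite polar PA PB in Pcd.
  have ts : (2 * theta + 40 * tau1) * s <= tau * s.
    rewrite ler_wpM2r ?addr_ge0 ?dot_ge0 // /theta.
    by move: t180; clear; lra.
  rewrite /Au /Av !mulmxDl !mulNmx !mul_scalar_mx !(dotDr _ _ c)
    !(dotDr _ _ d).
  rewrite !(dotNr c) !(dotNr d) !(dotZr _ c) !(dotZr _ d).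
  have -> : dot (c - d) (c - d) / eps = s / eps - 2 * (dot c d / eps).
    by rewrite /s !dot_lin (dotC d c); field.
  have sie : s / eps = dot c c / eps + dot d d / eps by rewrite /s mulrDl.
  have E1 : c1 * dot c c = dot c c / eps + 2 * theta * dot c c by rewrite /c1; ring.
  have E2 : c1 * dot d d = dot d d / eps + 2 * theta * dot d d by rewrite /c1; ring.
  have E3 : (2 * theta + 40 * tau1) * s = 2 * theta * dot c c + 2 * theta * dot d d
     + 40 * (tau1 * dot c c) + 40 * (tau1 * dot d d) by rewrite /s; ring.
  have E4 : 8 * (4 * tau1) * dot c c = 32 * (tau1 * dot c c) by ring.
  have E5 : 8 * (4 * tau1) * dot d d = 32 * (tau1 * dot d d) by ring.
  have E6 : 4 * tau1 * s = 4 * (tau1 * dot c c) + 4 * (tau1 * dot d d).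
    by rewrite /s; ring.
  have E7 : - dot c d / eps = - (dot c d / eps) by rewrite mulNr.
  rewrite E6 E7 in cross; rewrite E3 in ts; rewrite E1 E2 E4 E5 sie -/s.
  move: (dot c d / eps) (dot c c / eps) (dot d d / eps) (tau * s)
    (2 * theta * dot c c) (2 * theta * dot d d) (tau1 * dot c c) (tau1 * dot d d)
    (dot (col_mx c 0) (P *m col_mx 0 d)) (dot c (A1 *m c)) (dot d (B1 *m d))
    Pcd ts cross.
  by clear=> *; lra.
Qed.

(** * Test jets and jet-equivalences *)

Section QuadraticJets.
Context {R : realType} {n : nat}.

Lemma derive_quadratic (V : normedModType R) (f : V -> R) (x v : V) (c0 c1 : R) :
  (forall h : R, f (h *: v + x) = f x + h * c0 + h ^+ 2 * c1) ->
  'D_v f x = c0.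
Proof.
move=> fE; rewrite /derive; apply: cvg_lim; first exact: norm_hausdorff.
have idc : (fun h : R => h) @ 0^' --> (0 : R) by move=> A /nbhs_dnbhs.
have h1 : (fun h : R => c0 + h * c1) @ 0^' --> c0.
  rewrite -[X in _ --> X]addr0 -[X in _ + X](mul0r c1).
  by apply: cvgD; [exact: cvg_cst|apply: cvgM => //; exact: cvg_cst].
apply: cvg_trans h1; apply: near_eq_cvg.
have := nbhs_dnbhs_neq (0 : R); apply: filterS => h h0.
by rewrite /= fE -[f x + _ + _]addrA addrAC subrr add0r /GRing.scale /=; field.
Qed.

Context (a : R) (p x0 : 'cV[R]_n) (A : 'M[R]_n).
Hypothesis Asym : A^T = A.

Definition qfun (x : 'cV[R]_n) : R := a + qjet p A (x - x0).

Lemma qfun_shift (v x : 'cV[R]_n) (h : R) :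
  qfun (h *: v + x) = qfun x + h * (dot p v + dot v (A *m (x - x0)))
                      + h ^+ 2 * (2^-1 * dot v (A *m v)).
Proof.
rewrite /qfun /qjet -[h *: v + x - x0]addrA; move: (x - x0) => d.
rewrite !mulmxDr -!scalemxAr !dot_lin -[dot d (A *m v)](dot_sym d v Asym).
by rewrite (dotC (A *m d)); field.
Qed.

Lemma partial_qfun i : partial i qfun = fun x => p i 0 + (A *m (x - x0)) i 0.
Proof.
apply/funext => x; rewrite /partial (derive_quadratic (fun h => qfun_shift _ x h)).
by rewrite dot_delta dotC dot_delta.
Qed.

Lemma partial_affine i j :
  partial j (fun x => p i 0 + (A *m (x - x0)) i 0) = fun=> A i j.
Proof.
apply/funext => x; rewrite /partial; apply: (@derive_quadratic _ _ _ _ _ 0) => h.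
have -> : (A *m (h *: delta_mx j 0 + x - x0)) i 0 =
    h * A i j + (A *m (x - x0)) i 0.
  rewrite -[_ + x - x0]addrA mulmxDr -scalemxAr -colE [LHS]mxE.
  by congr (_ + _); rewrite !mxE.
by ring.
Qed.

Lemma differentiable_affine (b : R) (M : 'M[R]_n) i (x : 'cV[R]_n) :
  differentiable (fun x => b + (M *m (x - x0)) i 0) x.
Proof.
apply: differentiableD; first exact: differentiable_cst.
have -> : (fun x : 'cV[R]_n => (M *m (x - x0)) i 0) =
    \sum_k (fun x : 'cV[R]_n => M i k * (x k 0 - x0 k 0)).
  apply/funext => y; rewrite mxE fct_sumE; apply: eq_bigr => k _.
  by rewrite !mxE.
apply: differentiable_sum => k; apply: differentiableM.
  exact: differentiable_cst.
apply: differentiableD; last exact: differentiable_cst.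
exact: differentiable_coord.
Qed.

Lemma differentiable_qfun x : differentiable qfun x.
Proof.
have -> : qfun = (fun=> a) + \sum_k (fun x : 'cV[R]_n =>
    (x k 0 - x0 k 0) * (p k 0 + (2^-1 *: A *m (x - x0)) k 0)).
  apply/funext => y; rewrite /qfun /qjet /= fctE fct_sumE; congr (_ + _).
  rewrite (dotC p) -dotZr -dotDr dotE; apply: eq_bigr => k _.
  by rewrite -scalemxAl !mxE.
apply: differentiableD; first exact: differentiable_cst.
apply: differentiable_sum => k; apply: differentiableM.
  apply: differentiableD; last exact: differentiable_cst.
  exact: differentiable_coord.
exact: differentiable_affine.
Qed.

Lemma qfun_C2 : C2_near x0 qfun.
Proof.
apply: (@nearW _ _ _ (nbhs_filter x0)) => y; split; first exact: differentiable_qfun.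
  by move=> i; rewrite partial_qfun; exact: differentiable_affine.
by move=> i j; rewrite partial_qfun partial_affine; exact: cst_continuous.
Qed.

Lemma jet2_qfun : jet2 qfun x0 = (a, p, A).
Proof.
rewrite /jet2; congr (_, _, _).
- by rewrite /qfun subrr /qjet mulmx0 !dot0r mulr0 !addr0.
- apply/matrixP => i j; rewrite ord1 mxE partial_qfun subrr mulmx0 [X in _ + X]mxE.
  by rewrite addr0.
- by apply/matrixP => i j; rewrite mxE partial_qfun partial_affine.
Qed.

End QuadraticJets.

Lemma subharmonic_jet (R : realType) n (G : set ('cV[R]_n * jet R n)) (Y : set 'cV[R]_n)
    (u : 'cV[R]_n -> \bar R) (x p : 'cV[R]_n) (A : 'M[R]_n) (a : R) :
  subharmonic G Y u -> Y x -> A^T = A -> u x = a%:E ->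
  (\forall y \near x, (u y <= (a + qjet p A (y - x))%:E)%E) ->
  G (x, (a, p, A)).
Proof.
move=> [_ _ test] Yx As ux near_le; rewrite -(jet2_qfun a p x As).
apply: test => //; first exact: qfun_C2.
by rewrite ux /qfun subrr /qjet mulmx0 !dot0r mulr0 !addr0.
Qed.

(** * Entrywise estimates and the gap between two transported jets *)

Section MatrixBounds.
Context {R : realType} {n : nat}.
Local Notation N := (n%:R : R).

Lemma dot_cauchy (x y : 'cV[R]_n) : dot x y ^+ 2 <= dot x x * dot y y.
Proof.
have := dot_ge0 y; rewrite le_eqVlt => /orP[/eqP y0|y0].
  by rewrite (dot_eq0 (esym y0)) !dot0r mulr0 expr0n.
have := dot_ge0 (dot y y *: x - dot x y *: y).
rewrite !dot_lin (dotC y x) => h.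
rewrite -subr_ge0 -(pmulr_rge0 _ y0); apply: le_trans h _.
by rewrite le_eqVlt; apply/orP; left; apply/eqP; ring.
Qed.

Definition mx_le m (M : 'M[R]_(n, m)) (c : R) := forall i j, `|M i j| <= c.

Lemma mx_leD m (M M' : 'M[R]_(n, m)) c c' :
  mx_le M c -> mx_le M' c' -> mx_le (M + M') (c + c').
Proof.
by move=> h h' i j; rewrite mxE (le_trans (ler_normD _ _)) // lerD.
Qed.

Lemma mx_leN m (M : 'M[R]_(n, m)) c : mx_le M c -> mx_le (- M) c.
Proof. by move=> h i j; rewrite mxE normrN. Qed.

Lemma mx_leW m (M : 'M[R]_(n, m)) c c' : c <= c' -> mx_le M c -> mx_le M c'.
Proof. by move=> cc h i j; exact: le_trans cc. Qed.

Lemma mx_le_sum m (I : finType) (M : I -> 'M[R]_(n, m)) c :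
  (forall i, mx_le (M i) c) -> mx_le (\sum_i M i) (#|I|%:R * c).
Proof.
move=> h i j; rewrite summxE (le_trans (ler_norm_sum _ _ _)) //.
apply: (@le_trans _ _ (\sum_(k : I) c)); first by apply: ler_sum => k _; exact: h.
by rewrite sumr_const -[leLHS]mulr_natl.
Qed.

Lemma mx_leM m (M : 'M[R]_n) (M' : 'M[R]_(n, m)) c c' :
  mx_le M c -> mx_le M' c' -> mx_le (M *m M') (N * (c * c')).
Proof.
move=> h h' i j; rewrite mxE (le_trans (ler_norm_sum _ _ _)) //.
apply: (@le_trans _ _ (\sum_(k < n) c * c')).
  by apply: ler_sum => k _; rewrite normrM ler_pM.
by rewrite sumr_const card_ord -[leLHS]mulr_natl.
Qed.

Lemma dot_mul_le (M : 'M[R]_n) c w : mx_le M c ->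
  dot (M *m w) (M *m w) <= (N * c) ^+ 2 * dot w w.
Proof.
move=> h.
have row_le i : (M *m w) i 0 ^+ 2 <= N * c ^+ 2 * dot w w.
  have -> : (M *m w) i 0 = dot (row i M)^T w.
    by rewrite dotE mxE; apply: eq_bigr => j _; rewrite !mxE.
  apply: le_trans (dot_cauchy _ _) _; rewrite ler_wpM2r ?dot_ge0 //.
  rewrite dotE; apply: (@le_trans _ _ (\sum_(j < n) c ^+ 2)).
    apply: ler_sum => j _; rewrite !mxE -expr2 -real_normK ?num_real //.
    by rewrite lerXn2r ?nnegrE // (le_trans (normr_ge0 _) (h i j)).
  by rewrite sumr_const card_ord -[leLHS]mulr_natl.
rewrite dotE; apply: (@le_trans _ _ (\sum_(i < n) N * c ^+ 2 * dot w w)).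
  by apply: ler_sum => i _; rewrite -expr2.
rewrite sumr_const card_ord -[leLHS]mulr_natl.
by rewrite le_eqVlt; apply/orP; left; apply/eqP; ring.
Qed.

Lemma qform_ge (M : 'M[R]_n) c d w : 0 < d -> N * c <= d -> 0 <= c ->
  mx_le M c -> - (d * dot w w) <= dot w (M *m w).
Proof.
move=> d0 cd c0 h; have := dot_young (- w) (M *m w) d0.
rewrite !dotNl dotNr opprK => h1.
have h2 : dot (M *m w) (M *m w) / d <= d * dot w w.
  rewrite ler_pdivrMr // (le_trans (dot_mul_le w h)) //.
  have -> : d * dot w w * d = d ^+ 2 * dot w w by ring.
  rewrite ler_wpM2r ?dot_ge0 // lerXn2r // nnegrE ?mulr_ge0 //.
  exact: ltW.
by move: (dot (M *m w) (M *m w) / d) (d * dot w w) h1 h2 => *; lra.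
Qed.

Lemma linear_sum_delta (L : {linear 'cV[R]_n -> 'M[R]_n}) (v : 'cV[R]_n) :
  L v = \sum_k v k 0 *: L (delta_mx k 0).
Proof.
have {1}-> : v = \sum_k v k 0 *: delta_mx k 0.
  apply/matrixP => i j; rewrite ord1 summxE (bigD1 i) //= big1 ?addr0.
    by rewrite !mxE !eqxx mulr1.
  by move=> k ki; rewrite !mxE eq_sym (negbTE ki) mulr0.
by rewrite linear_sum; apply: eq_bigr => k _; rewrite linearZ.
Qed.

Lemma linear_mx_le (L : {linear 'cV[R]_n -> 'M[R]_n}) c (p : 'cV[R]_n) d :
  (forall k, mx_le (L (delta_mx k 0)) c) -> (forall k, `|p k 0| <= d) ->
  mx_le (L p) (N * (d * c)).
Proof.
move=> Lc pd; rewrite linear_sum_delta -[n in n%:R]card_ord.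
apply: mx_le_sum => k i j.
by rewrite mxE normrM; apply: ler_pM => //; exact: Lc.
Qed.

(** The gradients at the doubled maximum may blow up as the penalty parameter tends to 0; only their
    product with the distance [e] is small. The Lipschitz factor [e] is therefore kept together with
    the vector. *)
Lemma mx_leM_weighted (M : 'M[R]_n) (v : 'cV[R]_n) e c d : 0 <= c ->
  mx_le M (c * e) -> (forall k, e * `|v k 0| <= d) -> mx_le (M *m v) (N * (c * d)).
Proof.
move=> c0 Mc vd i j; rewrite mxE (le_trans (ler_norm_sum _ _ _)) //.
apply: (@le_trans _ _ (\sum_(k < n) c * d)).
  apply: ler_sum => k _; rewrite normrM ord1.
  apply: (@le_trans _ _ (c * e * `|v k 0|)); first by rewrite ler_wpM2r.
  by rewrite -mulrA ler_wpM2l.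
by rewrite sumr_const card_ord -[leLHS]mulr_natl.
Qed.

Lemma linear_mx_le_weighted (L L' : {linear 'cV[R]_n -> 'M[R]_n}) (v : 'cV[R]_n)
  e c d : 0 <= c ->
  (forall k, mx_le (L (delta_mx k 0) - L' (delta_mx k 0)) (c * e)) ->
  (forall k, e * `|v k 0| <= d) -> mx_le (L v - L' v) (N * (c * d)).
Proof.
move=> c0 Lc vd; rewrite !linear_sum_delta -sumrB -[n in n%:R]card_ord.
apply: mx_le_sum => k i j; rewrite -scalerBr mxE normrM.
apply: (@le_trans _ _ (`|v k 0| * (c * e))); first by rewrite ler_wpM2l //; exact: Lc.
by rewrite mulrCA ler_wpM2l // mulrC.
Qed.

Lemma mx_le_tr (M : 'M[R]_n) c : mx_le M c -> mx_le M^T c.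
Proof. by move=> h i j; rewrite mxE. Qed.

Lemma dot_conj (h S : 'M[R]_n) w :
  dot w ((h *m S *m h^T) *m w) = dot (h^T *m w) (S *m (h^T *m w)).
Proof. by rewrite -!mulmxA dot_trl trmxK. Qed.

Lemma conj_sym (h S : 'M[R]_n) : S^T = S -> (h *m S *m h^T)^T = h *m S *m h^T.
Proof. by move=> Ss; rewrite !trmx_mul trmxK Ss mulmxA. Qed.


(** [e] stands for $|x-y|$, and [kp], [kA] for the freedom in a neighbourhood of the dual jet. All
    errors are $O(t)$ with constants depending on [C] and the dimension, whereas subtracting
    [omega%:M] from [A] gains a fixed positive amount, as [hx] is uniformly invertible. So [t0] and
    [lam] are fixed before the penalty and the points. *)
Lemma jet_gap (C omega : R) : 1 <= C -> 0 < omega ->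
  exists t0 lam : R, [/\ 0 < t0, 0 < lam &
  forall (t eps e tau : R) (gx gy hx hy A B kA : 'M[R]_n) (p p2 kp : 'cV[R]_n)
    (Lx Ly : {linear 'cV[R]_n -> 'M[R]_n}),
  0 < t -> t <= t0 -> 0 < eps -> 0 <= e -> e ^+ 2 <= 3 * t * eps ->
  0 <= tau -> tau <= t ->
  gx \in unitmx -> hx \in unitmx ->
  [/\ mx_le (invmx gx) C, mx_le (invmx hx) C, mx_le hx C & mx_le hy C] ->
  mx_le (gy - gx) (C * e) -> mx_le (hx - hy) (C * e) ->
  (forall k, mx_le (Lx (delta_mx k 0)) C) ->
  (forall k, mx_le (Ly (delta_mx k 0) - Lx (delta_mx k 0)) (C * e)) ->
  (forall r, sym_mx (Lx r)) -> (forall r, sym_mx (Ly r)) ->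
  [/\ A^T = A, B^T = B & kA^T = kA] ->
  mx_le (p2 - p) (2 * t) -> (forall k, e * `|p2 k 0| <= 3 * t) ->
  mx_le kp t -> mx_le kA t ->
  (forall c d, dot c (A *m c) + dot d (B *m d)
     <= dot (c - d) (c - d) / eps + tau * (dot c c + dot d d)) ->
  exists d : 'cV[R]_n,
  [/\ mx_le d omega, gx *m (p + d) = gy *m p2 + kp &
      psd (- (hy *m B *m hy^T) + Ly p2 + kA
           - (hx *m (A - omega%:M) *m hx^T + Lx (p + d)) - lam%:M)]].
Proof.
move=> C1 om0; have C0 : 0 <= C by exact: le_trans C1.
have N0 : 0 <= N by rewrite ler0n.
pose Kp := N * (C * (N * (C * 3) + 1)) + 2.
have Kp2 : 2 <= Kp by rewrite /Kp lerDr !mulr_ge0 // addr_ge0 // !mulr_ge0.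
pose D := (N * C) ^+ 2 + 1.
have D1 : 1 <= D by rewrite /D lerDr sqr_ge0.
have D0 : 0 < D by exact: lt_le_trans D1.
pose K3 := N * (C * 3) + 1 + N * ((2 + Kp) * C).
have K30 : 0 <= K3.
  by rewrite /K3 !addr_ge0 ?mulr_ge0 // addr_ge0 // (le_trans _ Kp2).
(* $\omega\,h_xh_x^t\ge\omega/D=2\lambda$. Half of one [lam] pays for the errors
   ([Q * t <= lam / 2]), and a full [lam] is left for tameness. *)
pose lam := omega / (2 * D); have lam0 : 0 < lam by rewrite divr_gt0 ?mulr_gt0.
pose Q := 5 * (N * C) ^+ 2 + N * K3 + 1.
have Q0 : 0 < Q by rewrite /Q ltr_wpDl // addr_ge0 ?mulr_ge0 ?sqr_ge0.
have Kp0 : 0 < Kp by exact: lt_le_trans Kp2.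
exists (Num.min (omega / Kp) (lam / 2 / Q)), lam.
split=> //; first by rewrite lt_min (divr_gt0 om0 Kp0) (divr_gt0 (divr_gt0 lam0 _) Q0).
move=> t eps e tau gx gy hx hy A B kA p p2 kp Lx Ly t0.
rewrite le_min => /andP[tK tQ] eps0 e0 ee tau0 taut gxu hxu [gC hC hxC hyC]
  gyx hxy LxC Lyx Lxs Lys [As Bs kAs] p2p ep2 kpt kAt sums.
have tK' : Kp * t <= omega by rewrite mulrC -ler_pdivlMr.
have tQ' : Q * t <= lam / 2 by rewrite mulrC -ler_pdivlMr.
(* The unique correction that makes the two transported gradients equal; it is $O(t)$, hence within
   the allowance [omega]. *)
have [d dE0] : exists d, d = invmx gx *m (gy *m p2 + kp) - p.
  by exists (invmx gx *m (gy *m p2 + kp) - p).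
have dE : d = invmx gx *m ((gy - gx) *m p2 + kp) + (p2 - p).
  by rewrite dE0 mulmxBl addrAC mulmxBr mulKmx // addrA subrK.
have dK : mx_le d (Kp * t).
  rewrite dE; have -> : Kp * t = N * (C * (N * (C * (3 * t)) + t)) + 2 * t.
    by rewrite /Kp; ring.
  apply: mx_leD => //; apply: mx_leM => //; apply: mx_leD => //.
  exact: mx_leM_weighted.
have gE : gx *m (p + d) = gy *m p2 + kp.
  by rewrite dE0 addrC subrK mulKVmx.
exists d; split=> //; first exact: mx_leW dK.
have [M3 M3d] : exists M3, M3 = Ly p2 + kA - Lx (p + d).
  by exists (Ly p2 + kA - Lx (p + d)).
have M3E : M3 = (Ly p2 - Lx p2) + kA + Lx (p2 - p - d).
  rewrite M3d !linearB linearD /=.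
  by apply/matrixP => i j; rewrite !mxE; ring.
have M3K : mx_le M3 (K3 * t).
  rewrite M3E; have -> : K3 * t = N * (C * (3 * t)) + t + N * ((2 * t + Kp * t) * C).
    by rewrite /K3; ring.
  apply: mx_leD; first by apply: mx_leD => //; exact: linear_mx_le_weighted.
  apply: linear_mx_le => // k.
  by have := mx_leD p2p (mx_leN dK); apply.
have M3s : M3^T = M3.
  by rewrite M3d linearB linearD /= kAs Lxs Lys.
set P' := (X in psd X).
have P'E : P' = M3 - hy *m B *m hy^T - hx *m A *m hx^T
    + hx *m omega%:M *m hx^T - lam%:M.
  rewrite /P' M3d mulmxBr mulmxBl.
  by apply/matrixP => i j; rewrite !mxE; ring.
have P's : P'^T = P'.
  rewrite P'E; move: M3s (conj_sym hy Bs) (conj_sym hx As).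
  move: (hy *m B *m hy^T) (hx *m A *m hx^T) => S1 S2 M3s' S1s S2s.
  by rewrite !(linearB, linearD) /= M3s' S1s S2s !conj_sym ?tr_scalar_mx.
split=> // w.
have -> : (w^T *m P' *m w) 0 0 = dot w (P' *m w) by rewrite /dot mulmxA.
rewrite P'E !(mulmxDl, mulNmx) !(dotDr _ _ w) !(dotNr w) !dot_conj.
rewrite !mul_scalar_mx !dotZr.
(* With these test vectors $y-z=(h_x-h_y)^tw$ has size $O(e|w|)$, so the singular term
   $|y-z|^2/\varepsilon$ is only $O(t|w|^2)$. *)
have [y yE] : exists y, y = hx^T *m w by exists (hx^T *m w).
have [z zE] : exists z, z = hy^T *m w by exists (hy^T *m w).
rewrite -yE -zE; have := sums y z.
have yz : dot (y - z) (y - z) <= (N * (C * e)) ^+ 2 * dot w w.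
  rewrite yE zE -mulmxBl -linearB; apply: dot_mul_le; exact: mx_le_tr.
have yw : dot y y <= (N * C) ^+ 2 * dot w w.
  by rewrite yE; apply: dot_mul_le; exact: mx_le_tr.
have zw : dot z z <= (N * C) ^+ 2 * dot w w.
  by rewrite zE; apply: dot_mul_le; exact: mx_le_tr.
have wy : dot w w <= D * dot y y.
  have -> : w = (invmx hx)^T *m y by rewrite yE mulmxA -trmx_mul mulmxV // trmx1 mul1mx.
  apply: (@le_trans _ _ ((N * C) ^+ 2 * dot y y)).
    by apply: dot_mul_le; exact: mx_le_tr.
  by rewrite ler_wpM2r ?dot_ge0 // /D lerDl.
have ww := dot_ge0 w.
have tq : Q * t = 5 * ((N * C) ^+ 2 * t) + N * (K3 * t) + t by rewrite /Q; ring.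
have NCt : 0 <= (N * C) ^+ 2 * t by rewrite mulr_ge0 ?sqr_ge0 // ltW.
have NK3 : 0 <= N * (K3 * t) by rewrite !mulr_ge0 // ltW.
have del0 : 0 < N * (K3 * t) + t by rewrite ltr_wpDl.
have K3t : 0 <= K3 * t by rewrite mulr_ge0 // ltW.
have h3 : - ((N * (K3 * t) + t) * dot w w) <= dot w (M3 *m w).
  by apply: qform_ge M3K; rewrite ?lerDl // ltW.
have h1 : dot (y - z) (y - z) / eps <= 3 * ((N * C) ^+ 2 * t * dot w w).
  rewrite ler_pdivrMr // (le_trans yz) //.
  have -> : (N * (C * e)) ^+ 2 * dot w w = (N * C) ^+ 2 * dot w w * e ^+ 2 by ring.
  have -> : 3 * ((N * C) ^+ 2 * t * dot w w) * eps =
    (N * C) ^+ 2 * dot w w * (3 * t * eps) by ring.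
  by rewrite ler_wpM2l // mulr_ge0 ?sqr_ge0.
have h2 : tau * (dot y y + dot z z) <= 2 * ((N * C) ^+ 2 * t * dot w w).
  apply: (@le_trans _ _ (t * (dot y y + dot z z))).
    by rewrite ler_wpM2r ?addr_ge0 ?dot_ge0.
  have -> : 2 * ((N * C) ^+ 2 * t * dot w w) =
    t * ((N * C) ^+ 2 * dot w w + (N * C) ^+ 2 * dot w w) by ring.
  by rewrite ler_pM2l // lerD.
have h4 : 2 * lam * dot w w <= omega * dot y y.
  have -> : 2 * lam = omega / D by rewrite /lam; field; rewrite gt_eqF.
  by rewrite mulrAC -mulrA ler_pM2l // ler_pdivrMr // mulrC.
have h5 : Q * t * dot w w <= lam / 2 * dot w w by rewrite ler_wpM2r.
rewrite tq in h5; move: h1 h2 h3 h4 h5.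
have -> : (5 * ((N * C) ^+ 2 * t) + N * (K3 * t) + t) * dot w w =
  5 * ((N * C) ^+ 2 * t * dot w w) + (N * (K3 * t) + t) * dot w w by ring.
have -> : 2 * lam * dot w w = 2 * (lam * dot w w) by ring.
have -> : lam / 2 * dot w w = lam * dot w w / 2 by ring.
have lw : 0 <= lam * dot w w by rewrite mulr_ge0 // ltW.
move: lw.
move: (dot y (A *m y)) (dot z (B *m z)) (lam * dot w w)
  ((N * C) ^+ 2 * t * dot w w) ((N * (K3 * t) + t) * dot w w)
  (omega * dot y y) (dot w (M3 *m w)) (dot (y - z) (y - z) / eps)
  (tau * (dot y y + dot z z)) => *.
lra.
Qed.

End MatrixBounds.

(** * From local to uniform bounds on compact sets *)

Section CompactBounds.
Context {R : realType}.

(** Serves for bounds and for moduli alike: a radius is written as the inverse of [C], which makes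
    such properties monotone in [C]. *)
Lemma compact_bound (T : topologicalType) (K : set T) (Q : R -> T -> Prop) :
  compact K -> (forall C C' x, C <= C' -> Q C x -> Q C' x) ->
  (forall x, K x -> exists C, \forall x' \near x, Q C x') ->
  exists C, forall x, K x -> Q C x.
Proof.
move=> /compact_near_coveringP cK Qmon Qloc.
have := cK R (pinfty_nbhs R) Q _.
case=> [x Kx|M [_ MP]].
  have [C0 C0P] := Qloc x Kx.
  exists ([set x' | Q C0 x'], [set C | C0 <= C]) => /=.
    by split => //; apply: nbhs_pinfty_ge; rewrite num_real.
  by move=> [x' C] /= [h1 h2]; exact: Qmon h1.
by exists (M + 1) => x Kx; apply: MP => //; rewrite ltrDl.
Qed.

Lemma mx_norm_entry m n (M : 'M[R]_(m, n)) i j : `|M i j| <= `|M|.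
Proof.
by rewrite [leRHS]/Num.norm /= mx_normrE; apply/bigmax_geP; right => /=; exists (i, j).
Qed.

Lemma mx_norm_le m n (M : 'M[R]_(m, n)) c : 0 <= c ->
  (forall i j, `|M i j| <= c) -> `|M| <= c.
Proof.
by move=> c0 h; rewrite [leLHS]/Num.norm /= mx_normrE; apply/bigmax_leP; split.
Qed.

Lemma vec_norm_sq_le n (x : 'cV[R]_n) : `|x| ^+ 2 <= dot x x.
Proof.
have h : `|x| <= Num.sqrt (dot x x).
  apply: mx_norm_le => [|i j]; first exact: sqrtr_ge0.
  rewrite ord1 -sqrtr_sqr; apply: ler_wsqrtr; exact: coord_le_dot.
rewrite -[leRHS]sqr_sqrtr ?dot_ge0 // lerXn2r ?nnegrE //; exact: sqrtr_ge0.
Qed.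

Lemma lipschitz_on_compact n (W : normedModType R) (X K : set 'cV[R]_n)
  (f : 'cV[R]_n -> W) :
  open X -> compact K -> K `<=` X -> locally_lipschitz X f ->
  exists C, 0 < C /\ forall x, K x -> forall y, `|y - x| < C^-1 ->
     X y /\ `|f y - f x| <= C * `|y - x|.
Proof.
move=> oX cK KX lip.
pose Q C (x : 'cV[R]_n) := 0 < C /\ forall y, `|y - x| < C^-1 ->
     X y /\ `|f y - f x| <= C * `|y - x|.
have [||C CP] := @compact_bound _ K Q cK.
- move=> C C' x CC [C0 CP]; have C'0 := lt_le_trans C0 CC.
  split=> // y yx; have [|Xy fy] := CP y.
    by apply: (lt_le_trans yx); rewrite lef_pV2.
  by split=> //; apply: (le_trans fy); rewrite ler_wpM2r.
- move=> x Kx; have Xx := KX x Kx.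
  have [U Ux [M [_ MP]]] := lip x Xx.
  have : nbhs x (U `&` X) by apply: filterI => //; exact: open_nbhs_nbhs.
  move=> /nbhs_ballP[e /= e0 ballUX].
  have MM : `|M| + 1 > M by rewrite (le_lt_trans (ler_norm M)) // ltrDl.
  have fM := MP _ MM.
  pose C0 := `|M| + 1 + 2 / e.
  have C00 : 0 < C0 by rewrite /C0 addr_gt0 ?divr_gt0 // ltr_wpDl.
  exists C0; apply/nbhs_ballP; exists (e / 2); first by rewrite /= divr_gt0.
  move=> x' xx'; split=> // y yx'.
  have Ux' : (U `&` X) x'.
    by apply: ballUX; apply: le_ball xx'; move: e0; lra.
  have Uy : (U `&` X) y.
    apply: ballUX; rewrite -ball_normE /= distrC.
    have -> : y - x = (y - x') + (x' - x) by rewrite addrA subrK.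
    apply: (le_lt_trans (ler_normD _ _)).
    rewrite -ball_normE /= distrC in xx'.
    have C0e : C0^-1 <= e / 2.
      rewrite -[e / 2]invf_div lef_pV2 ?posrE ?divr_gt0 //.
      by rewrite /C0 lerDr addr_ge0.
    have := lt_le_trans yx' C0e; move: xx'; lra.
  split; first by case: Uy.
  have := fM (y, x') (conj Uy Ux') => /= h; apply: (le_trans h).
  by rewrite ler_wpM2r // /C0 lerDl divr_ge0 // ltW.
- have [x0|K0] := pselect (exists x, K x); last first.
    by exists 1; split=> // x Kx; case: K0; exists x.
  have [x Kx] := x0; have [C0 _] := CP x Kx.
  by exists C; split=> // x' /CP[].
Qed.

Lemma continuous_bounded_on_compact (T : topologicalType) (K : set T) (f : T -> R) :
  compact K -> (forall x, K x -> f @ x --> f x) ->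
  exists C, forall x, K x -> `|f x| <= C.
Proof.
move=> cK fc; apply: (compact_bound cK) => [C C' x CC h|x Kx].
  exact: le_trans CC.
exists (`|f x| + 1).
have := @cvgr_dist_le _ _ _ _ (nbhs_filter x) _ _ (fc x Kx) _ ltr01.
apply: filterS => y yx.
by rewrite -[f y](subrK (f x)) addrC (le_trans (ler_normD _ _)) // lerD2l distrC.
Qed.

Lemma cvg_prodr (I T : Type) (s : seq I) (F : set_system T) (f : I -> T -> R)
  (a : I -> R) : Filter F -> (forall i, f i @ F --> a i) ->
  (fun t => \prod_(i <- s) f i t) @ F --> \prod_(i <- s) a i.
Proof.
move=> FF fa; elim: s => [|i s IH].
  by rewrite big_nil; under eq_fun do rewrite big_nil; exact: cvg_cst.
rewrite big_cons; under eq_fun do rewrite big_cons.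
exact: cvgM.
Qed.

Lemma cvg_det n (T : Type) (F : set_system T) (M : T -> 'M[R]_n) (M0 : 'M[R]_n) :
  Filter F -> (forall i j, (fun t => M t i j) @ F --> M0 i j) ->
  (fun t => \det (M t)) @ F --> \det M0.
Proof.
move=> FF h; rewrite /determinant; apply: cvg_sumr => s; apply: cvgM.
  exact: cvg_cst.
by apply: cvg_prodr.
Qed.

Lemma cvg_invmx n (T : Type) (F : set_system T) (M : T -> 'M[R]_n) (M0 : 'M[R]_n) :
  Filter F -> (forall i j, (fun t => M t i j) @ F --> M0 i j) ->
  M0 \in unitmx -> (\forall t \near F, M t \in unitmx) ->
  forall i j, (fun t => invmx (M t) i j) @ F --> invmx M0 i j.
Proof.
move=> FF h M0u Mu i j.
have invE (A : 'M[R]_n) : A \in unitmx -> invmx A i j = (\det A)^-1 * cofactor A j i.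
  by move=> Au; rewrite /invmx Au !mxE.
rewrite invE //.
have : (fun t => (\det (M t))^-1 * cofactor (M t) j i) @ F
    --> (\det M0)^-1 * cofactor M0 j i.
  apply: cvgM.
    apply: cvgV; last exact: cvg_det.
    by move: M0u; rewrite unitmxE unitfE.
  apply: cvgM; first exact: cvg_cst.
  apply: cvg_det => k l; under eq_fun do rewrite !mxE; rewrite !mxE; exact: h.
apply: cvg_trans; apply: near_eq_cvg.
by apply: filterS Mu => t Mtu; rewrite invE.
Qed.

End CompactBounds.

Lemma int_inE (T : topologicalType) (D G : set T) (z : T) : D z ->
  int_in D G z = (\forall z' \near z, D z' -> G z').
Proof.
move=> Dz.
by have -> : int_in D G z = within D (nbhs z) G by rewrite (nbhs_subspace_in Dz).
Qed.

(** * Injectivity and continuity of a jet-equivalence *)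

Section JetMaps.
Context {R : realType} {n : nat}.
Variables (X : set 'cV[R]_n) (g h : 'cV[R]_n -> 'M[R]_n)
  (L : 'cV[R]_n -> {linear 'cV[R]_n -> 'M[R]_n}).
Hypothesis X_open : open X.
Hypothesis ghL : jet_equivalence X g h L.

Lemma jet_map_inj x J J' : X x ->
  (jet_map g h L (x, J)).2 = (jet_map g h L (x, J')).2 -> J = J'.
Proof.
have [gh _ _ _ _] := ghL; move=> /gh[gu hu].
case: J => [[r p] A]; case: J' => [[r' p'] A'] /= [-> gp hA].
have pp : p = p' by rewrite -(mulKmx gu p) gp mulKmx.
move: hA; rewrite pp => /addIr hA.
have htu : (h x)^T \in unitmx by rewrite unitmx_tr.
have -> : A = A'.
  by rewrite -(mulKmx hu A) -(mulmxK htu (h x *m A)) hA mulmxK // mulKmx.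
by [].
Qed.

Lemma jet_map_preimage (F : set ('cV[R]_n * jet R n)) (F0 : set (jet R n)) x J :
  jet_map g h L @` F = X `*` F0 -> X x -> F0 (jet_map g h L (x, J)).2 -> F (x, J).
Proof.
move=> FE Xx F0J.
have : (X `*` F0) (jet_map g h L (x, J)) by split=> //; case: J F0J => [[r p] A].
rewrite -FE => -[[x' J'] Fz e].
have xx : x' = x by move: e; case: J F0J J' Fz => [[r p] A] _ [[r' p'] A'] _ [].
rewrite xx in Fz e; suff <- : J' = J by [].
by apply: (jet_map_inj Xx); rewrite e.
Qed.

Lemma jet_map_image (F : set ('cV[R]_n * jet R n)) (F0 : set (jet R n)) z :
  jet_map g h L @` F = X `*` F0 -> F z -> F0 (jet_map g h L z).2.
Proof.
move=> FE Fz; have : (X `*` F0) (jet_map g h L z) by rewrite -FE; exists z.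
by case.
Qed.

Lemma lipschitz_cvg (W : normedModType R) (f : 'cV[R]_n -> W) y :
  locally_lipschitz X f -> X y -> f @ y --> f y.
Proof.
move=> lip Xy.
have [C [C0 CP]] := lipschitz_on_compact X_open (@compact_set1 _ y)
  (fun x (xy : x = y) => eq_ind_r X Xy xy) lip.
apply: (@cvgrPdist_lt _ _ _ _ (nbhs_filter y) f (f y)).2 => e e0.
apply/nbhs_ballP; exists (Num.min C^-1 (e / C)).
  by rewrite /= lt_min invr_gt0 C0 divr_gt0.
move=> t; rewrite -ball_normE /= lt_min => /andP[t1 t2].
rewrite distrC in t1; have [_ ft] := CP y erefl t t1.
rewrite distrC (le_lt_trans ft) // distrC mulrC -ltr_pdivlMr //.
Qed.

Lemma cvg_mulmx_entry m1 m2 m3 (T : Type) (Fl : set_system T)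
  (M : T -> 'M[R]_(m1, m2)) (M' : T -> 'M[R]_(m2, m3)) (M0 : 'M[R]_(m1, m2))
  (M0' : 'M[R]_(m2, m3)) :
  Filter Fl -> (forall i j, (fun t => M t i j) @ Fl --> M0 i j) ->
  (forall i j, (fun t => M' t i j) @ Fl --> M0' i j) ->
  forall i j, (fun t => (M t *m M' t) i j) @ Fl --> (M0 *m M0') i j.
Proof.
move=> FF cM cM' i j; under eq_fun do rewrite mxE; rewrite mxE.
by apply: cvg_sumr => k; exact: cvgM.
Qed.

Lemma jet_map_near y r p A nu : X y -> 0 < nu ->
  \forall z \near (y, ((r, p, A) : jet R n)),
  [/\ X z.1, `|z.1 - y| < nu, `|z.2.1.1 - r| <= nu,
      mx_le (g z.1 *m z.2.1.2 - g y *m p) nu &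
      mx_le (h z.1 *m z.2.2 *m (h z.1)^T + L z.1 z.2.1.2
             - (h y *m A *m (h y)^T + L y p)) nu].
Proof.
move=> Xy nu0; have [_ _ lipg liph lipL] := ghL.
suff gen (Fl : set_system ('cV[R]_n * jet R n)) : Filter Fl ->
    (fun z => z.1) @ Fl --> y -> (fun z => z.2.1.1) @ Fl --> r ->
    (fun z => z.2.1.2) @ Fl --> p -> (fun z => z.2.2) @ Fl --> A ->
    \forall z \near Fl, [/\ X z.1, `|z.1 - y| < nu, `|z.2.1.1 - r| <= nu,
      mx_le (g z.1 *m z.2.1.2 - g y *m p) nu &
      mx_le (h z.1 *m z.2.2 *m (h z.1)^T + L z.1 z.2.1.2
             - (h y *m A *m (h y)^T + L y p)) nu].
  pose z0 : 'cV[R]_n * jet R n := (y, (r, p, A)).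
  have c1 : (fun z : 'cV[R]_n * jet R n => z.1) @ z0 --> y by exact: cvg_fst.
  have c2 : (fun z : 'cV[R]_n * jet R n => z.2) @ z0 --> z0.2 by exact: cvg_snd.
  have c3 : (fun z : 'cV[R]_n * jet R n => z.2.1) @ z0 --> z0.2.1.
    by apply: (cvg_comp _ _ c2); exact: cvg_fst.
  apply: (gen (nbhs z0) (nbhs_filter z0)) => //.
  - by apply: (cvg_comp _ _ c3); exact: cvg_fst.
  - by apply: (cvg_comp _ _ c3); exact: cvg_snd.
  - by apply: (cvg_comp _ _ c2); exact: cvg_snd.
move=> FF c1 cr cp cA.
have subE m1 m2 (M M' : 'M[R]_(m1, m2)) i j : (M - M') i j = M i j - M' i j.
  by rewrite !mxE.
have addE (M M' : 'M[R]_n) i j : (M + M') i j = M i j + M' i j by rewrite mxE.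
have entry m1 m2 (f : 'cV[R]_n -> 'M[R]_(m1, m2)) i j : f @ y --> f y ->
    (fun z => f z.1 i j) @ Fl --> f y i j.
  move=> fc.
  exact: (cvg_comp _ _ (cvg_comp _ _ c1 fc) (@coord_continuous R m1 m2 i j (f y))).
have gc i j := entry _ _ g i j (lipschitz_cvg lipg Xy).
have hc i j := entry _ _ h i j (lipschitz_cvg liph Xy).
have Lc k i j := entry _ _ (fun x => L x (delta_mx k 0)) i j
  (lipschitz_cvg (lipL (delta_mx k 0)) Xy).
have pc i j : (fun z : 'cV[R]_n * jet R n => z.2.1.2 i j) @ Fl --> p i j.
  exact: (cvg_comp _ _ cp (@coord_continuous R n 1 i j p)).
have Ac i j : (fun z : 'cV[R]_n * jet R n => z.2.2 i j) @ Fl --> A i j.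
  exact: (cvg_comp _ _ cA (@coord_continuous R n n i j A)).
have n1 : \forall z \near Fl, X z.1 by apply: c1; exact: open_nbhs_nbhs.
have n2 : \forall z \near Fl, `|z.1 - y| < nu.
  have := @cvgr_dist_lt _ _ _ _ FF _ _ c1 _ nu0; apply: filterS => z; by rewrite distrC.
have n3 : \forall z \near Fl, `|z.2.1.1 - r| <= nu.
  have := @cvgr_dist_le _ _ _ _ FF _ _ cr _ nu0; apply: filterS => z; by rewrite distrC.
have n4 : \forall z \near Fl, mx_le (g z.1 *m z.2.1.2 - g y *m p) nu.
  apply: filter_forall => i; apply: filter_forall => j.
  have c := @cvg_mulmx_entry n n 1 _ Fl _ _ _ _ FF gc pc i j.
  have := @cvgr_dist_le _ _ _ _ FF _ _ c _ nu0; apply: filterS => z.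
  by rewrite distrC -subE.
have n5 : \forall z \near Fl, mx_le (h z.1 *m z.2.2 *m (h z.1)^T + L z.1 z.2.1.2
     - (h y *m A *m (h y)^T + L y p)) nu.
  apply: filter_forall => i; apply: filter_forall => j.
  have ht i' j' : (fun z : 'cV[R]_n * jet R n => (h z.1)^T i' j') @ Fl --> (h y)^T i' j'.
    by under eq_fun do rewrite mxE; rewrite mxE; exact: hc.
  have c := @cvg_mulmx_entry n n n _ Fl _ _ _ _ FF
    (@cvg_mulmx_entry n n n _ Fl _ _ _ _ FF hc Ac) ht i j.
  have Lcv : (fun z : 'cV[R]_n * jet R n => L z.1 z.2.1.2 i j) @ Fl --> L y p i j.
    have e x q : L x q i j = \sum_k q k 0 * L x (delta_mx k 0) i j.
      by rewrite linear_sum_delta summxE; apply: eq_bigr => k _; rewrite mxE.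
    under eq_fun do rewrite e; rewrite e.
    by apply: cvg_sumr => k; exact: cvgM.
  have D := @cvgr_dist_le _ _ _ _ FF _ _ (cvgD c Lcv) _ nu0.
  refine (@filterS _ _ FF _ _ _ (D FF)) => z /=.
  by rewrite distrC subE !addE.
apply: (@filterS2 _ _ FF _ _ _ _ (filterI n1 n2) (filterI n3 (filterI n4 n5))).
by move=> z [? ?] [? [? ?]].
Qed.

End JetMaps.

Section MetricBound.
Context {R : realType} {n : nat}.
Variables (X K : set 'cV[R]_n) (m : 'cV[R]_n -> jet R n -> jet R n -> R).
Hypothesis X_open : open X.
Hypothesis K_compact : compact K.
Hypothesis KX : K `<=` X.
Hypothesis m_metric : bundle_metric X m.

Let symD (J J' : jet R n) : sym_jets J -> sym_jets J' -> sym_jets (J + J').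
Proof.
by move=> h1 h2; rewrite /sym_jets /sym_mx /= linearD /= h1 h2.
Qed.

Let symZ a (J : jet R n) : sym_jets J -> sym_jets (a *: J).
Proof. by move=> h1; rewrite /sym_jets /sym_mx /= linearZ /= h1. Qed.

Let sym0 : sym_jets (0 : jet R n).
Proof. by rewrite /sym_jets /sym_mx /= trmx0. Qed.

Let m0 x I : X x -> sym_jets I -> m x 0 I = 0.
Proof.
move=> Xx sI; have := metric_lin m_metric 1 Xx sym0 sym0 sI.
by rewrite scaler0 addr0 mul1r => h; lra.
Qed.

Let mD x J J' I : X x -> sym_jets J -> sym_jets J' -> sym_jets I ->
  m x (J + J') I = m x J I + m x J' I.
Proof.
move=> Xx s1 s2 s3; have := metric_lin m_metric 1 Xx s1 s2 s3.
by rewrite scale1r mul1r.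
Qed.

Let mZ x a J I : X x -> sym_jets J -> sym_jets I ->
  m x (a *: J) I = a * m x J I.
Proof.
move=> Xx s1 s3; have := metric_lin m_metric a Xx s1 sym0 s3.
by rewrite m0 // !addr0.
Qed.

Let m_ge0 x J : X x -> sym_jets J -> 0 <= m x J J.
Proof.
move=> Xx sJ; have [->|J0] := eqVneq J 0; first by rewrite m0.
exact/ltW/(metric_pos m_metric).
Qed.

Let mDr x J J' I : X x -> sym_jets J -> sym_jets J' -> sym_jets I ->
  m x I (J + J') = m x I J + m x I J'.
Proof.
move=> Xx s1 s2 s3; have ms := Defs.metric_sym m_metric Xx s3.
rewrite (ms _ (symD s1 s2)) (ms _ s1) (ms _ s2).
exact: mD.
Qed.

Let mZr x a J I : X x -> sym_jets J -> sym_jets I -> m x I (a *: J) = a * m x I J.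
Proof.
move=> Xx s1 s3; have ms := Defs.metric_sym m_metric Xx s3.
rewrite (ms _ (symZ a s1)) (ms _ s1).
exact: mZ.
Qed.

Let qD x J J' : X x -> sym_jets J -> sym_jets J' ->
  m x (J + J') (J + J') <= 2 * m x J J + 2 * m x J' J'.
Proof.
move=> Xx s1 s2; have sN : sym_jets (- 1 *: J') by exact: symZ.
have := m_ge0 Xx (symD s1 sN).
have sJ := symD s1 s2; have sJN := symD s1 sN.
rewrite (mD Xx s1 sN sJN) (mDr Xx s1 sN s1) (mDr Xx s1 sN sN).
rewrite (mZr _ Xx s2 s1) (mZr _ Xx s2 sN) (mZ _ Xx s2 s1) (mZ _ Xx s2 s2).
rewrite (mD Xx s1 s2 sJ) (mDr Xx s1 s2 s1) (mDr Xx s1 s2 s2).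
by rewrite (Defs.metric_sym m_metric Xx s2 s1); lra.
Qed.

Let qZ x a J : X x -> sym_jets J -> m x (a *: J) (a *: J) = a ^+ 2 * m x J J.
Proof. by move=> Xx s1; rewrite mZ ?mZr //; [ring|exact: symZ]. Qed.

(** These jets are combinations of $n+1$ fixed ones, on which the continuous metric is bounded over
    [K]. Adding them one by one with $|J+J'|^2\le2|J|^2+2|J'|^2$ loses at most a power of 4, which
    [Z] absorbs. *)
Lemma metric_small : exists omega : R, 0 < omega /\ forall x (d : 'cV[R]_n),
  K x -> mx_le d omega -> metric_norm m x (0, d, - omega%:M) <= 1.
Proof.
pose b (i : 'I_n) : jet R n := (0, delta_mx i 0, 0).
pose bI : jet R n := (0, 0, 1%:M).
have sb i : sym_jets (b i) by rewrite /sym_jets /sym_mx /= trmx0.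
have sI : sym_jets bI by rewrite /sym_jets /sym_mx /= tr_scalar_mx.
have mc J x : sym_jets J -> K x -> (fun x => m x J J) @ x --> m x J J.
  move=> sJ Kx; have := metric_cont m_metric sJ sJ.
  by rewrite continuous_open_subspace // => /(_ x); apply; rewrite inE; exact: KX.
have /choice[Cb CbP] : forall i, exists C, forall x, K x -> `|m x (b i) (b i)| <= C.
  move=> i; apply: (continuous_bounded_on_compact K_compact) => x Kx.
  exact: mc.
have [CI CIP] : exists C, forall x, K x -> `|m x bI bI| <= C.
  apply: (continuous_bounded_on_compact K_compact) => x Kx; exact: mc.
pose Cm := \sum_i `|Cb i| + `|CI|.
have Cm0 : 0 <= Cm by rewrite addr_ge0 // sumr_ge0.
have bC i x : K x -> m x (b i) (b i) <= Cm.
  move=> Kx; apply: (le_trans (ler_norm _)); apply: (le_trans (CbP i x Kx)).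
  apply: (le_trans (ler_norm _)); rewrite /Cm (bigD1 i) //= -addrA lerDl.
  by rewrite addr_ge0 // sumr_ge0.
have IC x : K x -> m x bI bI <= Cm.
  move=> Kx; apply: (le_trans (ler_norm _)); apply: (le_trans (CIP x Kx)).
  by apply: (le_trans (ler_norm _)); rewrite /Cm lerDr sumr_ge0.
pose Z : R := 4 * 4 ^+ n * (Cm + 1).
have Z1 : 1 <= Z.
  rewrite /Z mulr_ege1 //; last by rewrite lerDr.
  by rewrite -exprS exprn_ege1 // ler1n.
have Z0 : 0 < Z by exact: lt_le_trans Z1.
exists Z^-1; split; first by rewrite invr_gt0.
set om := Z^-1; have om0 : 0 < om by rewrite invr_gt0.
have om1 : om <= 1 by rewrite invf_le1.
move=> x d Kx dom; have Xx := KX Kx.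
have sumP (s : seq 'I_n) : sym_jets (\sum_(i <- s) d i 0 *: b i) /\
   m x (\sum_(i <- s) d i 0 *: b i) (\sum_(i <- s) d i 0 *: b i)
   <= 4 ^+ size s * (om ^+ 2 * Cm).
  elim: s => [|i s [IH1 IH2]].
    rewrite big_nil m0 //; split=> //; rewrite expr0 mul1r mulr_ge0 // sqr_ge0 //.
  rewrite big_cons; split; first by apply: symD => //; exact: symZ.
  apply: le_trans (qD Xx (symZ _ (sb i)) IH1) _; rewrite qZ //.
  have h1 : d i 0 ^+ 2 * m x (b i) (b i) <= om ^+ 2 * Cm.
    apply: ler_pM; [exact: sqr_ge0|exact: m_ge0| |exact: bC].
    by rewrite -real_normK ?num_real // lerXn2r ?nnegrE // ltW.
  have h2 : om ^+ 2 * Cm <= 4 ^+ size s * (om ^+ 2 * Cm).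
    apply: ler_peMl; first by rewrite mulr_ge0 ?sqr_ge0.
    by rewrite exprn_ege1 // ler1n.
  have -> : 4 ^+ size (i :: s) * (om ^+ 2 * Cm) =
    4 * (4 ^+ size s * (om ^+ 2 * Cm)) by rewrite /= exprS -mulrA.
  by move: (4 ^+ size s * (om ^+ 2 * Cm)) (om ^+ 2 * Cm) IH2 h1 h2 => *; lra.
have [S1 S2] := sumP (index_enum _).
have dE : ((0, d, - om%:M) : jet R n) = \sum_i d i 0 *: b i + (- om) *: bI.
  have -> : \sum_i d i 0 *: b i = ((0, d, 0) : jet R n).
    have e1 : (\sum_i d i 0 *: b i).1.1 = 0.
      rewrite (big_morph (fun J : jet R n => J.1.1) (id1 := 0) (op1 := +%R)) //.
      by rewrite big1 // => i _; rewrite /= /GRing.scale /= mulr0.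
    have e2 : (\sum_i d i 0 *: b i).1.2 = d.
      rewrite (big_morph (fun J : jet R n => J.1.2) (id1 := 0) (op1 := +%R)) //=.
      apply/matrixP => i j; rewrite ord1 summxE (bigD1 i) //= big1 ?addr0.
        by rewrite !mxE !eqxx mulr1.
      by move=> k ki; rewrite !mxE eq_sym (negbTE ki) mulr0.
    have e3 : (\sum_i d i 0 *: b i).2 = 0.
      rewrite (big_morph (fun J : jet R n => J.2) (id1 := 0) (op1 := +%R)) //.
      by rewrite big1 // => i _; rewrite /= scaler0.
    by move: e1 e2 e3; case: (\sum_i _) => [[r p] A] /= -> -> ->.
  congr (_, _, _); rewrite /= ?scaler0 ?addr0 ?add0r //.
  by rewrite scaleNr scalemx1.
rewrite /metric_norm dE -[leRHS]sqrtr1 ler_wsqrtr //.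
have := qD Xx S1 (symZ (- om) sI); rewrite qZ // sqrrN => q1.
apply: (le_trans q1).
have h1 : om ^+ 2 * m x bI bI <= om ^+ 2 * Cm by rewrite ler_wpM2l ?sqr_ge0 ?IC.
have sz : size (index_enum (fintype_ordinal__canonical__fintype_Finite n)) = n.
  by rewrite [index_enum _]unlock -enumT size_enum_ord.
rewrite sz in S2.
have h2 : om ^+ 2 * Cm <= 4 ^+ n * (om ^+ 2 * Cm).
  apply: ler_peMl; first by rewrite mulr_ge0 ?sqr_ge0.
  by rewrite exprn_ege1 // ler1n.
have h3 : 4 * (4 ^+ n * (om ^+ 2 * Cm)) <= 1.
  apply: (@le_trans _ _ (om * Z)); last by rewrite mulVf // gt_eqF.
  have -> : 4 * (4 ^+ n * (om ^+ 2 * Cm)) = om * (om * (4 * 4 ^+ n * Cm)) by ring.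
  rewrite ler_pM2l // (@le_trans _ _ (1 * (4 * 4 ^+ n * Cm))) //.
    by rewrite ler_wpM2r // !mulr_ge0 // exprn_ge0.
  by rewrite mul1r /Z ler_pM2l ?lerDl // mulr_gt0 // exprn_gt0.
by move: (4 ^+ n * (om ^+ 2 * Cm)) (om ^+ 2 * Cm) (om ^+ 2 * _) (m x _ _) S2 h1 h2 h3
  => *; lra.
Qed.

End MetricBound.

Section Selection.
Context {R : realType}.

(** Otherwise each halving of [e] would lower [Th] by more than [kappa], and [Th] would fall below
    [M]. *)
Lemma scale_pigeonhole (Th : R -> R) (M : R) :
  (forall e, 0 < e -> M <= Th e) -> (forall e, 0 < e -> Th e <= Th (2 * e)) ->
  forall e0 kappa, 0 < e0 -> 0 < kappa ->
  exists e, [/\ 0 < e, e <= e0 & Th (2 * e) - Th e <= kappa].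
Proof.
move=> ThM Thmon e0 kappa e00 k0; apply: contrapT => no.
pose s k := e0 / 2 ^+ k.
have s0 k : 0 < s k by rewrite divr_gt0 // exprn_gt0.
have sS k : s k = 2 * s k.+1.
  by rewrite /s exprS; field; rewrite expf_neq0.
have drop k : Th (s k) + k%:R * kappa <= Th (s 0%N).
  elim: k => [|k IH]; first by rewrite mul0r addr0.
  have h : kappa < Th (2 * s k.+1) - Th (s k.+1).
    rewrite ltNge; apply/negP => h; apply: no; exists (s k.+1); split=> //.
    by rewrite /s ler_pdivrMr ?exprn_gt0 // ler_peMr ?(ltW e00) // exprn_ege1 // ler1n.
  rewrite -sS in h; rewrite -natr1 mulrDl mul1r.
  by move: (k%:R * kappa) IH h => *; lra.
have [k kP] := exists_nat_gt ((Th (s 0%N) - M) / kappa).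
have := drop k; have := ThM _ (s0 k).
by move: kP; rewrite ltr_pdivrMr //; move: (k%:R * kappa) => *; lra.
Qed.

End Selection.

(** * Incompatibility of a strict jet with a dual jet *)

Section Contradiction.
Context {R : realType} {n : nat}.

Lemma psd_shift (P : 'M[R]_n) (lam : R) : 0 <= lam -> psd (P - lam%:M) -> psd P.
Proof.
move=> lam0 [sP pP]; split.
  have := sP; rewrite /sym_mx linearB /= tr_scalar_mx.
  by move=> /(congr1 (fun M => M + lam%:M)); rewrite !subrK.
move=> v; apply: (le_trans (pP v)).
have -> : (v^T *m (P - lam%:M) *m v) 0 0 = (v^T *m P *m v) 0 0 - lam * dot v v.
  by rewrite mulmxBr mulmxBl mul_mx_scalar -scalemxAl /dot !mxE.
by rewrite gerBl mulr_ge0 // dot_ge0.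
Qed.

Lemma tr_conjD (h S l : 'M[R]_n) : S^T = S -> l^T = l ->
  (h *m S *m h^T + l)^T = h *m S *m h^T + l.
Proof. by move=> sS sl; rewrite [LHS]linearD /= conj_sym // sl. Qed.

(** It has to be shown that all jets near [(y, - (b, q, B))] lie in the inhomogeneous set.
    Transported to the model, each of them arises from the corrected strict jet at [x] by lowering
    the value by at least [s] and adding a matrix at least [lam]. Conditions (P) and (N) keep it in
    [F0], and tameness raises [f0] by [ct], which covers the variation of [psi]. *)
Lemma dual_contradiction (X : set 'cV[R]_n) (g h : 'cV[R]_n -> 'M[R]_n)
  (L : 'cV[R]_n -> {linear 'cV[R]_n -> 'M[R]_n})
  (F0 : set (jet R n)) (f0 : jet R n -> R)
  (F : set ('cV[R]_n * jet R n)) (f : 'cV[R]_n * jet R n -> R)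
  (psi : 'cV[R]_n -> R) (m : 'cV[R]_n -> jet R n -> jet R n -> R)
  (omega lam ct s nu : R) (x y p q : 'cV[R]_n) (A B : 'M[R]_n) (a b : R) :
  open X -> jet_equivalence X g h L -> positivity F0 -> negativity F0 ->
  jet_map g h L @` F = X `*` F0 ->
  (forall z, F z -> f z = f0 (jet_map g h L z).2) ->
  0 <= lam -> 0 < s -> 0 < nu -> X x -> X y -> 2 * s <= a + b ->
  (forall J r P, F0 J -> s <= r -> psd (P - lam%:M) ->
     ct <= f0 (J + (- r, 0, P)) - f0 J) ->
  (forall y', `|y' - y| < nu -> psi y' <= psi x + ct) ->
  (forall d, mx_le d omega -> metric_norm m x (0, d, - omega%:M) <= 1) ->
  (forall kp kA, mx_le kp nu -> mx_le kA nu -> kA^T = kA -> exists d,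
     [/\ mx_le d omega, g x *m (p + d) = g y *m (- q) + kp &
         psd (- (h y *m B *m (h y)^T) + L y (- q) + kA
           - (h x *m (A - omega%:M) *m (h x)^T + L x (p + d)) - lam%:M)]) ->
  strict_part m (inhomogeneous F f psi) 1 (x, (a, p, A)) ->
  ~ dual X (inhomogeneous F f psi) (y, (b, q, B)).
Proof.
move=> X_open ghL F0P F0N FE fE lam0 s0 nu0 Xx Xy sab tame_c psi_le metr gap
  [_ strict] [[_ symB]]; apply.
have {}symB : B^T = B by [].
have [_ Lsym _ _ _] := ghL.
(* A nearby value [r''] is at most [- b + s], so [a - r''] is at least [s] out of the available
   [2 * s]. *)
pose nu' := Num.min nu s.
have nu'0 : 0 < nu' by rewrite lt_min nu0.
rewrite int_inE; last first.
  by split=> //=; rewrite /sym_jets /sym_mx /= linearN /= symB.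
have near := jet_map_near X_open ghL (- b) (- q) (- B) Xy nu'0.
refine (@filterS _ _ (nbhs_filter _) _ _ _ near).
move=> [y'' [[r'' p''] A'']] /= [Xy'' yn rn kpn kAn] [_ symA''].
have {}symA'' : A''^T = A'' by [].
have n1 : nu' <= nu by rewrite ge_min lexx.
have n2 : nu' <= s by rewrite ge_min lexx orbT.
have symNB : (- B)^T = - B by rewrite linearN /= symB.
have symk := tr_conjD (h y'') symA'' (Lsym y'' Xy'' p'').
have symk' := tr_conjD (h y) symNB (Lsym y Xy (- q)).
have [|d [dom pE psdP]] := gap _ _ (mx_leW n1 kpn) (mx_leW n1 kAn).
  by rewrite [LHS]linearB /= symk symk'.
have symO : sym_jets ((0, d, - omega%:M) : jet R n).
  by rewrite /sym_jets /sym_mx /= linearN /= tr_scalar_mx.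
have [Fx psix] := strict _ symO (metr d dom).
set J1 := (jet_map g h L (x, (a, p, A) + (0, d, - omega%:M))).2.
have F0J1 : F0 J1 by exact: (jet_map_image FE Fx).
set P := h y'' *m A'' *m (h y'')^T + L y'' p''
  - (h x *m (A - omega%:M) *m (h x)^T + L x (p + d)).
have psdP1 : psd (P - lam%:M).
  have -> : P = - (h y *m B *m (h y)^T) + L y (- q) +
     (h y'' *m A'' *m (h y'')^T + L y'' p'' - (h y *m - B *m (h y)^T + L y (- q)))
     - (h x *m (A - omega%:M) *m (h x)^T + L x (p + d)).
    by rewrite /P mulmxN mulNmx [X in _ = X - _]addrC subrK.
  exact: psdP.
set K2 := (jet_map g h L (y'', (r'', p'', A''))).2.
have K2E : K2 = J1 + (- (a - r''), 0, P).
  rewrite /K2 /J1 /=; congr (_, _, _).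
  - by rewrite /= addr0 opprB addrC subrK.
  - by rewrite /= addr0 pE [RHS]addrC subrK.
  - by rewrite /P /= [RHS]addrC subrK.
have ar : s <= a - r''.
  move: (ler_norm (r'' + b)) rn; rewrite opprK.
  by move: sab n2 => *; lra.
have F0K2 : F0 K2.
  have := F0N _ (a - r'') (F0P _ P F0J1 (psd_shift lam0 psdP1)).
  rewrite K2E => /(_ (le_trans (ltW s0) ar)).
  have -> // : J1 + (0, 0, P) + (- (a - r''), 0, 0) = J1 + (- (a - r''), 0, P).
  by rewrite -addrA; congr (_ + (_, _, _)); rewrite /= ?add0r ?addr0.
have Fz := jet_map_preimage ghL FE Xy'' F0K2.
split=> //=; rewrite fE //.
have := tame_c _ _ _ F0J1 ar psdP1; rewrite -K2E.
rewrite (fE _ Fx) in psix.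
have := psi_le _ (lt_le_trans yn n1); move: psix; rewrite -/J1 -/K2 /=.
by move=> *; lra.
Qed.
End Contradiction.

Section UniformBounds.
Context {R : realType} {n : nat}.

Lemma common_bound (I : finType) (P : I -> R -> Prop) :
  (forall i C C', C <= C' -> P i C -> P i C') -> (forall i, exists C, P i C) ->
  exists C, forall i, P i C.
Proof.
move=> Pmon /choice[C CP]; exists (\sum_i `|C i|) => i.
apply: Pmon (CP i); apply: (le_trans (ler_norm _)).
by rewrite (bigD1 i) //= lerDl sumr_ge0.
Qed.

Lemma matrix_bounded_on_compact (K : set 'cV[R]_n) (f : 'cV[R]_n -> 'M[R]_n) :
  compact K -> (forall x, K x -> forall i j, (fun y => f y i j) @ x --> f x i j) ->
  exists C, forall x, K x -> mx_le (f x) C.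
Proof.
move=> cK fc; apply: (compact_bound cK) => [C C' x CC|x Kx]; first exact: mx_leW.
exists (`|f x| + 1).
apply: (@filter_forall _ _ _ _ (nbhs_filter x)) => i.
apply: (@filter_forall _ _ _ _ (nbhs_filter x)) => j.
have := @cvgr_dist_le _ _ _ _ (nbhs_filter x) _ _ (fc x Kx i j) _ ltr01.
apply: filterS => y yx; rewrite -[f y i j](subrK (f x i j)) addrC.
apply: (le_trans (ler_normD _ _)); rewrite lerD ?mx_norm_entry //.
by rewrite distrC.
Qed.

Lemma jet_equivalence_bounds (X K : set 'cV[R]_n) (g h : 'cV[R]_n -> 'M[R]_n)
  (L : 'cV[R]_n -> {linear 'cV[R]_n -> 'M[R]_n}) :
  open X -> compact K -> K `<=` X -> jet_equivalence X g h L ->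
  exists C, [/\ 1 <= C,
    forall x, K x -> [/\ mx_le (invmx (g x)) C, mx_le (invmx (h x)) C,
      mx_le (h x) C & forall k, mx_le (L x (delta_mx k 0)) C] &
    forall x y, K x -> `|y - x| < C^-1 ->
      [/\ mx_le (g y - g x) (C * `|y - x|), mx_le (h x - h y) (C * `|y - x|) &
        forall k, mx_le (L y (delta_mx k 0) - L x (delta_mx k 0)) (C * `|y - x|)]].
Proof.
move=> oX cK KX ghL; have [gh _ lipg liph lipL] := ghL.
have entry (f : 'cV[R]_n -> 'M[R]_n) : locally_lipschitz X f ->
    forall x, K x -> forall i j, (fun y => f y i j) @ x --> f x i j.
  move=> lipf x Kx i j.
  have fc := lipschitz_cvg oX lipf (KX x Kx).
  exact: (cvg_comp _ _ fc (@coord_continuous R n n i j (f x))).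
have inv (f : 'cV[R]_n -> 'M[R]_n) : locally_lipschitz X f ->
    (forall x, X x -> f x \in unitmx) ->
    forall x, K x -> forall i j, (fun y => invmx (f y) i j) @ x --> invmx (f x) i j.
  move=> lipf fu x Kx; have Xx := KX x Kx.
  apply: (@cvg_invmx R n _ (nbhs x) f (f x) (nbhs_filter x)) => //.
  - exact: entry.
  - exact: fu.
  - have : nbhs x X by exact: open_nbhs_nbhs.
    by apply: filterS => y /fu.
have [C1 P1] := matrix_bounded_on_compact cK (inv g lipg (fun x Xx => (gh x Xx).1)).
have [C2 P2] := matrix_bounded_on_compact cK (inv h liph (fun x Xx => (gh x Xx).2)).
have [C3 P3] := matrix_bounded_on_compact cK (entry h liph).
have [C4 P4] : exists C, forall k : 'I_n, forall x, K x -> mx_le (L x (delta_mx k 0)) C.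
  apply: common_bound => [k C C' CC P x Kx|k]; first exact: mx_leW (P x Kx).
  exact: matrix_bounded_on_compact cK (entry _ (lipL (delta_mx k 0))).
have lip (f : 'cV[R]_n -> 'M[R]_n) : locally_lipschitz X f -> exists C, 0 < C /\
   forall x, K x -> forall y, `|y - x| < C^-1 -> mx_le (f y - f x) (C * `|y - x|).
  move=> lipf; have [C [C0 CP]] := lipschitz_on_compact oX cK KX lipf.
  exists C; split=> // x Kx y yx i j; have [_ h1] := CP x Kx y yx.
  exact: le_trans (mx_norm_entry _ _ _) h1.
have [C5 [C50 P5]] := lip g lipg; have [C6 [C60 P6]] := lip h liph.
have lipW C C' : C <= C' -> 0 < C -> forall x y (M : 'M[R]_n),
    (`|y - x : 'cV[R]_n| < C^-1 -> mx_le M (C * `|y - x|)) ->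
    (`|y - x| < C'^-1 -> mx_le M (C' * `|y - x|)).
  move=> CC C0 x y M MP yx; apply: (@mx_leW _ _ _ _ (C * `|y - x|)).
    by rewrite ler_wpM2r.
  by apply: MP; apply: (lt_le_trans yx); rewrite lef_pV2 ?posrE // (lt_le_trans C0).
have [C7 P7] : exists C, forall k : 'I_n, 0 < C /\ forall x, K x ->
    forall y, `|y - x| < C^-1 ->
    mx_le (L y (delta_mx k 0) - L x (delta_mx k 0)) (C * `|y - x|).
  apply: common_bound => [k C C' CC [C0 P]|k]; last exact: lip (lipL (delta_mx k 0)).
  by split=> [|x Kx y]; [exact: lt_le_trans CC|exact: (lipW _ _ CC C0) (P x Kx y)].
pose S := `|C1| + `|C2| + `|C3| + `|C4| + C5 + C6 + `|C7|.
have [h1 h2 h3 h4 h7] : [/\ C1 <= 1 + S, C2 <= 1 + S, C3 <= 1 + S, C4 <= 1 + S &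
    C7 <= 1 + S].
  rewrite /S; move: (ler_norm C1) (ler_norm C2) (ler_norm C3) (ler_norm C4)
   (ler_norm C7) (normr_ge0 C1) (normr_ge0 C2) (normr_ge0 C3) (normr_ge0 C4)
   (normr_ge0 C7) C50 C60; clear -n => *; split; lra.
have [h0 h5 h6] : [/\ 1 <= 1 + S, C5 <= 1 + S & C6 <= 1 + S].
  rewrite /S; move: (normr_ge0 C1) (normr_ge0 C2) (normr_ge0 C3) (normr_ge0 C4)
   (normr_ge0 C7) C50 C60; clear -n => *; split; lra.
exists (1 + S); split=> [//|x Kx|x y Kx yx].
  split; [exact: mx_leW h1 (P1 x Kx)|exact: mx_leW h2 (P2 x Kx)
         |exact: mx_leW h3 (P3 x Kx)|].
  by move=> k; exact: mx_leW h4 (P4 k x Kx).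
split.
- exact: (lipW _ _ h5 C50) (P5 x Kx y) yx.
- by rewrite -opprB; apply/mx_leN; exact: (lipW _ _ h6 C60) (P6 x Kx y) yx.
- by move=> k; have [C70 P] := P7 k; exact: (lipW _ _ h7 C70) (P x Kx y) yx.
Qed.

End UniformBounds.

(** * Doubling of variables *)

Section Doubling.
Context {R : realType} {n : nat}.
Variables (K : set 'cV[R]_n) (u v : 'cV[R]_n -> \bar R).
Hypothesis K_compact : compact K.
Hypothesis u_lt : forall x, K x -> (u x < +oo)%E.
Hypothesis v_lt : forall x, K x -> (v x < +oo)%E.
Hypothesis u_usc : usc_within K u.
Hypothesis v_usc : usc_within K v.

Lemma doubling_max (x1 : 'cV[R]_n) (a1 b1 eps : R) :
  K x1 -> u x1 = a1%:E -> v x1 = b1%:E -> 0 < eps ->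
  exists Theta, (forall x y a b, K x -> K y -> u x = a%:E -> v y = b%:E ->
      a + b - sqd x y / (6 * eps) <= Theta) /\
    (exists x y a b, [/\ K x, K y, u x = a%:E, v y = b%:E &
      Theta = a + b - sqd x y / (6 * eps)]).
Proof.
move=> Kx1 ux1 vx1 eps0.
pose c (z : 'cV[R]_n * 'cV[R]_n) : R := - (sqd z.1 z.2 / (6 * eps)).
pose f (z : 'cV[R]_n * 'cV[R]_n) := (u z.1 + (v z.2 + (c z)%:E))%E.
have cc z : {for z, continuous c}.
  have cz : (fun z : 'cV[R]_n * 'cV[R]_n => z.1 - z.2) @ z --> z.1 - z.2.
    by apply: (@cvgB _ _ _ (nbhs z) (nbhs_filter z)); [exact: cvg_fst|exact: cvg_snd].
  apply: (@cvgN _ _ _ (nbhs z) (nbhs_filter z)).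
  apply: (@cvgM _ _ (nbhs z) (nbhs_filter z)); last exact: cvg_cst.
  exact: (@cvg_dot R n _ (nbhs z) _ _ _ _ (nbhs_filter z) cz cz).
have cKK : compact (K `*` K) by exact: compact_setX.
have f_usc : usc_within (K `*` K) f.
  apply: usc_withinD => [x [/u_lt]|x [_ /v_lt vl]||] //.
  - by rewrite lte_add_pinfty // ltry.
  - by apply: (usc_within_comp _ _ u_usc) => [z|z []//]; exact: cvg_fst.
  - apply: usc_withinD => [x [_ /v_lt]|x _||] //; first exact: ltry.
      by apply: (usc_within_comp _ _ v_usc) => [z|z []//]; exact: cvg_snd.
    by apply: usc_within_continuous => z _; exact: cc.
have f_lt z : (K `*` K) z -> (f z < +oo)%E.
  by move=> [/u_lt h1 /v_lt h2]; rewrite !lte_add_pinfty // ltry.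
have [[x y] [Kx Ky] fmax] := usc_compact_max cKK (conj Kx1 Kx1 : (K `*` K) (x1, x1)) f_lt f_usc.
have := fmax (x1, x1) (conj Kx1 Kx1); have := u_lt Kx; have := v_lt Ky.
rewrite [X in (X <= _)%E]/f /= ux1 vx1 -!EFinD /f /=.
case ux : (u x) => [a| |] //; case vy : (v y) => [b| |] // _ _ _.
exists (a + b - sqd x y / (6 * eps)); split; last by exists x, y, a, b.
move=> x' y' a' b' Kx' Ky' ux' vy'.
have := fmax (x', y') (conj Kx' Ky').
by rewrite /f /= ux' vy' ux vy -!EFinD lee_fin /c /= !addrA.
Qed.

(** By semicontinuity the boundary inequality survives a small separation of the two points. Either
    of them may be the one on the boundary, hence both orders; this forces the doubled maximum into
    the open set. *)
Lemma boundary_gap (S : set 'cV[R]_n) (M : R) : compact S -> S `<=` K -> 0 < M ->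
  (forall x, S x -> (u x + v x <= 0)%E) ->
  exists C : R, 0 < C /\ forall x y, S x -> K y -> `|y - x| < C^-1 ->
    (u x + v y < M%:E)%E /\ (u y + v x < M%:E)%E.
Proof.
move=> cS SK M0 uv.
pose Q C x := 0 < C /\ forall y, S x -> K y -> `|y - x| < C^-1 ->
    (u x + v y < M%:E)%E /\ (u y + v x < M%:E)%E.
have [||C CP] := @compact_bound _ _ S Q cS.
- move=> C C' x CC [C0 P]; split=> [|y Sx Ky yx]; first exact: lt_le_trans CC.
  by apply: P => //; apply: (lt_le_trans yx); rewrite lef_pV2 ?posrE // (lt_le_trans C0).
- move=> x Sx; have Kx := SK x Sx.
  have : (u x + v x < M%:E)%E by apply: le_lt_trans (uv x Sx) _; rewrite lte_fin.
  move=> /(lteD_split (u_lt Kx) (v_lt Kx))[s [t [us vt st]]].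
  have hu := u_usc Kx us; have hv := v_usc Kx vt.
  rewrite !near_withinE in hu hv.
  have /nbhs_ballP[e /= e0 eP] := @filterI _ _ (nbhs_filter x) _ _ hu hv.
  exists (2 / e); apply/nbhs_ballP; exists (e / 2); first by rewrite /= divr_gt0.
  move=> x' xx'; split=> [|y Sx' Ky yx']; first by rewrite divr_gt0.
  have Kx' := SK x' Sx'.
  have bx' : ball x e x' by apply: le_ball xx'; move: e0; lra.
  have by' : ball x e y.
    rewrite -ball_normE /= distrC -[y](subrK x') -addrA.
    apply: (le_lt_trans (ler_normD _ _)); rewrite invf_div in yx'.
    by move: xx'; rewrite -ball_normE /= distrC; move: yx'; lra.
  have [/(_ Kx') ux' /(_ Kx') vx'] := eP _ bx'.
  have [/(_ Ky) uy /(_ Ky) vy] := eP _ by'.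
  have sM : (s%:E + t%:E <= M%:E)%E by rewrite -EFinD lee_fin.
  by split; apply: lt_le_trans sM; exact: lteD.
- have [[x Sx]|S0] := pselect (exists x, S x); last first.
    by exists 1; split=> // x y Sx; case: S0; exists x.
  have [C0 _] := CP x Sx.
  by exists C; split=> // x' y Sx' Ky yx; have [_ P] := CP x' Sx'; exact: P.
Qed.

End Doubling.

Section NearMax.
Context {R : realType} {n : nat}.

(** The same pair competes at parameter $2\varepsilon$, where its penalty is halved. The gain is at
    most [Th2 - Th1 + tau], so the total penalty is small: $T\le t\varepsilon$. Both gradients are
    within $\sqrt\tau$ of $\pm z/\varepsilon$ with $|z|^2\le T$, which bounds their product with the
    distance. *)
Lemma near_max_estimates (Th1 Th2 eps tau t a b : R) (x y xi eta p q : 'cV[R]_n) :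
  0 < eps -> eps <= 1 / 3 -> 0 < t -> t <= 1 -> tau <= t / 8 -> tau <= t ^+ 2 ->
  Th2 - Th1 <= t / 8 -> a + b - sqd x y / (6 * (2 * eps)) <= Th2 ->
  Th1 - tau <= a + b - (sqd x xi + sqd xi eta + sqd y eta) / (2 * eps) ->
  dot (p - eps^-1 *: (xi - eta)) (p - eps^-1 *: (xi - eta)) <= tau ->
  dot (q + eps^-1 *: (xi - eta)) (q + eps^-1 *: (xi - eta)) <= tau ->
  [/\ `|y - x| ^+ 2 <= 3 * t * eps, mx_le (- q - p) (2 * t) &
      forall k, `|y - x| * `|(- q) k 0| <= 3 * t].
Proof.
move=> eps0 eps1 t0 t1 taut taut2 Thk ub near pt qt.
have [e eE] : exists e, e = `|y - x| by exists `|y - x|.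
have [z zE] : exists z, z = xi - eta by exists (xi - eta).
have s1 := sqd3_le x xi eta y.
have exy : e ^+ 2 <= sqd x y.
  by rewrite eE distrC; exact: vec_norm_sq_le.
have zT : dot z z <= sqd x xi + sqd xi eta + sqd y eta.
  by rewrite zE -/(sqd xi eta); move: (sqd_ge0 x xi) (sqd_ge0 y eta) => *; lra.
have [T TE] : exists T, T = sqd x xi + sqd xi eta + sqd y eta.
  by exists (sqd x xi + sqd xi eta + sqd y eta).
rewrite -TE in s1 zT near; rewrite -zE in pt qt; rewrite -eE.
have Tt : T <= t * eps.
  rewrite -ler_pdivrMr //.
  have e1 : T / (2 * eps) = T / eps / 2 by field; rewrite gt_eqF.
  have e2 : sqd x y / (6 * (2 * eps)) <= T / eps / 4.
    have -> : sqd x y / (6 * (2 * eps)) = sqd x y / 3 / eps / 4.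
      by field; rewrite gt_eqF.
    by rewrite ler_pM2r // ler_pM2r ?invr_gt0.
  move: near ub e2; rewrite e1; move: (T / eps) (sqd x y / _) => W S.
  by move: Thk taut => *; lra.
have ztau (w : 'cV[R]_n) k : dot w w <= tau -> `|w k 0| <= t.
  move=> wt; rewrite -(@ler_sqr _ _ t) ?nnegrE // ?(ltW t0) //.
  by rewrite real_normK ?num_real // (le_trans (coord_le_dot w k)) // (le_trans wt).
have pk k := ztau _ k pt; have qk k := ztau _ k qt.
have e0 : 0 <= e by rewrite eE.
have et : e ^+ 2 <= 3 * (t * eps) by move: (t * eps) exy s1 Tt => *; lra.
split; first by rewrite -mulrA.
- move=> i j; rewrite ord1.
  have -> : (- q - p) i 0 = - (q + eps^-1 *: z) i 0 - (p - eps^-1 *: z) i 0.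
    by rewrite !mxE; ring.
  apply: (le_trans (ler_normB _ _)); rewrite normrN.
  by have := pk i; have := qk i; lra.
- move=> k; have e1 : e <= 1.
    rewrite -(@ler_sqr _ _ 1) ?nnegrE // expr1n.
    have h : t * eps <= 1 / 3.
      by apply: le_trans eps1; rewrite ler_piMl // ltW.
    by move: (t * eps) h et => *; lra.
  have -> : (- q) k 0 = eps^-1 * z k 0 - (q + eps^-1 *: z) k 0 by rewrite !mxE; ring.
  have h1 : `|eps^-1 * z k 0 - (q + eps^-1 *: z) k 0| <= eps^-1 * `|z k 0| + t.
    apply: (le_trans (ler_normB _ _)); rewrite normrM gtr0_norm ?invr_gt0 //.
    by rewrite lerD2l.
  apply: (le_trans (ler_wpM2l e0 h1)); rewrite mulrDr.
  have h2 : e * t <= t by rewrite ler_piMl // ltW.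
  have h3 : e * (eps^-1 * `|z k 0|) <= 2 * t.
    rewrite mulrCA mulrC ler_pdivrMr // -[leRHS]mulrA.
    have h4 := sqr_ge0 (e - `|z k 0|).
    have h5 : `|z k 0| ^+ 2 <= T.
      by rewrite real_normK ?num_real // (le_trans (coord_le_dot z k)).
    have h6 : (e - `|z k 0|) ^+ 2 = e ^+ 2 - 2 * (e * `|z k 0|) + `|z k 0| ^+ 2 by ring.
    rewrite h6 in h4.
    move: (`|z k 0| ^+ 2) (e * _) (t * eps) h4 h5 exy s1 Tt => * ; lra.
  by move: (e * t) (e * _) h2 h3 => *; lra.
Qed.
End NearMax.

Lemma compact_modulus (R : realType) n (K : set 'cV[R]_n) (psi : 'cV[R]_n -> R) c :
  compact K -> (forall x, K x -> psi @ x --> psi x) -> 0 < c ->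
  exists C : R, 0 < C /\ forall x y, K x -> `|y - x| < C^-1 -> `|psi y - psi x| <= c.
Proof.
move=> cK psic c0.
pose Q C x := 0 < C /\ forall y, `|y - x| < C^-1 -> `|psi y - psi x| <= c.
have [||C CP] := @compact_bound _ _ K Q cK.
- move=> C C' x CC [C0 P]; split=> [|y yx]; first exact: lt_le_trans CC.
  by apply: P => //; apply: (lt_le_trans yx); rewrite lef_pV2 ?posrE // (lt_le_trans C0).
- move=> x Kx; have c2 : 0 < c / 2 by rewrite divr_gt0.
  have /nbhs_ballP[e /= e0 eP] :=
    @cvgr_dist_le _ _ _ _ (nbhs_filter x) _ _ (psic x Kx) _ c2.
  exists (2 / e); apply/nbhs_ballP; exists (e / 2); first by rewrite /= divr_gt0.
  move=> x' xx'; split=> [|y yx']; first by rewrite divr_gt0.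
  have bx' : ball x e x' by apply: le_ball xx'; move: e0; lra.
  have by' : ball x e y.
    rewrite -ball_normE /= distrC -[y](subrK x') -addrA.
    apply: (le_lt_trans (ler_normD _ _)); rewrite invf_div in yx'.
    by move: xx'; rewrite -ball_normE /= distrC; move: yx'; lra.
  have /= h1 := eP _ bx'; have /= h2 := eP _ by'.
  rewrite -[psi y](subrK (psi x)) -addrA (le_trans (ler_normD _ _)) //.
  by rewrite distrC; move: h1 h2; lra.
- have [[x Sx]|S0] := pselect (exists x, K x); last first.
    by exists 1; split=> // x y Sx; case: S0; exists x.
  have [C0 _] := CP x Sx.
  by exists C; split=> // x' y Sx' yx; have [_ P] := CP x' Sx'; exact: P.
Qed.

(** * Weak comparison: choice of constants and conclusion *)

Theorem theorem4p2 (R : realType) (n : nat)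
  (F0 : set (jet R n)) (f0 : jet R n -> R)
  (F0_subeq : const_subequation F0)
  (f0_cont : {within F0, continuous f0})
  (F0f0_compatible : compatible F0 f0)
  (F0f0_tame : tame F0 f0)
  (X : set 'cV[R]_n) (X_open : open X)
  (m : 'cV[R]_n -> jet R n -> jet R n -> R) (m_metric : bundle_metric X m)
  (F : set ('cV[R]_n * jet R n)) (f : 'cV[R]_n * jet R n -> R)
  (F_subeq : subequation X F)
  (f_cont : {within F, continuous f})
  (Ff_equiv : jet_equivalent X F f F0 f0)
  (psi : 'cV[R]_n -> R)
  (psi_cont : {within X, continuous psi})
  (psi_admissible : psi @` X `<=` f0 @` F0) :
  weak_comparison X m (inhomogeneous F f psi) X.
Proof.
have [g [h [L [ghL FE fE]]]] := Ff_equiv.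
have [gh Lsym _ _ _] := ghL.
(* The constant need not depend on the metric: [omega] is adapted to it later, on the compact
   closure of [Omega]. *)
exists 1 => // u v usub vsub Omega Omega_open K_compact KX bd x1 Kx1.
rewrite leNgt; apply/negP => pos.
have [u_lt u_usc _] := usub; have [v_lt v_usc _] := vsub.
have usc_K w : usc_on X w -> usc_within (closure Omega) w.
  move=> w_usc x Kx a wa; have := w_usc x (KX x Kx) a wa.
  rewrite !near_withinE; apply: filterS => y wy /KX; exact: wy.
have uK_lt x (Kx : closure Omega x) := u_lt x (KX x Kx).
have vK_lt x (Kx : closure Omega x) := v_lt x (KX x Kx).
have uK := usc_K u u_usc; have vK := usc_K v v_usc.
have [a1 [b1 [ux1 vx1 M0]]] : exists a b, [/\ u x1 = a%:E, v x1 = b%:E & 0 < a + b].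
  move: pos (uK_lt x1 Kx1) (vK_lt x1 Kx1).
  case: (u x1) => [a| |] //; case: (v x1) => [b| |] //.
  by rewrite -EFinD lte_fin => ab _ _; exists a, b.
have M2 : 0 < (a1 + b1) / 2 by rewrite divr_gt0.
have M4 : 0 < (a1 + b1) / 4 by rewrite divr_gt0.
have S_compact : compact (closure Omega `\` Omega).
  by rewrite setDE; apply: compact_closedI => //; exact: open_closedC.
have [Cb [Cb0 bdP]] := boundary_gap uK_lt vK_lt uK vK S_compact
  (@subDsetl _ _ _) M2 bd.
have [C [C1 boundP lipP]] := jet_equivalence_bounds X_open K_compact KX ghL.
have C0 : 0 < C by exact: lt_le_trans C1.
have [omega [om0 omP]] := metric_small X_open K_compact KX m_metric.
have [t0 [lam [t00 lam0 gapP]]] := @jet_gap R n C omega C1 om0.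
(* Near-maximum points will satisfy $a+b\ge(a_1+b_1)/2$, twice the value used here; the other half
   is lost to the neighbourhood of the dual jet. *)
have [ct ct0 tameP] := F0f0_tame _ _ M4 lam0.
have psic x : closure Omega x -> psi @ x --> psi x.
  move=> Kx; move: psi_cont; rewrite continuous_open_subspace //.
  by apply; rewrite inE; exact: KX.
(* [psi] varies twice, from [x] to [y] and from [y] to a neighbouring base point. *)
have ct2 : 0 < ct / 2 by rewrite divr_gt0.
have [Cp [Cp0 psiP]] := compact_modulus K_compact psic ct2.
have [t [t_gt0 tt0 t1]] : exists t, [/\ 0 < t, t <= t0 & t <= 1].
  by exists (Num.min t0 1); rewrite lt_min t00 !ge_min !lexx orbT ltr01.
have [tau [tau0 taut taut2 tauM]] : exists tau,
    [/\ 0 < tau, tau <= t / 8, tau <= t ^+ 2 & tau <= (a1 + b1) / 2].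
  exists (Num.min (t / 8) (Num.min (t ^+ 2) ((a1 + b1) / 2))).
  by split; rewrite ?lt_min ?M2 ?exprn_gt0 ?divr_gt0 // !ge_min !lexx ?orbT.
have [rho [rho0 rhoC rhoP rhob]] : exists rho : R,
    [/\ 0 < rho, rho <= C^-1, rho <= Cp^-1 & rho <= Cb^-1].
  exists (Num.min C^-1 (Num.min Cp^-1 Cb^-1)).
  by split; rewrite ?lt_min ?invr_gt0 ?C0 ?Cp0 ?Cb0 // !ge_min !lexx ?orbT.
have /choice[Th ThP] : forall eps : R, exists Theta : R, 0 < eps ->
    (forall x y a b, closure Omega x -> closure Omega y -> u x = a%:E -> v y = b%:E ->
      a + b - sqd x y / (6 * eps) <= Theta) /\
    (exists x y a b, [/\ closure Omega x, closure Omega y, u x = a%:E, v y = b%:E &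
      Theta = a + b - sqd x y / (6 * eps)]).
  move=> eps; have [eps0|/negP eps0] := boolP (0 < eps); last by exists 0.
  by have [T1 h1] :=
    doubling_max K_compact uK_lt vK_lt uK vK Kx1 ux1 vx1 eps0; exists T1.
have ThM eps : 0 < eps -> a1 + b1 <= Th eps.
  move=> eps0; have [ub _] := ThP eps eps0; move: (ub x1 x1 a1 b1 Kx1 Kx1 ux1 vx1).
  by rewrite /sqd subrr dot0r mul0r subr0.
have Thmono eps : 0 < eps -> Th eps <= Th (2 * eps).
  move=> eps0; have eps20 : 0 < 2 * eps by rewrite mulr_gt0.
  have [_ [x [y [a [b [Kx Ky ux vy ->]]]]]] := ThP eps eps0.
  have [ub _] := ThP _ eps20; apply: le_trans (ub x y a b Kx Ky ux vy).
  rewrite lerD2l lerN2 ler_wpM2l ?sqd_ge0 //.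
  by rewrite lef_pV2 ?posrE ?mulr_gt0 // ler_pM2l // ler_peMl ?ler1n // ltW.
(* The bound 1/3 gives $|x-y|\le1$, and the other one gives $|x-y|^2\le3t\varepsilon\le\rho^2/2$. *)
have e00 : 0 < Num.min (1 / 3) (rho ^+ 2 / 6).
  by rewrite lt_min !divr_gt0 // exprn_gt0.
have t80 : 0 < t / 8 by rewrite divr_gt0.
have [eps [eps0 epsle Thk]] := scale_pigeonhole ThM Thmono e00 t80.
move: epsle; rewrite le_min => /andP[eps1 epsrho].
have eps20 : 0 < 2 * eps by rewrite mulr_gt0.
have [ub1 max1] := ThP eps eps0; have [ub2 _] := ThP _ eps20.
have [x [y [xi [eta [p [q [A [B [a [b]]]]]]]]]] :=
  approx_sums eps0 K_compact uK vK uK_lt vK_lt ub1 max1 tau0.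
move=> [[Kx Ky ux vy] [[nearT pt qt [As Bs sums]] [nearx neary]]].
have [e2 qp eq] := near_max_estimates eps0 eps1 t_gt0 t1 taut taut2 Thk
  (ub2 x y a b Kx Ky ux vy) nearT pt qt.
have e_lt : `|y - x| < rho.
  rewrite -(@ltr_sqr _ `|y - x| rho) ?nnegrE // ?(ltW rho0) //.
  apply: (le_lt_trans e2); apply: (@le_lt_trans _ _ (3 * eps)).
    by rewrite -mulrA ler_pM2l // ler_piMl // ltW.
  by move: epsrho (exprn_gt0 2 rho0); clear; lra.
have ab : (a1 + b1) / 2 <= a + b.
  have T0 : 0 <= (sqd x xi + sqd xi eta + sqd y eta) / (2 * eps).
    by rewrite divr_ge0 ?(ltW eps20) // !addr_ge0 ?sqd_ge0.
  move: (_ / (2 * eps)) (ThM eps eps0) T0 nearT tauM.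
  by clear=> *; lra.
have Ox : Omega x.
  apply: contrapT => nOx.
  have [] := bdP x y (conj Kx nOx) Ky (lt_le_trans e_lt rhob).
  by rewrite ux vy -EFinD lte_fin ltNge ab.
have Oy : Omega y.
  apply: contrapT => nOy; rewrite distrC in e_lt.
  have [_] := bdP y x (conj Ky nOy) Kx (lt_le_trans e_lt rhob).
  by rewrite ux vy -EFinD lte_fin ltNge ab.
have nearO z : Omega z -> nbhs z (closure Omega).
  move=> Oz; have : nbhs z Omega by exact: open_nbhs_nbhs.
  by apply: filterS; exact: subset_closure.
have [Xx Xy] := (KX x Kx, KX y Ky).
have strict : strict_part m (inhomogeneous F f psi) 1 (x, (a, p, A)).
  apply: (subharmonic_jet usub Xx As ux).
  by have := nearO x Ox; apply: filterS2 nearx => z uz; exact: uz.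
have dualy : dual X (inhomogeneous F f psi) (y, (b, q, B)).
  apply: (subharmonic_jet vsub Xy Bs vy).
  by have := nearO y Oy; apply: filterS2 neary => z vz; exact: vz.
have nu0 : 0 < Num.min t Cp^-1 by rewrite lt_min t_gt0 invr_gt0.
have tau_t : tau <= t by move: taut t_gt0; clear; lra.
have [gxC hxC hC LC] := boundP x Kx; have [_ _ hyC _] := boundP y Ky.
have [glip hlip Llip] := lipP x y Kx (lt_le_trans e_lt rhoC).
apply: (dual_contradiction X_open ghL (const_P F0_subeq) (const_N F0_subeq) FE fE
  (ltW lam0) M4 nu0 Xx Xy _ tameP _ (fun d => omP x d Kx) _ strict dualy).
- by move: ab; clear; lra.
- move=> y'; rewrite lt_min => /andP[_ y'y].
  have h1 := psiP y y' Ky y'y; have h2 := psiP x y Kx (lt_le_trans e_lt rhoP).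
  move: (ler_norm (psi y' - psi y)) (ler_norm (psi y - psi x)) h1 h2.
  by clear=> *; lra.
- move=> kp kA kpn kAn kAs.
  have nt : Num.min t Cp^-1 <= t by rewrite ge_min lexx.
  have [gx hx] := gh x Xx.
  exact: (gapP t eps `|y - x| tau _ _ _ _ A B kA p (- q) kp (L x) (L y) t_gt0 tt0
    eps0 (normr_ge0 _) e2 (ltW tau0) tau_t gx hx (And4 gxC hxC hC hyC) glip hlip
    LC Llip (Lsym x Xx) (Lsym y Xy) (And3 As Bs kAs) qp eq (mx_leW nt kpn)
    (mx_leW nt kAn) sums).
Qed.
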